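(* For all $n\ge1$, let $m_n$ and $n_n$ be integers with $0\le n_n<m_n$, and let $N_n := m_n-n_n$. Suppose that $N_n\to+\infty$ and $m_n/N_n\to a\in[1,+\infty)$. Let $\lambda_n := (n_n/m_n)\exp(-n_n/m_n)\in[0,e^{-1})$, so that $\lambda_n\to\lambda := (1-1/a)\exp(-1+1/a)$, and suppose that $\lambda\ge(2e)^{-1}$. Put $\kappa := -\log(\lambda)-1$, $$\alpha := \kappa\sqrt2,\qquad \beta := 2\kappa\sqrt{\Big(1+\frac1\kappa\Big)\Big(1+\frac{1+\log2}{\kappa}\Big)}.$$ Let $X^{(n)}$ have the Borel distribution with parameter $\lambda_n$ (so that $\mathbb{E}[X^{(n)}]=m_n/N_n$), let $Y^{(n)}$ given $X^{(n)}=l$ be distributed as the total displacement $d_{l,l-1}$ for every integer $l\ge1$, and let $k_n := m_n$. Then, with $\sigma_{X^{(n)}} := \mathrm{Var}(X^{(n)})^{1/2}$: 1. $\log(\sigma_{X^{(n)}}) = o(N_n^{1/2})$; 2. $\mathbb{E}\big[|X^{(n)}-\mathbb{E}[X^{(n)}]|^3\big] = o\big(N_n^{1/2}\sigma_{X^{(n)}}^3\big)$; 3. there exists $c>0$ such that, for all $n\ge1$ and $s\in[-\pi,\pi]$, $\big|\mathbb{E}[e^{isX^{(n)}}]\big| \le 1 - c\,\sigma_{X^{(n)}}^2 s^2$; 4. $k_n = N_n\mathbb{E}[X^{(n)}] + O(\sigma_{X^{(n)}}N_n^{1/2})$; 5. $\mathrm{Var}(Y^{(n)}) = o(N_n^{1/2})$;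 6. for all $y>0$, $\liminf_{n\to\infty}\frac{1}{\sqrt{N_n y}}\log\mathbb{P}(Y^{(n)}\ge N_n y) \ge -\beta$ and $\limsup_{n\to\infty}\sup_{u\ge\sqrt{N_n y}}\frac{1}{\sqrt u}\log\mathbb{P}(Y^{(n)}\ge u) \le -\alpha$. Moreover, for all $y>0$, $$-\beta\sqrt y \le \liminf_{n\to\infty}\frac{1}{\sqrt{N_n}}\log\mathbb{P}\big(d_{m_n,n_n}-\mathbb{E}[d_{m_n,n_n}]\ge N_n y\big) \le \limsup_{n\to\infty}\frac{1}{\sqrt{N_n}}\log\mathbb{P}\big(d_{m_n,n_n}-\mathbb{E}[d_{m_n,n_n}]\ge N_n y\big)\le -\alpha\sqrt y.$$
   Context: Hashing with linear probing: for integers $0\le n<m$, $n$ balls are thrown sequentially into $m$ urns numbered $1,\dots,m$ and arranged in a circle; the addresses $h_1,\dots,h_n$ at which the balls land are independent and uniform on $\{1,\dots,m\}$. A ball that lands in an occupied urn is moved to the next empty urn, always moving in the same fixed direction (increasing numbers, cyclically). The length (number of steps) of the move is the displacement of the ball ($0$ if its urn was empty), and $d_{m,n}$ denotes the (random) sum of the displacements of all $n$ balls. Borel distribution with parameter $\lambda\in(0,e^{-1}]$: the law on $\{1,2,\dots\}$ given by $\mathbb{P}(X=l)=\frac{1}{T(\lambda)}\frac{\lambda^l l^{l-1}}{l!}$, where $T(\lambda)=\sum_{l\ge1}\frac{l^{l-1}\lambda^l}{l!}$ is the tree function. For parameter $\lambda=0$ it is understood as the Dirac mass at $1$. *)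

(* Defs.v *)
From HB Require Import structures.
From mathcomp Require Import all_boot all_order all_algebra.
From mathcomp Require Import all_classical all_reals all_analysis.
From mathcomp Require Import complex.

Set Implicit Arguments.
Unset Strict Implicit.
Unset Printing Implicit Defensive.

Import Order.TTheory GRing.Theory Num.Theory.
Import numFieldNormedType.Exports.

Local Open Scope classical_set_scope.
Local Open Scope ring_scope.

(** Linear probing.  The urns are the natural numbers 1, ..., m. *)

Definition next_urn (m k : nat) : nat := if (k < m)%N then k.+1 else 1%N.

(* As long as one of the m urns is empty, the search below [m] succeeds, and
   its result is the least [j] such that the urn [j] steps after [k] is not
   in [occ]. *)
Definition displacement (m : nat) (occ : seq nat) (k : nat) : nat :=
  find (fun j => iter j (next_urn m) k \notin occ) (iota 0 m).

Fixpoint linear_probing (m : nat) (occ hs : seq nat) : nat :=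
  if hs is k :: hs' then
    let j := displacement m occ k in
    (j + linear_probing m (iter j (next_urn m) k :: occ) hs')%N
  else 0%N.

Definition total_displacement (m : nat) (hs : seq nat) : nat :=
  linear_probing m [::] hs.

Section Probability.
Context d (T : measurableType d) (R : realType) (P : probability T R).

Definition uniform_on_urns (m : nat) (X : {RV P >-> nat}) : Prop :=
  forall k : nat,
    P (X @^-1` [set k]) = (if (1 <= k <= m)%N then m%:R^-1 else 0)%:E.

(* Every subset of [nat] is measurable. *)
Definition mutually_independent (n : nat) (X : 'I_n -> {RV P >-> nat}) : Prop :=
  forall (J : {set 'I_n}) (A : 'I_n -> set nat),
    P (\bigcap_(i in [set` J]) (X i @^-1` A i)) =
    (\prod_(i in J) P (X i @^-1` A i))%E.

Definition hash_displacement (m n : nat) (h : 'I_n -> {RV P >-> nat}) (w : T)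
    : nat :=
  total_displacement m [seq h i w | i <- enum 'I_n].

Definition tree_function (lam : R) : R :=
  limn (fun n => \sum_(1 <= l < n) l%:R ^+ l.-1 * lam ^+ l / l`!%:R).

Definition borel_pmf (lam : R) (l : nat) : R :=
  if lam == 0 then (l == 1%N)%:R
  else if l == 0%N then 0
  else (tree_function lam)^-1 * (lam ^+ l * l%:R ^+ l.-1 / l`!%:R).

Definition has_borel_law (lam : R) (X : {RV P >-> nat}) : Prop :=
  forall l : nat, P (X @^-1` [set l]) = (borel_pmf lam l)%:E.

Definition real_of (X : T -> nat) : T -> R := fun w => (X w)%:R.

Definition stddev (X : T -> R) : R := Num.sqrt (fine 'V_P[X]).

(* E[exp(isX)], by Euler's formula. *)
Definition char_fun (X : T -> R) (s : R) : R[i] :=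
  Complex (fine 'E_P[fun w => cos (s * X w)]) (fine 'E_P[fun w => sin (s * X w)]).

End Probability.

(* f = o(g) as n tends to infinity.  The values of [f] are extended reals so
   that an infinite moment, or the logarithm of 0, is not sent to 0. *)
Definition elittleo (R : realType) (f : nat -> \bar R) (g : nat -> R) : Prop :=
  forall eps : R, 0 < eps ->
    \forall n \near \oo, (`|f n| <= (eps * `|g n|)%:E)%E.

(* Main.v *)
(* The balls are grouped in blocks, each a run of occupied urns closed by an empty
   urn. Rotating the circle so that the last urn is empty, the law of d_{m,n}
   becomes that of a sum of N = m - n i.i.d. copies of Y conditioned on the sum of
   the N block lengths, i.i.d. copies of X, being m. For the Borel parameter in
   force this event has probability at least 1/(e m^2), so conditioning costs a
   factor that is negligible on the scale exp(sqrt N).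

   Upper bounds: a block of length l has displacement at most l^2/2, so that for
   the total displacement to be large either some block is longer than
   sqrt(2 N y), at a cost of about kappa per urn, or a Chernoff bound applies to
   the blocks truncated at that length. Lower bounds: the addresses
   1, 1, 2, 2, ..., w, w, w + 1, ..., u, in any order, displace balls by at least
   u w; one such block costs (kappa + 1)(u + w) + w log 2, and minimizing under
   u w = N y gives beta.

   The normalization of the Borel weights comes from powers: writing S for their
   total mass, S^N is at most affine in N, because the sum of N lengths takes few
   values, and at least the inverse of a polynomial in N, because such a
   sum equals m with polynomial probability; hence S = 1. Differentiating this
   identity in the parameter gives the mean. *)

Require Import Defs.
From HB Require Import structures.
From mathcomp Require Import all_boot all_order all_algebra.
From mathcomp Require Import all_classical all_reals all_analysis.
From mathcomp Require Import complex.
From mathcomp Require Import measurable_realfun.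
From mathcomp Require Import ring lra zify.

Set Implicit Arguments.
Unset Strict Implicit.
Unset Printing Implicit Defensive.

Import Order.TTheory GRing.Theory Num.Theory.
Import numFieldNormedType.Exports.

Local Open Scope classical_set_scope.
Local Open Scope ring_scope.

(** * Linear probing on lists of addresses *)

Section LinearProbing.
Local Open Scope nat_scope.
Implicit Types (m k l x j n : nat) (occ hs w u v s : seq nat).

(** The Borel parameter is written as [x * expR (- x)] with [x = n / m]; since the tree function
    sends it back to [x], the law takes the explicit form [bpmf x], whose tail has ratio
    [x * expR (1 - x)]. This ratio tends to [expR (- kappa)], which is why [kappa] is the cost per
    urn. Given the sum of the lengths, the law does not depend on [x]; the choice [x = n / m]
    centres the Poisson mass that governs the conditioning, so its probability is only polynomially
    small. Blocks longer than [m] cannot occur, hence block expectations are finite sums over lists,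
    and probability spaces enter late.

    In the upper bound a Chernoff parameter [theta] is usable on the lengths [l] with
    [theta * l ^ 2 / 2 <= kappa * l]; truncating near [sqrt (2 N y)] makes both contributions close
    to [exp (- kappa * sqrt (2 N y))].

    The deviations are centred at the mean of the conditioned sum, which is not exactly [N] times
    the block mean. The two agree up to [o(N)], as follows from the tail bounds themselves, and a
    slight change of [y] absorbs the difference. *)

Definition in_urns m s := all (fun x => 1 <= x <= m) s.

Fixpoint occ_after m occ hs : seq nat :=
  if hs is k :: hs' then
    occ_after m (iter (displacement m occ k) (next_urn m) k :: occ) hs'
  else occ.

(** If urn [m] is empty at the end, no ball has moved from urn [m] to urn 1, so the circle acts as a
    line. It holds for [m = 0] without balls: this is what remains after the last block. *)
Definition confined m w := m \notin occ_after m [::] w.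

Lemma iter_next_urn m k j : 1 <= k <= m -> j <= m ->
  iter j (next_urn m) k = if k + j <= m then k + j else k + j - m.
Proof.
move=> km; elim: j => [|j IH] jm /=.
  by rewrite addn0; case: ifP => //; move: km => /andP[_ ->].
rewrite IH; last by lia.
by rewrite /next_urn; case: (leqP (k + j) m) => h1; case: ifP => h2; case: ifP; lia.
Qed.

Lemma iter_next_urn_le m k j : iter j (next_urn m) k <= k + j.
Proof.
elim: j => [|j] /=; first by rewrite addn0.
by move: (iter _ _ _) => y; rewrite /next_urn; case: ifP; lia.
Qed.

Lemma next_urn_in m k : 1 <= k <= m -> 1 <= next_urn m k <= m.
Proof. by rewrite /next_urn; case: ifP; lia. Qed.

Lemma iter_next_urn_in m k j : 1 <= k <= m -> 1 <= iter j (next_urn m) k <= m.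
Proof. by move=> km; elim: j => //= j /next_urn_in. Qed.

Lemma displacement_le m occ k : displacement m occ k <= m.
Proof. by rewrite /displacement -[leqRHS](size_iota 0 m) find_size. Qed.

Lemma before_displacement m occ k i :
  i < displacement m occ k -> iter i (next_urn m) k \in occ.
Proof.
move=> id; have im := leq_trans id (displacement_le m occ k).
have := before_find 0 id; rewrite nth_iota ?add0n// => /negbT.
by rewrite negbK.
Qed.

Lemma landing_free m occ k x : 1 <= k <= m -> 1 <= x <= m -> x \notin occ ->
  iter (displacement m occ k) (next_urn m) k \notin occ.
Proof.
move=> km xm xo.
have hh : has (fun j => iter j (next_urn m) k \notin occ) (iota 0 m).
  apply/hasP; exists (if k <= x then x - k else x + m - k).
    by rewrite mem_iota; case: ifP; lia.
  rewrite iter_next_urn//; last by case: ifP; lia.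
  set y := (X in X \notin _); suff -> : y = x by [].
  by rewrite /y; case: (leqP k x) => h; case: ifP; lia.
have := nth_find 0 hh; rewrite nth_iota ?add0n//.
by move: hh; rewrite has_find size_iota.
Qed.

(** Only the urns from [k] to an empty urn [x] are read, whatever the size [m] of the circle.
    [linear_probing_split] compares two circles in this way. *)
Lemma displacement_nowrap m occ k x : 1 <= k <= x -> x <= m -> x \notin occ ->
  exists j, [/\ k + j <= x, k + j \notin occ,
    (forall i, i < j -> k + i \in occ) &
    displacement m occ k = j /\ iter j (next_urn m) k = k + j].
Proof.
move=> kx xm xo.
have ex : exists j, k + j \notin occ by exists (x - k); rewrite subnKC//; lia.
case: (ex_minnP ex) => j jo jmin; have jx : k + j <= x.
  by have := jmin (x - k); rewrite subnKC ?xo; [move=> /(_ isT); lia|lia].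
have bef i : i < j -> k + i \in occ.
  by move=> ij; apply/negPn/negP => /jmin; lia.
have it i : k + i <= m -> iter i (next_urn m) k = k + i.
  by move=> ki; rewrite iter_next_urn ?ki//; lia.
exists j; split=> //; split; last by apply: it; lia.
apply/eqP; rewrite eqn_leq; apply/andP; split; rewrite leqNgt; apply/negP => h.
  by have := before_displacement h; rewrite it ?(negbTE jo)//; lia.
have dm : displacement m occ k < m by lia.
have hh : has (fun j => iter j (next_urn m) k \notin occ) (iota 0 m).
  by rewrite has_find size_iota.
have := nth_find 0 hh; rewrite nth_iota ?add0n// -/(displacement m occ k).
by rewrite it ?bef//; lia.
Qed.

(** The urns passed on the way are all occupied, and distinct because the ball makes at most [m]
    steps. *)
Lemma displacement_le_size m occ k : 1 <= k <= m ->
  displacement m occ k <= size occ.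
Proof.
move=> km; set j := displacement m occ k.
rewrite -[leqLHS](size_iota 0) -(size_map (fun i => iter i (next_urn m) k)).
apply: uniq_leq_size.
  rewrite map_inj_in_uniq ?iota_uniq// => a b; rewrite !mem_iota => ha hb.
  have jm := displacement_le m occ k; rewrite -/j in jm.
  rewrite !iter_next_urn//; try lia.
  by case: ifP; case: ifP; lia.
move=> y /mapP[j' + ->]; rewrite mem_iota => /andP[_ ij].
exact: before_displacement.
Qed.

(** A ball that finds [s] urns occupied moves at most [s] steps, and [2 * s <= (s + 1) ^ 2 - s ^ 2]:
    the squares telescope. *)
Lemma linear_probing_le m occ hs : in_urns m hs ->
  2 * linear_probing m occ hs + size occ ^ 2 <= (size occ + size hs) ^ 2.
Proof.
elim: hs occ => [|k hs IH] occ /=; first by rewrite addn0.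
case/andP=> km /(IH (iter (displacement m occ k) (next_urn m) k :: occ)) /=.
have := displacement_le_size occ km; set j := displacement _ _ _.
by set L := linear_probing _ _ _; rewrite -!mulnn; nia.
Qed.

Lemma total_displacement_le m w : in_urns m w ->
  2 * total_displacement m w <= size w ^ 2.
Proof. by move/(@linear_probing_le _ [::]); rewrite /= add0n addn0. Qed.

Lemma sumn_occ_after_le m occ hs :
  sumn (occ_after m occ hs) <= sumn occ + sumn hs + linear_probing m occ hs.
Proof.
elim: hs occ => [|k hs IH] occ /=; first by rewrite !addn0.
apply: (leq_trans (IH _)) => /=.
by have := iter_next_urn_le m k (displacement m occ k); lia.
Qed.

Lemma occ_after_mono m occ hs x : x \in occ -> x \in occ_after m occ hs.
Proof.
by elim: hs occ => //= k hs IH occ xo; apply: IH; rewrite inE xo orbT.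
Qed.

Lemma size_occ_after m occ hs : size (occ_after m occ hs) = size occ + size hs.
Proof. by elim: hs occ => [|k hs IH] occ /=; rewrite ?addn0// IH /= addSnnS. Qed.

Lemma in_urns_occ_after m occ hs : in_urns m hs -> in_urns m occ ->
  in_urns m (occ_after m occ hs).
Proof.
elim: hs occ => //= k hs IH occ /andP[km hsm] om; apply: IH => //=.
by rewrite om andbT iter_next_urn_in.
Qed.

Lemma uniq_occ_after m occ hs x : in_urns m hs -> 1 <= x <= m ->
  x \notin occ_after m occ hs -> uniq occ -> uniq (occ_after m occ hs).
Proof.
elim: hs occ => //= k hs IH occ /andP[km hsm] xm xf uo; apply: IH => //=.
rewrite uo andbT (landing_free km xm)//.
apply: contra xf => xo; apply: occ_after_mono.
by rewrite inE xo orbT.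
Qed.

Lemma exists_empty_urn m w : in_urns m w -> size w < m ->
  exists2 x, 1 <= x <= m & x \notin occ_after m [::] w.
Proof.
move=> wm wlt; set fin := occ_after m [::] w.
have : ~~ all (mem fin) (iota 1 m).
  apply/negP => /allP sub; have := uniq_leq_size (iota_uniq 1 m) sub.
  by rewrite size_iota size_occ_after add0n; lia.
by case/allPn => x; rewrite mem_iota => xm xf; exists x => //; lia.
Qed.

Lemma uniq_final m w : in_urns m w -> size w < m ->
  uniq (occ_after m [::] w).
Proof.
by move=> wm /(exists_empty_urn wm)[x xm xf]; apply: uniq_occ_after xf _.
Qed.

Lemma sumn_iota1 m : 2 * sumn (iota 1 m) = m * m.+1.
Proof.
elim: m => // m IH; rewrite -[in iota _ _](addn1 m) iotaD sumn_cat mulnDr IH /=; lia.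
Qed.

(** The [m - 1] balls fill all urns but one, so their final positions sum to at least
    [m * (m + 1) / 2 - m]. A position exceeds the address by at most the displacement, so small
    addresses force a large displacement. *)
Lemma linear_probing_ge m w : in_urns m w -> size w = m.-1 -> 0 < m ->
  m * m.-1 <= 2 * (sumn w + total_displacement m w).
Proof.
move=> wm sw m0; have wlt : size w < m by lia.
have [x xm xf] := exists_empty_urn wm wlt.
set fin := occ_after m [::] w in xf.
have ux : uniq (x :: fin) by rewrite /= xf; apply: uniq_final.
have := uniq_min_size ux (_ : {subset x :: fin <= iota 1 m}).
rewrite /= size_occ_after add0n sw size_iota; case.
- move=> y; rewrite inE => /orP[/eqP->|yf]; first by rewrite mem_iota; lia.
  by have /allP/(_ y yf) := in_urns_occ_after wm (isT : in_urns _ [::]); rewrite mem_iota; lia.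
- by lia.
move=> _ eqs; have pe : perm_eq (x :: fin) (iota 1 m).
  by apply: uniq_perm => //; apply: iota_uniq.
have := sumn_iota1 m; rewrite -(perm_sumn pe) /=.
have := sumn_occ_after_le m [::] w; rewrite -/fin /total_displacement /=.
by nia.
Qed.

Lemma mem_map_next_urn m s x : in_urns m s -> 1 <= x <= m ->
  (next_urn m x \in map (next_urn m) s) = (x \in s).
Proof.
move=> /allP sm xm; apply/mapP/idP => [[y ys]|xs]; last by exists x.
have /= ym := sm _ ys; rewrite /next_urn => e; suff -> : x = y by [].
by move: e; case: ifP; case: ifP; lia.
Qed.

Lemma iter_next_urnS m j k :
  iter j (next_urn m) (next_urn m k) = next_urn m (iter j (next_urn m) k).
Proof. by rewrite -iterSr. Qed.

Lemma displacement_rot m occ k : in_urns m occ -> 1 <= k <= m ->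
  displacement m (map (next_urn m) occ) (next_urn m k) = displacement m occ k.
Proof.
move=> om km; rewrite /displacement; apply: eq_find => j.
by rewrite iter_next_urnS mem_map_next_urn// iter_next_urn_in.
Qed.

Lemma linear_probing_rot m occ hs : in_urns m occ -> in_urns m hs ->
  linear_probing m (map (next_urn m) occ) (map (next_urn m) hs) =
    linear_probing m occ hs /\
  occ_after m (map (next_urn m) occ) (map (next_urn m) hs) =
    map (next_urn m) (occ_after m occ hs).
Proof.
elim: hs occ => //= k hs IH occ om /andP[km hsm].
rewrite displacement_rot// iter_next_urnS -map_cons.
set p := iter _ _ _.
have pm : in_urns m (p :: occ) by rewrite /= om andbT iter_next_urn_in.
by have [-> ->] := IH _ pm hsm.
Qed.

Definition agree_upto l occ1 occ :=
  forall x, 1 <= x <= l -> (x \in occ1) = (x \in occ).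
(** The clause [0 \notin occ2] serves the case [l = m], where the second circle is empty and its
    last urn [m - l] is 0. *)
Definition agree_from l m occ2 occ :=
  (forall x, 1 <= x <= m - l -> (x \in occ2) = (x + l \in occ)) /\ 0 \notin occ2.

Lemma agree_from_last l m occ2 occ : l <= m -> agree_from l m occ2 occ ->
  m \notin occ -> m - l \notin occ2.
Proof.
move=> lm [ag o2] mo; have [->//|lt0] := posnP (m - l).
by rewrite ag ?lt0 ?leqnn// subnK.
Qed.

(* Urns [l] and [m] stay empty on the circle of [m] urns if and only if urn
   [l] stays empty on the circle of the first [l] urns and the last urn stays
   empty on the circle of the remaining [m - l] urns; the two groups of balls
   then never interact. *)
Lemma linear_probing_split l m occ occ1 occ2 hs : l <= m ->
  in_urns m hs -> agree_upto l occ1 occ -> agree_from l m occ2 occ ->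
  l \notin occ -> m \notin occ -> 0 < l ->
  let u := [seq k <- hs | k <= l] in
  let v := map (subn^~ l) [seq k <- hs | ~~ (k <= l)] in
  let empty_after :=
    (l \notin occ_after m occ hs) && (m \notin occ_after m occ hs) in
  let empty_after' := (l \notin occ_after l occ1 u) &&
    (m - l \notin occ_after (m - l) occ2 v) in
  empty_after = empty_after' /\
  (empty_after ->
     linear_probing m occ hs =
       linear_probing l occ1 u + linear_probing (m - l) occ2 v /\
     agree_upto l (occ_after l occ1 u) (occ_after m occ hs)).
Proof.
move=> lm; elim: hs occ occ1 occ2 => [|k hs IH] occ occ1 occ2 /=.
  move=> _ ag1 ag2 lo mo l0; split=> //.
  by rewrite lo mo ag1 ?lo ?(agree_from_last lm ag2)// l0 leqnn.
case/andP=> km hsm ag1 ag2 lo mo l0.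
case: (leqP k l) => kl /=.
- have [j [kjl kjo bef [dj ij]]] := @displacement_nowrap m occ k l ltac:(lia) lm lo.
  have lo1 : l \notin occ1 by rewrite ag1 ?lo//; lia.
  have [j1 [kjl1 kjo1 bef1 [dj1 ij1]]] :=
    @displacement_nowrap l occ1 k l ltac:(lia) (leqnn _) lo1.
  have jj : j1 = j.
    have [lt|lt|//] := ltngtP j1 j.
      by have := bef _ lt; rewrite -ag1 ?(negbTE kjo1)//; lia.
    by have := bef1 _ lt; rewrite ag1 ?(negbTE kjo)//; lia.
  rewrite dj ij dj1 ij1 jj.
  have ag1' : agree_upto l (k + j :: occ1) (k + j :: occ).
    by move=> x xl; rewrite !inE ag1.
  have ag2' : agree_from l m occ2 (k + j :: occ).
    split; last by case: ag2.
    move=> x xl; rewrite inE ag2.1//.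
    by case: eqP => //; lia.
  (* A ball that fills urn [l] makes both sides false for good. Otherwise [l] is still empty and the
     induction hypothesis applies. *)
  have [e|ne] := eqVneq (k + j) l.
    by rewrite !(occ_after_mono _ _ (_ : l \in k + j :: _)) ?inE ?e ?eqxx.
  have [||e H] := IH _ _ _ hsm ag1' ag2' _ _ l0.
  + by rewrite inE negb_or lo andbT eq_sym.
  + by rewrite inE negb_or mo andbT; apply/eqP; lia.
  by split=> // /H[-> ?]; split=> //; rewrite addnA.
- have [j [kjl kjo bef [dj ij]]] := @displacement_nowrap m occ k m ltac:(lia) (leqnn _) mo.
  have mo2 := agree_from_last lm ag2 mo.
  have [j1 [kjl1 kjo1 bef1 [dj1 ij1]]] :=
    @displacement_nowrap (m - l) occ2 (k - l) (m - l) ltac:(lia) (leqnn _) mo2.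
  have kl' i : k - l + i + l = k + i by lia.
  have jj : j1 = j.
    have [lt|lt|//] := ltngtP j1 j.
      by have := bef _ lt; rewrite -kl' -ag2.1 ?(negbTE kjo1)//; lia.
    by have := bef1 _ lt; rewrite ag2.1 ?kl' ?(negbTE kjo)//; lia.
  rewrite dj ij dj1 ij1 jj.
  have ag1' : agree_upto l occ1 (k + j :: occ).
    by move=> x xl; rewrite !inE ag1//; case: eqP => //; lia.
  have ag2' : agree_from l m (k - l + j :: occ2) (k + j :: occ).
    split; last by rewrite inE negb_or ag2.2 andbT; apply/eqP; lia.
    move=> x xl; rewrite !inE ag2.1//; congr orb.
    by apply/eqP/eqP; lia.
  have [e|ne] := eqVneq (k + j) m.
    rewrite (occ_after_mono _ _ (_ : m \in k + j :: _)) ?inE ?e ?eqxx// andbF.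
    rewrite (occ_after_mono _ _ (_ : m - l \in k - l + j :: _)) ?andbF// inE.
    by apply/orP; left; apply/eqP; lia.
  have [||e H] := IH _ _ _ hsm ag1' ag2' _ _ l0.
  + by rewrite inE negb_or lo andbT; apply/eqP; lia.
  + by rewrite inE negb_or mo andbT eq_sym.
  by split=> // /H[-> ?]; split=> //; lia.
Qed.

Definition low l w := [seq k <- w | k <= l].
Definition high l w := map (subn^~ l) [seq k <- w | ~~ (k <= l)].

Lemma in_urns_low l m w : in_urns m w -> in_urns l (low l w).
Proof.
move=> /allP wm; apply/allP => x; rewrite mem_filter => /andP[xl /wm]/=; lia.
Qed.

(** When [l - 1] balls have addresses up to [l] and urn [l] stays empty, they fill the urns before
    [l]. The right-hand side thus says that [l] is the first empty urn, which singles out one [l] in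
    [confined_first_empty]. *)
Lemma confined_split l m w : 1 <= l <= m -> in_urns m w ->
  size (low l w) = l.-1 ->
  confined l (low l w) && confined (m - l) (high l w) =
    (confined m w &&
     [forall i : 'I_l.-1, (i.+1 \in occ_after m [::] w)] &&
     (l \notin occ_after m [::] w)) /\
  (confined l (low l w) && confined (m - l) (high l w) ->
   total_displacement m w =
   total_displacement l (low l w) + total_displacement (m - l) (high l w)).
Proof.
move=> lm wm sz.
have := @linear_probing_split l m [::] [::] [::] w ltac:(lia) wm.
move=> /(_ (fun=> fun=> erefl)) /(_ (conj (fun=> fun=> erefl) isT)) /(_ isT isT).
move=> /(_ ltac:(lia)) /= [e H].
rewrite /confined -/(low l w) -/(high l w) in e H *; rewrite -e; split; last first.
  by move=> /H[].
have [h|h] := boolP (_ && _); last first.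
  by apply/esym/negbTE; apply: contra h => /andP[/andP[-> _] ->].
have [_ ag] := H h; have := h; rewrite e => /andP[ll mm].
have /andP[-> ->] := h; rewrite andbT /=; apply/esym.
apply/forallP => i; rewrite -ag; last by have := ltn_ord i; lia.
have ul := in_urns_low l wm.
have uf := @uniq_occ_after l [::] _ l ul ltac:(lia) ll isT.
have sub : {subset occ_after l [::] (low l w) <= iota 1 l.-1}.
  move=> y yf; have /allP/(_ y yf) /= := in_urns_occ_after ul (isT : in_urns _ [::]).
  rewrite mem_iota; suff : y != l by move/eqP; lia.
  by apply: contraNneq ll => yl; rewrite yl in yf.
have [] := uniq_min_size uf sub.
  by rewrite size_iota size_occ_after sz.
by move=> _ ->; rewrite mem_iota; have := ltn_ord i; lia.
Qed.
End LinearProbing.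

(** * Sums over address lists: rotation, shuffles and the first empty urn *)

Section Words.
Local Open Scope nat_scope.
Variable R : comNzRingType.
Implicit Types (m k l n r : nat) (w u v s : seq nat).

Fixpoint words s n : seq (seq nat) :=
  if n is n'.+1 then [seq a :: w | a <- s, w <- words s n'] else [:: [::]].

Lemma mem_words s n w : w \in words s n -> size w = n /\ {subset w <= s}.
Proof.
elim: n w => [|n IH] w /=; first by rewrite inE => /eqP->.
case/allpairsP => -[a v] /= [as_ /IH[sv vs] ->] /=; rewrite sv; split=> //.
by move=> x; rewrite inE => /orP[/eqP->//|/vs].
Qed.

Lemma words_in_urns m n w : w \in words (iota 1 m) n -> in_urns m w.
Proof.
case/mem_words => _ sub; apply/allP => x /sub; rewrite mem_iota; lia.
Qed.

Lemma words_uniq s n : uniq s -> uniq (words s n).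
Proof.
move=> us; elim: n => //= n IH; apply: allpairs_uniq => //.
by move=> [a v] [b w] _ _ /= [-> ->].
Qed.

Lemma size_words s n : size (words s n) = size s ^ n.
Proof. by elim: n => //= n IH; rewrite size_allpairs IH expnS. Qed.

Local Open Scope ring_scope.
Implicit Types F : seq nat -> R.

Lemma sum_wordsS s n F : \sum_(w <- words s n.+1) F w =
  \sum_(a <- s) \sum_(w <- words s n) F (a :: w).
Proof. by rewrite /= big_allpairs_dep. Qed.

Lemma sum_words0 s F : \sum_(w <- words s 0) F w = F [::].
Proof. by rewrite /= big_seq1. Qed.

Lemma sum_words_map (g : nat -> nat) s n F :
  \sum_(w <- words (map g s) n) F w = \sum_(w <- words s n) F (map g w).
Proof.
elim: n F => [|n IH] F; first by rewrite !sum_words0.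
by rewrite !sum_wordsS big_map; apply: eq_bigr => a _; rewrite IH.
Qed.

Lemma sum_words_perm s s' n F : perm_eq s s' ->
  \sum_(w <- words s n) F w = \sum_(w <- words s' n) F w.
Proof.
move=> ss'; elim: n F => [|n IH] F; first by rewrite !sum_words0.
by rewrite !sum_wordsS (perm_big _ ss'); apply: eq_bigr => a _; rewrite IH.
Qed.

Lemma perm_next_urn m : perm_eq (map (next_urn m) (iota 1 m)) (iota 1 m).
Proof.
case: m => // m; have e0 : iota 1 m.+1 = iota 1 m ++ [:: m.+1].
  by rewrite -[in LHS](addn1 m) iotaD add1n.
have e : map (next_urn m.+1) (iota 1 m) = iota 2 m.
  rewrite -[in RHS](addn1 1) iotaDl; apply/eq_in_map => x.
  by rewrite mem_iota /next_urn; case: ifP => //; lia.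
rewrite [X in map _ X]e0 map_cat e /= [next_urn _ _]/next_urn ltnn.
by rewrite -[1 :: _]cat1s perm_catC.
Qed.

Lemma sum_words_next_urn m n F :
  \sum_(w <- words (iota 1 m) n) F w =
  \sum_(w <- words (iota 1 m) n) F (map (next_urn m) w).
Proof. by rewrite -sum_words_map; apply/esym/sum_words_perm/perm_next_urn. Qed.

(* By rotation invariance each urn is empty at the end in the same proportion
   [(m - n) / m] of cases, independently of the total displacement. *)
Lemma sum_confined m n (G : nat -> R) : (n < m)%N ->
  m%:R * (\sum_(w <- words (iota 1 m) n)
            (confined m w)%:R * G (total_displacement m w)) =
  (m - n)%:R * \sum_(w <- words (iota 1 m) n) G (total_displacement m w).
Proof.
move=> nm; pose S k := \sum_(w <- words (iota 1 m) n)
  (k \notin occ_after m [::] w)%:R * G (total_displacement m w).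
have Snext k : (1 <= k <= m)%N -> S (next_urn m k) = S k.
  move=> km; rewrite /S sum_words_next_urn.
  apply: eq_big_seq => w /words_in_urns wm.
  have [e1 e2] := linear_probing_rot (isT : in_urns m [::]) wm.
  by rewrite /total_displacement e1 e2 mem_map_next_urn// in_urns_occ_after.
have SE k : (1 <= k <= m)%N -> S k = S m.
  have m1 : (1 <= m <= m)%N by lia.
  move=> km; have -> : k = iter k (next_urn m) m.
    by rewrite iter_next_urn//; [case: ifP; lia|lia].
  by elim: k {km} => //= k IH; rewrite Snext ?iter_next_urn_in.
(* Summing [S k] over all urns counts each list once for every urn left empty, that is [m - n]
   times. *)
have -> : m%:R * S m = \sum_(k <- iota 1 m) S k.
  rewrite (eq_big_seq (fun=> S m)); last first.
    by move=> k; rewrite mem_iota => km; apply: SE; lia.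
  by rewrite big_const_seq count_predT size_iota iter_addr_0 mulr_natl.
rewrite /S exchange_big /= mulr_sumr; apply: eq_big_seq => w ww.
have wm := words_in_urns ww; have [sw _] := mem_words ww.
rewrite -mulr_suml -natr_sum; congr (_%:R * _).
set fin := occ_after m [::] w.
have uf : uniq fin by apply: uniq_final; rewrite // sw.
rewrite -big_mkcond sum1_count.
have := count_predC (mem fin) (iota 1 m); rewrite size_iota.
suff -> : count (mem fin) (iota 1 m) = n.
  by move=> e; rewrite -[in RHS]e addKn.
rewrite -size_filter -sw -[RHS]add0n -(size_occ_after m [::] w).
apply/perm_size/uniq_perm; rewrite ?filter_uniq ?iota_uniq//.
move=> y; rewrite mem_filter /=; case yf : (y \in fin) => //=.
have /allP/(_ y yf) /= := in_urns_occ_after wm (isT : in_urns _ [::]).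
by rewrite mem_iota; lia.
Qed.

(** A word is determined by its two subwords and by the set of positions of the first one. In the
    induction on the first letter this is Pascal's rule. *)
Lemma sum_words_shuffle (P : pred nat) s1 s2 n r (K : seq nat -> seq nat -> R) :
  all P s1 -> all (predC P) s2 ->
  \sum_(w <- words (s1 ++ s2) n) (size [seq a <- w | P a] == r)%:R *
     K [seq a <- w | P a] [seq a <- w | ~~ P a] =
  'C(n, r)%:R *
  \sum_(u <- words s1 r) \sum_(v <- words s2 (n - r)) K u v.
Proof.
move=> /allP P1 /allP P2; elim: n r K => [|n IH] r K.
  rewrite sum_words0 /=; case: r => [|r]; last by rewrite bin0n !mul0r.
  by rewrite bin0 !mul1r !sum_words0.
rewrite sum_wordsS big_cat /=.
have -> : \sum_(a <- s2) \sum_(w <- words (s1 ++ s2) n)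
    (size [seq b <- a :: w | P b] == r)%:R *
      K [seq b <- a :: w | P b] [seq b <- a :: w | ~~ P b] =
  'C(n, r)%:R * \sum_(u <- words s1 r) \sum_(v <- words s2 (n.+1 - r)) K u v.
  (* For [r > n] the truncated [n.+1 - r] is no longer the successor of [n - r], but the binomial
     coefficient vanishes. *)
  have [rn|nr] := leqP r n; last first.
    rewrite bin_small// mul0r big1_seq// => a /andP[_ /P2 /= Pa].
    rewrite (negbTE Pa) /= -[RHS](mul0r (\sum_(u <- words s1 r)
      \sum_(v <- words s2 (n - r)) K u (a :: v))).
    by rewrite (IH r (fun u v => K u (a :: v))) bin_small.
  rewrite subSn//.
  under [in RHS]eq_bigr do rewrite sum_wordsS.
  rewrite [in RHS]exchange_big mulr_sumr /=; apply: eq_big_seq => a /P2 /= Pa.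
  by rewrite (negbTE Pa) /= (IH r (fun u v => K u (a :: v))).
case: r => [|r].
  rewrite !bin0 big1_seq ?add0r// => a /andP[_ /P1 Pa].
  by rewrite big1// => w _; rewrite Pa /= mul0r.
rewrite binS natrD mulrDl addrC subSS; congr (_ + _).
rewrite sum_wordsS mulr_sumr; apply: eq_big_seq => a /P1 Pa.
by rewrite Pa /= (IH r (fun u v => K (a :: u) v)).
Qed.

(** No ball crosses the empty urn [l], so the balls addressed up to [l] are those that end in the
    urns before [l], which are all full. *)
Lemma size_low_first m l w : (1 <= l <= m)%N -> in_urns m w -> confined m w ->
  l \notin occ_after m [::] w ->
  (forall i, (1 <= i < l)%N -> i \in occ_after m [::] w) ->
  size (low l w) = l.-1.
Proof.
move=> lm wm cw lo first.
have := @linear_probing_split l m [::] [::] [::] w ltac:(lia) wm.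
move=> /(_ (fun=> fun=> erefl)) /(_ (conj (fun=> fun=> erefl) isT)) /(_ isT isT).
move=> /(_ ltac:(lia)) /= [e H].
rewrite -/(low l w) -/(high l w) in e H.
have h : (l \notin occ_after m [::] w) && (m \notin occ_after m [::] w).
  by rewrite lo.
have [_ ag] := H h; have := h; rewrite e => /andP[ll _].
have ul := in_urns_low l wm.
have uf := @uniq_occ_after l [::] _ l ul ltac:(lia) ll isT.
rewrite -[LHS](add0n) -(size_occ_after l [::]) -[RHS](size_iota 1).
apply/perm_size/uniq_perm => //; first exact: iota_uniq.
move=> y; rewrite mem_iota; apply/idP/idP => [yf|yl].
  have /allP/(_ y yf) /= := in_urns_occ_after ul (isT : in_urns _ [::]).
  suff : y != l by move/eqP; lia.
  by apply: contraNneq ll => yl; rewrite yl in yf.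
by rewrite ag ?first//; lia.
Qed.

(** By [confined_split] a term of the sum survives only if [l] is the first empty urn, so there is
    exactly one. *)
Lemma confined_first_empty m w (F : nat -> R) : in_urns m w -> (0 < m)%N ->
  (confined m w)%:R * F (total_displacement m w) =
  \sum_(l <- iota 1 m) (size (low l w) == l.-1)%:R *
    ((confined l (low l w) && confined (m - l) (high l w))%:R *
     F (total_displacement l (low l w) +
        total_displacement (m - l) (high l w))%N).
Proof.
move=> wm m0; set fin := occ_after m [::] w.
have [cw|cw] := boolP (confined m w); last first.
  rewrite mul0r big1_seq// => l /andP[_]; rewrite mem_iota => lm.
  case: eqP => sz; last by rewrite mul0r.
  have [-> _] := @confined_split l m w ltac:(lia) wm sz.
  by rewrite (negbTE cw) mul0r mulr0.
have ex : exists l, (0 < l)%N && (l \notin fin) by exists m; rewrite m0.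
case: (ex_minnP ex) => l /andP[l0 lo] lmin.
have lm : (l <= m)%N by apply: lmin; rewrite m0.
have first i : (1 <= i < l)%N -> i \in fin.
  move=> il; apply/negPn/negP => io.
  by have := lmin i; rewrite io andbT; lia.
have lm' : (1 <= l <= m)%N by lia.
have sz := size_low_first lm' wm cw lo first.
rewrite mul1r (bigD1_seq l) ?iota_uniq//=; last by rewrite mem_iota; lia.
rewrite sz eqxx mul1r.
have [e H] := confined_split lm' wm sz.
have ce : confined l (low l w) && confined (m - l) (high l w).
  rewrite e cw lo andbT /=; apply/forallP => i; apply: first.
  by have := ltn_ord i; lia.
rewrite (H ce) ce mul1r big1_seq ?addr0// => j /andP[jl].
rewrite mem_iota => jm; case: eqP => szj; last by rewrite mul0r.
have [-> _] := @confined_split j m w ltac:(lia) wm szj.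
rewrite cw /= -/fin mul1r.
case: (ltngtP j l) jl => // jl _.
  by rewrite (first j) ?andbF ?mul0r//; lia.
have lj : (l.-1 < j.-1)%N by lia.
case: forallP => [/(_ (Ordinal lj)) /=|_]; last by rewrite mul0r.
by rewrite prednK// (negbTE lo).
Qed.

(* [l] is the first urn that remains empty. *)
Lemma sum_confined_rec m n (F : nat -> R) : (0 < m)%N ->
  \sum_(w <- words (iota 1 m) n)
    (confined m w)%:R * F (total_displacement m w) =
  \sum_(l <- iota 1 m) 'C(n, l.-1)%:R *
    \sum_(u <- words (iota 1 l) l.-1) (confined l u)%:R *
      \sum_(v <- words (iota 1 (m - l)) (n - l.-1)) (confined (m - l) v)%:R *
        F (total_displacement l u + total_displacement (m - l) v)%N.
Proof.
move=> m0; rewrite (eq_big_seq _ (fun w ww =>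
  confined_first_empty F (words_in_urns ww) m0)).
rewrite exchange_big; apply: eq_big_seq => l; rewrite mem_iota => lm.
have -> : iota 1 m = iota 1 l ++ map (addn l) (iota 1 (m - l)).
  by rewrite -iotaDl [(l + 1)%N]addnC -iotaD subnKC//; lia.
rewrite (@sum_words_shuffle (fun k => k <= l)%N (iota 1 l) _ n l.-1
  (fun u v => (confined l u && confined (m - l) (map (subn^~ l) v))%:R *
    F (total_displacement l u +
       total_displacement (m - l) (map (subn^~ l) v))%N)); first last.
- by apply/allP => x /mapP[y]; rewrite mem_iota /= => ? ->; lia.
- by apply/allP => x; rewrite mem_iota; lia.
congr (_ * _); apply: eq_bigr => u _; rewrite mulr_sumr sum_words_map.
apply: eq_bigr => v _; rewrite -map_comp.
rewrite (eq_map (g := id)) ?map_id; last by move=> x /=; rewrite addKn.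
by rewrite mulrA; case: (confined l u); rewrite ?mul1r ?mul0r.
Qed.
End Words.

(** * Decomposition into blocks *)

Section IteratedSum.
Variables (R : realType) (I : eqType) (q : I -> R) (le dd : I -> nat).
Implicit Types (r : seq I) (F G : nat -> nat -> R).

(* The expectation of [F (X_1 + ... + X_N) (Y_1 + ... + Y_N)] for i.i.d. pairs
   [(X_i, Y_i)] with the (sub)distribution giving mass [q i] to
   [(le i, dd i)]. *)
Fixpoint iidE r N F : R :=
  if N is N'.+1 then
    \sum_(i <- r) q i * iidE r N' (fun m k => F (le i + m)%N (dd i + k)%N)
  else F 0%N 0%N.

Lemma iidE_ext L r N F G : {in r, forall i, 1 <= le i <= L}%N ->
  (forall m k, (N <= m <= N * L)%N -> F m k = G m k) ->
  iidE r N F = iidE r N G.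
Proof.
move=> rL; elim: N F G => [|N IH] F G FG /=; first exact: FG.
apply: eq_big_seq => i /rL il; congr (_ * _); apply: IH => m k mN.
by apply: FG; rewrite mulSn; lia.
Qed.

Lemma iidEZ r N (c : R) F :
  iidE r N (fun m k => c * F m k) = c * iidE r N F.
Proof.
elim: N F => [|N IH] F //=; rewrite mulr_sumr.
by apply: eq_bigr => i _; rewrite IH mulrCA.
Qed.

Lemma iidED r N F G :
  iidE r N (fun m k => F m k + G m k) = iidE r N F + iidE r N G.
Proof.
elim: N F G => [|N IH] F G //=; rewrite -big_split.
by apply: eq_bigr => i _; rewrite IH mulrDr.
Qed.

Lemma iidE0 r N : iidE r N (fun _ _ => 0) = 0.
Proof. by elim: N => //= N ->; rewrite big1// => i _; rewrite mulr0. Qed.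

Lemma iidE_sum r N (J : Type) (s : seq J) (F : J -> nat -> nat -> R) :
  iidE r N (fun m k => \sum_(j <- s) F j m k) = \sum_(j <- s) iidE r N (F j).
Proof.
elim: s => [|j s IH].
  rewrite big_nil -[RHS](iidE0 r N); congr iidE.
  by apply/funext => m; apply/funext => k; rewrite big_nil.
rewrite big_cons -IH -iidED; congr iidE.
by apply/funext => m; apply/funext => k; rewrite big_cons.
Qed.

Lemma iidE_expr r N (h : R) :
  iidE r N (fun _ k => h ^+ k) = (\sum_(i <- r) q i * h ^+ dd i) ^+ N.
Proof.
elim: N => [|N IH] //=; rewrite exprS mulr_suml; apply: eq_bigr => i _.
rewrite -mulrA -IH -(iidEZ _ _ (h ^+ dd i)); congr (_ * iidE _ _ _).
by apply/funext => m; apply/funext => k; rewrite exprD.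
Qed.

Lemma iidE1 r N : iidE r N (fun _ _ => 1) = (\sum_(i <- r) q i) ^+ N.
Proof.
have := iidE_expr r N 1.
have -> : (fun _ k : nat => 1 ^+ k : R) = (fun _ _ => 1).
  by apply/funext => m; apply/funext => k; rewrite expr1n.
by move=> ->; congr (_ ^+ _); apply: eq_bigr => i _; rewrite expr1n mulr1.
Qed.

Hypothesis q_ge0 : forall i, 0 <= q i.

Lemma iidE_le r N F G : (forall m k, F m k <= G m k) ->
  iidE r N F <= iidE r N G.
Proof.
elim: N F G => [|N IH] F G FG //=.
by apply: ler_sum => i _; apply: ler_wpM2l => //; apply: IH.
Qed.

Lemma iidE_ge0 r N F : (forall m k, 0 <= F m k) -> 0 <= iidE r N F.
Proof. by move=> F0; rewrite -(iidE0 r N); apply: iidE_le. Qed.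

Lemma iidE_filter_le r (P : pred I) N F : (forall m k, 0 <= F m k) ->
  iidE [seq i <- r | P i] N F <= iidE r N F.
Proof.
elim: N F => [|N IH] F F0 //=.
rewrite big_filter [leRHS](bigID P) /= ler_wpDr//.
  by apply: sumr_ge0 => i _; rewrite mulr_ge0// iidE_ge0.
by apply: ler_sum => i _; apply: ler_wpM2l => //; apply: IH.
Qed.

(** Union bound: each of the [N] draws leaves [P] with the mass of the discarded items, and then [F]
    costs at most 1. *)
Lemma iidE_truncate r (P : pred I) N F :
  \sum_(i <- r) q i <= 1 -> (forall m k, 0 <= F m k <= 1) ->
  iidE r N F <= iidE [seq i <- r | P i] N F
                + N%:R * \sum_(i <- r | ~~ P i) q i.
Proof.
move=> q1; set d := \sum_(i <- r | _) _.
have d0 : 0 <= d by apply: sumr_ge0.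
elim: N F => [|N IH] F F01 /=; first by rewrite mul0r addr0.
apply: (@le_trans _ _ (\sum_(i <- r) (q i *
    iidE [seq i <- r | P i] N (fun m k => F (le i + m)%N (dd i + k)%N)
     + q i * (N%:R * d)))).
  by apply: ler_sum => i _; rewrite -mulrDr ler_wpM2l//; apply: IH.
rewrite big_split /= -mulr_suml.
set S := (X in X + _ <= _).
have -> : \sum_(i <- [seq i <- r | P i]) q i *
   iidE [seq i <- r | P i] N (fun m k => F (le i + m)%N (dd i + k)%N) =
   S - \sum_(i <- r | ~~ P i) q i *
   iidE [seq i <- r | P i] N (fun m k => F (le i + m)%N (dd i + k)%N).
  by rewrite big_filter /S [in RHS](bigID P) /= addrK.
have : \sum_(i <- r | ~~ P i) q i *
   iidE [seq i <- r | P i] N (fun m k => F (le i + m)%N (dd i + k)%N) <= d.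
  apply: ler_sum => i _; rewrite -[leRHS]mulr1; apply: ler_wpM2l => //.
  apply: (le_trans (iidE_le (G := fun _ _ => 1) _ _ _)).
    by move=> m k; case/andP: (F01 (le i + m)%N (dd i + k)%N).
  rewrite iidE1 exprn_ile1//; first by apply: sumr_ge0.
  by apply: le_trans q1; rewrite big_filter [leRHS](bigID P) /= lerDl sumr_ge0.
have : (\sum_(i <- r) q i) * (N%:R * d) <= N%:R * d.
  by rewrite -[leRHS]mul1r ler_wpM2r// mulr_ge0.
rewrite -natr1 mulrDl mul1r; lra.
Qed.
End IteratedSum.

(** * Growth criterion and crude Stirling bounds *)

Section RealLemmas.
Variable R : realType.
Implicit Types (x s a b : R).

(** Bernoulli's inequality for [s ^+ K] is itself only affine in [K]; squaring it gives a quadratic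
    lower bound for [s ^+ (K * 2)], which no affine function dominates. *)
Lemma expr_le_affine_le1 s a b : 0 <= s ->
  (forall N : nat, s ^+ N <= a * N%:R + b) -> s <= 1.
Proof.
move=> s0 H; rewrite leNgt; apply/negP => s1.
pose d := s - 1; have d0 : 0 < d by rewrite subr_gt0.
have bern k : 1 + k%:R * d <= s ^+ k.
  elim: k => [|k IH]; first by rewrite mul0r addr0 expr0.
  rewrite exprS; apply: (@le_trans _ _ (s * (1 + k%:R * d))).
    have -> : s = 1 + d by rewrite /d addrC subrK.
    rewrite -natr1; have : 0 <= k%:R * d * d by rewrite !mulr_ge0// ltW.
    by lra.
  by rewrite ler_wpM2l.
(* [K] is chosen such that [K > 1] and [K * d ^+ 2 > 2 * |a| + |b|], so that the quadratic term
   beats the affine bound at [K * 2]. *)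
pose K := Num.bound ((`|2 * a| + `|b|) / d ^+ 2 + 1).
have KP : (`|2 * a| + `|b|) / d ^+ 2 + 1 < K%:R.
  by apply: archi_boundP; rewrite addr_ge0// divr_ge0 ?addr_ge0// sqr_ge0.
have d2 : 0 < d ^+ 2 by rewrite exprn_gt0.
have K1 : 1 < K%:R :> R.
  by apply: (le_lt_trans _ KP); rewrite lerDr divr_ge0 ?addr_ge0// ltW.
have Kd : `|2 * a| + `|b| < K%:R * d ^+ 2.
  by rewrite -ltr_pdivrMr//; apply: (le_lt_trans _ KP); rewrite lerDl.
have := H (K * 2)%N; rewrite exprM natrM => H'.
have : (1 + K%:R * d) ^+ 2 <= (s ^+ K) ^+ 2.
  have h : 0 <= 1 + K%:R * d by rewrite addr_ge0// mulr_ge0// ltW.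
  by rewrite ler_sqr ?nnegrE ?(le_trans h)//.
have ha := ler_norm (2 * a); have hb := ler_norm b.
move=> H2; have : K%:R * (`|2 * a| + `|b|) < K%:R * (K%:R * d ^+ 2).
  by rewrite ltr_pM2l//; lra.
have : 2 * a * K%:R <= `|2 * a| * K%:R by rewrite ler_wpM2r.
have : `|b| <= `|b| * K%:R by rewrite ler_peMr// ltW.
have : 0 <= K%:R * d by rewrite mulr_ge0// ltW.
move: H' H2; rewrite !expr2; nra.
Qed.

Lemma ln_ge1V x : 0 < x -> 1 - x^-1 <= ln x.
Proof.
move=> x0; have h : 0 < x^-1 by rewrite invr_gt0.
have := @le_ln1Dx R (x^-1 - 1); rewrite [1 + _]addrCA subrr addr0 lnV ?posrE//.
by move/(_ ltac:(lra)); lra.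
Qed.

Lemma expRn (t : R) n : expR t ^+ n = expR (n%:R * t).
Proof. by rewrite expRM_natl. Qed.

(** [n ^ n / n!] is one term of the exponential series at [n]. *)
Lemma expn_le_fact n : (n%:R ^+ n : R) <= n`!%:R * expR n%:R.
Proof.
case: n => [|n]; first by rewrite expr0 mul1r expR0.
have := @expR_ge1Dxn R n.+1%:R n (ler0n _ _).
have f0 : (0 : R) < (n.+1)`!%:R by rewrite ltr0n fact_gt0.
move=> h; have : n.+1%:R ^+ n.+1 / (n.+1)`!%:R <= expR n.+1%:R :> R by lra.
by rewrite ler_pdivrMr// mulrC.
Qed.

(** A Stirling bound up to a polynomial factor. The induction step is
    [e * k ^ (k + 1) <= (k + 1) ^ (k + 1)], that is [ln (1 + 1 / k) >= 1 / (k + 1)]. *)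
Lemma fact_le_expn n : (0 < n)%N ->
  (n`!%:R * expR n%:R : R) <= expR 1 * n%:R * n%:R ^+ n.
Proof.
elim: n => // -[|n] IH _; first by rewrite mul1r expr1 !mulr1.
have {IH} := IH isT; set k := n.+1; have k0 : (0 : R) < k%:R by rewrite ltr0n.
have step : (expR 1 * k%:R ^+ k.+1 : R) <= k.+1%:R ^+ k.+1.
  have k10 : (0 : R) < k.+1%:R by rewrite ltr0n.
  have := @ln_ge1V (k.+1%:R / k%:R) (divr_gt0 k10 k0).
  rewrite invf_div => h.
  have h2 : k.+1%:R^-1 <= ln (k.+1%:R / k%:R : R).
    apply: le_trans h; have := k10; rewrite -natr1 => k1.
    rewrite (_ : 1 - _ = (k%:R + 1)^-1)//; field; exact: lt0r_neq0.
  have h3 : expR 1 <= (k.+1%:R / k%:R) ^+ k.+1 :> R.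
    rewrite -[X in _ <= X ^+ _](lnK (_ : _ \is Num.pos)) ?posrE ?divr_gt0//.
    by rewrite expRn ler_expR -(@ler_pdivrMl _ k.+1%:R)// mulr1.
  by rewrite -ler_pdivlMr ?exprn_gt0// -expr_div_n.
move=> IH; rewrite factS natrM -natr1 expRD natr1.
apply: (@le_trans _ _ (k.+1%:R * expR 1 * (expR 1 * k%:R * k%:R ^+ k))).
  have -> : k.+1%:R * k`!%:R * (expR k%:R * expR 1) =
    k.+1%:R * expR 1 * (k`!%:R * expR k%:R) :> R by ring.
  by rewrite ler_wpM2l ?mulr_ge0 ?expR_ge0.
rewrite [k.+1%:R * expR 1]mulrC -[leLHS]mulrA -[leRHS]mulrA ler_wpM2l ?expR_ge0//.
by rewrite ler_wpM2l// -mulrA -exprS.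
Qed.
End RealLemmas.

(** * Borel weights of blocks and the conditioned sum *)

Section Blocks.
Variable R : realType.
Implicit Types (x : R) (m n l M N : nat) (b : nat * seq nat).

(** The Borel law with parameter [x * expR (- x)], its tree function replaced by the value [x]. At
    [x = 0] it is the Dirac mass at 1. At [l = 0] the formula gives 1, so sums start at [l = 1]. *)
Definition bpmf x l : R :=
  expR (- (l%:R * x)) * (l%:R * x) ^+ l.-1 / l`!%:R.

Definition unif_mean m n (F : nat -> R) : R :=
  (m%:R ^+ n)^-1 * \sum_(w <- words (iota 1 m) n) F (total_displacement m w).

(* A block is a maximal run of [l - 1] occupied urns followed by an empty one,
   together with the addresses of its balls. *)
Definition blocks M : seq (nat * seq nat) :=
  [seq (l, u) | l <- iota 1 M,
                u <- [seq u <- words (iota 1 l) l.-1 | confined l u]].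

Definition bdisp b := total_displacement b.1 b.2.

(** The factors [expR (- (l * x))] and [x ^+ l.-1] multiply over the blocks, and the factorials make
    up the multinomial coefficient that distributes the balls among them. *)
Definition bweight x b : R :=
  expR (- (b.1%:R * x)) * x ^+ b.1.-1 / (b.1.-1)`!%:R.

Lemma bweight_ge0 x b : 0 <= x -> 0 <= bweight x b.
Proof. by move=> x0; rewrite /bweight divr_ge0// mulr_ge0 ?expR_ge0// exprn_ge0. Qed.

Lemma bpmf_ge0 x l : 0 <= x -> 0 <= bpmf x l.
Proof.
by move=> x0; rewrite /bpmf divr_ge0// mulr_ge0 ?expR_ge0// exprn_ge0// mulr_ge0.
Qed.

Lemma blocks_size M : {in blocks M, forall b, 1 <= b.1 <= M}%N.
Proof.
by move=> b /allpairsPdep[l [u [+ _ ->]]] /=; rewrite mem_iota; lia.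
Qed.

Lemma iidE_blocks_ext x M N (F G : nat -> nat -> R) :
  (forall m k, (N <= m <= N * M)%N -> F m k = G m k) ->
  iidE (bweight x) fst bdisp (blocks M) N F =
  iidE (bweight x) fst bdisp (blocks M) N G.
Proof. by move=> FG; apply: (@iidE_ext R _ _ _ _ M) => //; exact: blocks_size. Qed.

Lemma filter_blocks L M : (L <= M)%N ->
  [seq b <- blocks M | b.1 <= L]%N = blocks L.
Proof.
move=> LM; rewrite {1}/blocks -(subnKC LM) iotaD /allpairs_dep map_cat.
rewrite flatten_cat filter_cat -/(allpairs_dep _ _ _) -/(allpairs_dep _ _ _).
rewrite -/(blocks L) (all_filterP _); last first.
  by apply/allP => b /blocks_size; lia.
rewrite -[RHS]cats0; congr (_ ++ _); apply/eqP; rewrite -[_ == _]negbK -has_filter.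
apply/hasPn => b /allpairsPdep[l [u [+ _ ->]]] /=; rewrite mem_iota; lia.
Qed.

Lemma sum_blocks_words x M (G : nat * seq nat -> R) :
  \sum_(b <- blocks M) bweight x b * G b =
  \sum_(l <- iota 1 M) expR (- (l%:R * x)) * x ^+ l.-1 / (l.-1)`!%:R *
    \sum_(u <- words (iota 1 l) l.-1) (confined l u)%:R * G (l, u).
Proof.
rewrite big_allpairs_dep; apply: eq_bigr => l _.
rewrite big_filter mulr_sumr big_mkcond; apply: eq_bigr => u _ /=.
by case: ifP; rewrite ?mul1r ?mul0r ?mulr0.
Qed.

(** By [sum_confined] with [l - 1] balls, a proportion [1 / l] of the address lists is confined,
    whatever the displacement. Hence a random block has length law [bpmf x] and, given the length
    [l], the displacement law of [d_{l,l-1}]. *)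
Lemma sum_blocks x M (G : nat -> nat -> R) :
  \sum_(b <- blocks M) bweight x b * G b.1 (bdisp b) =
  \sum_(l <- iota 1 M) bpmf x l * unif_mean l l.-1 (G l).
Proof.
rewrite (sum_blocks_words _ _ (fun b => G b.1 (bdisp b))) /bdisp /=.
apply: eq_big_seq => l; rewrite mem_iota => lM.
have l0 : l%:R != 0 :> R by rewrite pnatr_eq0; lia.
have lt : (l.-1 < l)%N by lia.
have /(canRL (mulKf l0)) -> := sum_confined (G l) lt.
have -> : (l - l.-1)%N = 1%N by lia.
rewrite mul1r /bpmf /unif_mean -[in l`!](prednK (_ : 0 < l)%N); last by lia.
rewrite factS prednK; last by lia.
rewrite exprMn natrM; field.
by rewrite l0 expf_neq0// pnatr_eq0 -lt0n fact_gt0.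
Qed.

Lemma unif_mean1 m n : (0 < m)%N -> unif_mean m n (fun=> 1) = 1.
Proof.
move=> m0; rewrite /unif_mean big_const_seq count_predT iter_addr_0.
by rewrite size_words size_iota natrX mulVf// expf_neq0// pnatr_eq0; lia.
Qed.

Lemma unif_mean_cst m n (c : R) : (0 < m)%N -> unif_mean m n (fun=> c) = c.
Proof.
move=> m0; rewrite -[RHS]mulr1 -(unif_mean1 n m0) /unif_mean [RHS]mulrCA.
by congr (_ * _); rewrite mulr_sumr; apply: eq_bigr => w _; rewrite mulr1.
Qed.

Lemma sum_bweight x M :
  \sum_(b <- blocks M) bweight x b = \sum_(l <- iota 1 M) bpmf x l.
Proof.
have := sum_blocks x M (fun _ _ => 1); under eq_bigr do rewrite mulr1.
move=> ->; apply: eq_big_seq => l; rewrite mem_iota => lM.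
by rewrite unif_mean1 ?mulr1//; lia.
Qed.

Lemma confined_lt m w : in_urns m w -> confined m w -> (0 < m)%N ->
  (size w < m)%N.
Proof.
move=> wm cw m0; have := @uniq_occ_after m [::] w m wm ltac:(lia) cw isT.
move=> uf; have H := @uniq_leq_size _ _ (iota 1 m.-1) uf.
rewrite size_occ_after size_iota add0n in H.
suff /H : {subset occ_after m [::] w <= iota 1 m.-1} by lia.
move=> y yf; have /allP/(_ y yf) /= := in_urns_occ_after wm (isT : in_urns _ [::]).
rewrite mem_iota; suff : y != m by move/eqP; lia.
by apply: contraNneq cw => ym; rewrite ym in yf.
Qed.

(** Induction on the number [N] of empty urns, cutting off the first block with [sum_confined_rec]:
    the binomial coefficient splits [1 / n!] into the factorials of the block and of the rest. [M]
    is only a cutoff, since longer blocks cannot fit. *)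
Lemma iidE_blocks x N n M (F : nat -> R) : 0 <= x -> (n + N <= M)%N ->
  expR (- ((n + N)%:R * x)) * x ^+ n / n`!%:R *
   \sum_(w <- words (iota 1 (n + N)) n)
     (confined (n + N) w)%:R * F (total_displacement (n + N) w) =
  iidE (bweight x) fst bdisp (blocks M) N (fun m k => (m == n + N)%N%:R * F k).
Proof.
move=> x0; elim: N n F => [|N IH] n F nM.
  rewrite addn0 /=; case: n nM => [|n] nM.
    by rewrite sum_words0 mul0r oppr0 expR0 expr0 fact0 divr1 !mul1r.
  rewrite mul0r big1_seq ?mulr0// => w /andP[_ ww].
  case: (boolP (confined _ _)) => [cw|]; last by rewrite mul0r.
  have := confined_lt (words_in_urns ww) cw isT.
  by have [-> _] := mem_words ww; rewrite ltnn.
set m := (n + N.+1)%N in nM *; have m0 : (0 < m)%N by rewrite /m; lia.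
rewrite sum_confined_rec//.
rewrite [RHS]/= (sum_blocks_words x M (fun b =>
  iidE (bweight x) fst bdisp (blocks M) N
    (fun m' k => ((b.1 + m')%N == m)%:R * F (bdisp b + k)%N))) /=.
have -> : iota 1 M = iota 1 m ++ iota m.+1 (M - m).
  by rewrite -[in RHS]add1n -iotaD subnKC.
rewrite big_cat /= [X in _ = _ + X]big1_seq ?addr0; last first.
  move=> l /andP[_]; rewrite mem_iota => lm; rewrite big1 ?mulr0// => u _.
  rewrite (_ : iidE _ _ _ _ _ _ = 0) ?mulr0//.
  rewrite -[RHS](iidE0 (bweight x) fst bdisp (blocks M) N); congr iidE.
  apply/funext => m'; apply/funext => k.
  by rewrite (_ : (l + m' == m)%N = false) ?mul0r//; apply/negbTE/eqP; lia.
rewrite mulr_sumr; apply: eq_big_seq => l; rewrite mem_iota => lm.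
(* Such a block has more balls than there are; on the right, the other [N] blocks, each of length at
   least 1, would not fit. *)
have [ln|nl] := leqP l.-1 n; last first.
  rewrite bin_small// mul0r mulr0; apply/esym; rewrite big1 ?mulr0// => u _.
  rewrite (_ : iidE _ _ _ _ _ _ = 0) ?mulr0//.
  rewrite -[RHS](iidE0 (bweight x) fst bdisp (blocks M) N).
  apply: iidE_blocks_ext => m' k m'N /=.
  by rewrite (_ : (l + m' == m)%N = false) ?mul0r//; apply/negbTE/eqP; lia.
have mE : (m - l = (n - l.-1) + N)%N by lia.
have fn (k : nat) : k`!%:R != 0 :> R by rewrite pnatr_eq0 -lt0n fact_gt0.
have := bin_fact ln; set p := l.-1 in ln *; set s := (n - p)%N in mE *.
move=> bf; have {}bf : n`!%:R = 'C(n, p)%:R * (p`!%:R * s`!%:R) :> R.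
  by rewrite -bf !natrM.
have Cn0 : 'C(n, p)%:R != 0 :> R by rewrite pnatr_eq0 -lt0n bin_gt0.
have sp : n = (s + p)%N by lia.
have e1 : expR (- (m%:R * x)) = expR (- (l%:R * x)) * expR (- ((m - l)%:R * x)).
  by rewrite -expRD -opprD -mulrDl -natrD subnKC//; lia.
rewrite e1 [in x ^+ n]sp exprD bf.
set A := \sum_(u <- _) _; set B := \sum_(u <- _) _.
suff -> : B = expR (- ((m - l)%:R * x)) * x ^+ s / s`!%:R * A.
  by field; rewrite !fn Cn0.
rewrite /A mulr_sumr; apply: eq_bigr => u _; rewrite mulrCA; congr (_ * _).
have H := IH s (fun k => F (total_displacement l u + k)%N) ltac:(lia).
rewrite mE H; congr iidE; apply/funext => m'; apply/funext => k.
congr (_%:R * _); rewrite -mE; by apply/eqP/eqP; lia.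
Qed.

(** The parameter [x > 0] is free: conditioning on the total length removes it. *)
Lemma unif_mean_iidE x m n M (F : nat -> R) : 0 < x -> (n < m <= M)%N ->
  unif_mean m n F =
  m%:R / (m - n)%:R * (n`!%:R * expR (m%:R * x)) / (m%:R * x) ^+ n *
  iidE (bweight x) fst bdisp (blocks M) (m - n)
    (fun m' k => (m' == m)%:R * F k).
Proof.
move=> x0 nm; have mE : (n + (m - n))%N = m by rewrite subnKC//; lia.
have := @iidE_blocks x (m - n) n M F (ltW x0); rewrite mE => <-; last by lia.
have m0 : m%:R != 0 :> R by rewrite pnatr_eq0; lia.
have N0 : (m - n)%:R != 0 :> R by rewrite pnatr_eq0; lia.
have := sum_confined F (ltac:(lia) : (n < m)%N).
move=> /(canRL (mulKf m0)) ->; rewrite expRN /unif_mean exprMn; field.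
by rewrite m0 N0 !expf_neq0// ?lt0r_neq0 ?expR_gt0// ltr0n fact_gt0.
Qed.

(** The Borel-Tanner law: [N / m] times the mass at [n] of the Poisson law with mean [m * x]. It is
    the case [F = 1] of [unif_mean_iidE]. *)
Lemma iidE_hit x m n M : 0 < x -> (n < m <= M)%N ->
  iidE (bweight x) fst bdisp (blocks M) (m - n) (fun m' k => (m' == m)%:R) =
  (m - n)%:R / m%:R * (expR (- (m%:R * x)) * (m%:R * x) ^+ n / n`!%:R).
Proof.
move=> x0 nm; have := @unif_mean_iidE x m n M (fun=> 1) x0 nm.
rewrite unif_mean1; last by lia.
under eq_fun do under eq_fun do rewrite mulr1.
have m0 : m%:R != 0 :> R by rewrite pnatr_eq0; lia.
have N0 : (m - n)%:R != 0 :> R by rewrite pnatr_eq0; lia.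
set E := iidE _ _ _ _ _ _ => H.
have f0 : n`!%:R != 0 :> R by rewrite pnatr_eq0 -lt0n fact_gt0.
have e0 : expR (m%:R * x) != 0 by rewrite lt0r_neq0 ?expR_gt0.
have p0 : (m%:R * x) ^+ n != 0 by rewrite expf_neq0// mulf_neq0// lt0r_neq0.
rewrite expRN; apply: (@mulfI _ (m%:R / (m - n)%:R * (n`!%:R * expR (m%:R * x)) / (m%:R * x) ^+ n)).
  by rewrite !mulf_neq0// invr_neq0.
by rewrite -H; field; rewrite f0 N0 m0 e0 p0.
Qed.

(** The total mass of the blocks is not yet known to be at most 1, so this is read off the formula
    of [iidE_hit]: a ratio and a Poisson mass, each at most 1. *)
Lemma iidE_hit_le1 x m N M : 0 < x -> (m <= M)%N ->
  iidE (bweight x) fst bdisp (blocks M) N (fun m' k => (m' == m)%:R) <= 1.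
Proof.
move=> x0 mM; have [Nm|mN] := leqP N m; last first.
  rewrite (@iidE_blocks_ext _ _ _ _ (fun _ _ => 0)) ?iidE0//.
  by move=> m' k h; rewrite (_ : m' == m = false)//; apply/eqP; lia.
case: N Nm => [_|N Nm]; first by rewrite /= lern1 leq_b1.
have := @iidE_hit x m (m - N.+1) M x0 ltac:(lia).
rewrite subKn// => ->; set n := (m - N.+1)%N.
have m0 : 0 < m%:R :> R by rewrite ltr0n; lia.
have mx : 0 <= m%:R * x by rewrite mulr_ge0// ltW.
apply: mulr_ile1; rewrite ?divr_ge0 ?mulr_ge0 ?expR_ge0 ?exprn_ge0//.
  by rewrite ler_pdivrMr// mul1r ler_nat.
have f0 k : 0 < k`!%:R :> R by rewrite ltr0n fact_gt0.
have key k : (m%:R * x) ^+ k <= expR (m%:R * x) * k`!%:R.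
  rewrite -ler_pdivrMr//; case: k => [|k].
    by rewrite expr0 fact0 divr1; apply: le_trans (expR_ge1Dx _); rewrite lerDl.
  by have := expR_ge1Dxn k mx; lra.
by rewrite ler_pdivrMr// mul1r expRN ler_pdivrMl ?expR_gt0.
Qed.

(* The total mass [S] of the blocks of length at most [L] satisfies
   [S ^ N <= N * L + 1], since a sum of [N] lengths takes at most [N * L + 1]
   values, each with mass at most 1. *)
Lemma sum_bpmf_le1 x L : 0 < x -> \sum_(l <- iota 1 L) bpmf x l <= 1.
Proof.
move=> x0; apply: (@expr_le_affine_le1 _ _ L%:R 1).
  by apply: sumr_ge0 => l _; rewrite bpmf_ge0// ltW.
move=> N; rewrite -sum_bweight -(iidE1 (bweight x) fst bdisp).
set M := (N * L)%N.
rewrite (@iidE_blocks_ext _ _ _ _ (fun m' k =>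
    \sum_(m <- iota 0 M.+1) (m' == m)%:R)); last first.
  move=> m' k h; rewrite -natr_sum -big_mkcond sum1_count.
  rewrite (eq_count (a2 := pred1 m')) => [|j]; last by rewrite /= eq_sym.
  by rewrite count_uniq_mem ?iota_uniq// mem_iota; case: andP => //; lia.
have LM : (L <= M + L)%N by lia.
rewrite -(filter_blocks LM); apply: le_trans.
  apply: iidE_filter_le => [b|m' k]; first exact/bweight_ge0/ltW.
  by apply: sumr_ge0.
rewrite iidE_sum; apply: (@le_trans _ _ (\sum_(m <- iota 0 M.+1) 1)).
  rewrite big_seq [leRHS]big_seq; apply: ler_sum => m; rewrite mem_iota => mM.
  by apply: iidE_hit_le1 => //; lia.
rewrite big_const_seq count_predT size_iota iter_addr_0 -natr1.
by rewrite lerD2r /M natrM mulrC.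
Qed.

(** Replacing [m] and [n] by [k * m] and [k * n] keeps [x], and the Poisson mass in [iidE_hit] is
    then taken at its mean, where [fact_le_expn] bounds it below. So [s ^- N] to the power [k] is at
    most linear in [k], and [expr_le_affine_le1] applies. *)
Lemma le1_sum_bpmf m n (s : R) : (0 < n < m)%N ->
  (forall L, \sum_(l <- iota 1 L) bpmf (n%:R / m%:R) l <= s) -> 1 <= s.
Proof.
move=> nm H; set x := n%:R / m%:R in H *.
have m0 : 0 < m%:R :> R by rewrite ltr0n; lia.
have n0 : 0 < n%:R :> R by rewrite ltr0n; lia.
have x0 : 0 < x by rewrite divr_gt0.
have s0 : 0 < s.
  apply: lt_le_trans (H 1%N); rewrite big_seq1 /bpmf /= expr0 mulr1.
  by rewrite divr_gt0 ?expR_gt0// ltr0n fact_gt0.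
set N := (m - n)%N; have N0 : 0 < N%:R :> R by rewrite ltr0n /N; lia.
rewrite -invf_le1//; suff : s^-1 ^+ N <= 1.
  by rewrite expr_le1 ?invr_ge0 ?(ltW s0)// /N; lia.
apply: (@expr_le_affine_le1 _ _ (m%:R / N%:R * expR 1 * n%:R) 1).
  by rewrite exprn_ge0// invr_ge0 ltW.
case=> [|j]; first by rewrite expr0 mulr0 add0r.
set k := j.+1; have k0 : 0 < k%:R :> R by rewrite ltr0n.
apply: (@le_trans _ _ (m%:R / N%:R * expR 1 * n%:R * k%:R)); last first.
  by rewrite lerDl.
rewrite -exprM exprVn -[leRHS]invrK lef_pV2 ?posrE ?exprn_gt0//; last first.
  by rewrite invr_gt0 !mulr_gt0 ?expR_gt0// invr_gt0.
have kn0 : (0 < k * n)%N by rewrite muln_gt0; lia.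
have := @iidE_hit x (k * m) (k * n) (k * m) x0.
rewrite leqnn andbT ltn_pmul2l// => /(_ ltac:(lia)).
rewrite -mulnBr -/N => hit.
have : iidE (bweight x) fst bdisp (blocks (k * m)) (k * N)
    (fun m' k' => (m' == k * m)%N%:R) <= s ^+ (N * k).
  apply: (@le_trans _ _ (iidE (bweight x) fst bdisp (blocks (k * m)) (k * N)
    (fun _ _ => 1))).
    apply: iidE_le => [b|m' k']; first exact/bweight_ge0/ltW.
    by rewrite lern1 leq_b1.
  rewrite iidE1 [(N * k)%N]mulnC sum_bweight; apply: lerXn2r; rewrite ?nnegrE//.
    by apply: sumr_ge0 => l _; exact/bpmf_ge0/ltW.
  exact: ltW.
rewrite {}hit; apply: le_trans.
have -> : (k * m)%:R * x = (k * n)%:R :> R.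
  by rewrite /x !natrM; field; rewrite lt0r_neq0.
have := @fact_le_expn R _ kn0; set p := (k * n)%N in kn0 *.
have p0 : 0 < p%:R :> R by rewrite ltr0n.
have f0 : 0 < p`!%:R :> R by rewrite ltr0n fact_gt0.
move=> fact; rewrite [(k * N)%:R]natrM [(k * m)%:R]natrM expRN.
have -> : k%:R * N%:R / (k%:R * m%:R) * ((expR p%:R)^-1 * p%:R ^+ p / p`!%:R) =
   N%:R / m%:R * (p%:R ^+ p / (p`!%:R * expR p%:R)) :> R.
  by field; rewrite !lt0r_neq0 ?expR_gt0.
have -> : (m%:R / N%:R * expR 1 * n%:R * k%:R)^-1 =
   N%:R / m%:R * (expR 1 * p%:R)^-1 :> R.
  by rewrite /p natrM; field; rewrite !lt0r_neq0 ?expR_gt0.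
apply: ler_wpM2l; first by rewrite divr_ge0 // ltW.
rewrite ler_pdivlMr ?mulr_gt0 ?expR_gt0//.
by rewrite mulrC ler_pdivrMr ?mulr_gt0 ?expR_gt0// [leRHS]mulrC.
Qed.
End Blocks.

(** * Tails of the displacement *)

Section ManyDisplacements.
Variable R : realType.
Implicit Types (A s : seq nat) (x y t : R) (m n l u w : nat).

Lemma sum_count_mem s A : uniq s -> {subset A <= s} ->
  (\sum_(a <- s) count_mem a A = size A)%N.
Proof.
move=> us; elim: A => [|b A IH] sub; first by rewrite big1.
rewrite /= big_split /= IH => [|x xA]; last by rewrite sub// inE xA orbT.
rewrite -[(size A).+1]add1n; congr addn.
rewrite (bigD1_seq b)//=; last by rewrite sub// mem_head.
rewrite eqxx big1// => i ib; by rewrite eq_sym (negbTE ib).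
Qed.

(** The multinomial count of the rearrangements of [A], by induction on the first letter: a letter
    [a] can come from each of its occurrences in [A]. *)
Lemma sum_words_perm_eq s A : uniq s -> {subset A <= s} ->
  (\sum_(v <- words s (size A)) (perm_eq v A)%:R) *
    \prod_(a <- s) (count_mem a A)`!%:R = (size A)`!%:R :> R.
Proof.
move=> us; move en : (size A) => n; elim: n A en => [|n IH] A en sub.
  by case: A en sub => // _ _; rewrite sum_words0 big1 ?mulr1.
rewrite sum_wordsS mulr_suml factS natrM -en -(sum_count_mem us sub).
rewrite natr_sum mulr_suml; apply: eq_big_seq => a as_.
have [aA|aA] := boolP (a \in A); last first.
  rewrite (count_memPn aA) mul0r big1 ?mul0r// => v _.
  by case: (boolP (perm_eq _ _)) => // /perm_mem/(_ a); rewrite mem_head (negbTE aA).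
have sr : size (rem a A) = n by rewrite size_rem// en.
rewrite -(IH _ sr); last by move=> x /mem_rem/sub.
rewrite mulrCA; congr (_ * _).
  apply: eq_bigr => v _; congr (_%:R).
  by rewrite (permPr (perm_to_rem aA)) perm_cons.
rewrite (bigD1_seq a)//= [in RHS](bigD1_seq a)//= mulrA; congr (_ * _).
  have c0 : (0 < count_mem a A)%N by rewrite -has_count has_pred1.
  rewrite count_mem_rem eqxx subn1.
  by case: (count_mem a A) c0 => // c _; rewrite factS natrM.
apply: eq_bigr => b ba; rewrite count_mem_rem eq_sym (negbTE ba) subn0//.
Qed.

Lemma unif_mean_ge0 m n (F : nat -> R) : (forall k, 0 <= F k) ->
  0 <= unif_mean m n F.
Proof.
by move=> F0; rewrite mulr_ge0 ?invr_ge0 ?exprn_ge0// sumr_ge0.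
Qed.

Lemma unif_mean_le m n (F G : nat -> R) : (forall k, F k <= G k) ->
  unif_mean m n F <= unif_mean m n G.
Proof.
by move=> FG; rewrite ler_wpM2l ?invr_ge0 ?exprn_ge0// ler_sum.
Qed.

(* Addresses [1, 1, 2, 2, ..., w, w, w + 1, w + 2, ..., u], in any order. *)
Lemma unif_mean_ge_uw u w : (w <= u)%N ->
  (u + w)`!%:R / (2 ^+ w * (u + w).+1%:R ^+ (u + w)) <=
  unif_mean (u + w).+1 (u + w) (fun k => (u * w <= k)%N%:R) :> R.
Proof.
move=> wu; set l := (u + w).+1; pose A := iota 1 w ++ iota 1 u.
have sA : size A = (u + w)%N by rewrite size_cat !size_iota addnC.
have sub : {subset A <= iota 1 l}.
  by move=> z; rewrite mem_cat !mem_iota /l; lia.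
have := sum_words_perm_eq (iota_uniq 1 l) sub; rewrite sA.
have -> : \prod_(a <- iota 1 l) (count_mem a A)`!%:R = 2 ^+ w :> R.
  rewrite (eq_big_seq (fun a => if (a <= w)%N then 2 else 1 : R)); last first.
    move=> a; rewrite mem_iota => al.
    rewrite count_cat !count_uniq_mem ?iota_uniq// !mem_iota.
    have -> : (1 <= a < 1 + w)%N = (a <= w)%N by apply/idP/idP; lia.
    case: (leqP a w) => aw; last by case: (_ && _).
    have -> : (1 <= a < 1 + u)%N by lia.
    by [].
  have -> : iota 1 l = iota 1 w ++ iota w.+1 u.+1.
    by rewrite -[w.+1]add1n -iotaD addnS addnC.
  move: (u.+1) => k; rewrite big_cat /= [X in _ * X]big1_seq ?mulr1; last first.
    by move=> a /andP[_]; rewrite mem_iota; case: leqP => //; lia.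
  rewrite big_seq (eq_bigr (fun=> 2)) -?big_seq; last first.
    by move=> a; rewrite mem_iota => aw; rewrite ifT//; lia.
  by rewrite big_const_seq count_predT size_iota iter_mulr_1.
move=> e; rewrite /unif_mean invfM mulrA mulrC; apply: ler_wpM2l.
  by rewrite invr_ge0 exprn_ge0.
rewrite -e mulfK ?expf_neq0// big_seq [leRHS]big_seq; apply: ler_sum => v vl.
have [pv|_] := boolP (perm_eq v A); last exact: ler0n.
have sv : size v = l.-1 by rewrite (perm_size pv) sA.
(* Since [(u + w) * (u + w + 1) = u * (u + 1) + w * (w + 1) + 2 * u * w], the bound leaves a
   displacement of at least [u * w]. *)
have := linear_probing_ge (words_in_urns vl) sv isT.
have -> : sumn v = sumn A by exact: perm_sumn.
rewrite sumn_cat; have := sumn_iota1 w; have := sumn_iota1 u.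
rewrite ler_nat lt0b; set d := total_displacement _ _.
by rewrite /l /= => h1 h2 h3; nia.
Qed.

(** The factorials cancel. Each ball costs [x - ln x], close to [kappa + 1], and each doubled
    address a further [ln 2]. *)
Lemma bpmf_unif_mean_ge_uw x u w : 0 <= x -> (w <= u)%N ->
  expR (- ((u + w).+1%:R * x)) * x ^+ (u + w) / ((u + w).+1%:R * 2 ^+ w) <=
  bpmf x (u + w).+1 *
  unif_mean (u + w).+1 (u + w) (fun k => (u * w <= k)%N%:R).
Proof.
move=> x0 wu; set l := (u + w).+1.
apply: (@le_trans _ _ (bpmf x l *
  ((u + w)`!%:R / (2 ^+ w * l%:R ^+ (u + w))))); last first.
  by apply: ler_wpM2l; [exact: bpmf_ge0|exact: unif_mean_ge_uw].
rewrite le_eqVlt; apply/orP; left; apply/eqP.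
have l0 : l%:R != 0 :> R by rewrite pnatr_eq0.
have f0 : (u + w)`!%:R != 0 :> R by rewrite pnatr_eq0 -lt0n fact_gt0.
have lf : l`!%:R = l%:R * (u + w)`!%:R :> R by rewrite -natrM -factS.
rewrite /bpmf lf exprMn [l.-1]/=.
by field; rewrite l0 f0 !expf_neq0// pnatr_eq0.
Qed.
End ManyDisplacements.

(** * Geometric tails and exponential moments of a block *)

Section TailBounds.
Variable R : realType.
Implicit Types (x y z t theta kappa : R) (m n l u w M N : nat).

Lemma sum_geometric_le (q : R) a k : 0 <= q -> q < 1 ->
  \sum_(l <- iota a k) q ^+ l <= q ^+ a / (1 - q).
Proof.
move=> q0 q1; have d0 : 0 < 1 - q by rewrite subr_gt0.
elim: k a => [|k IH] a; first by rewrite big_nil divr_ge0 ?exprn_ge0// ltW.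
rewrite /= big_cons (le_trans (lerD (lexx _) (IH a.+1)))//.
rewrite le_eqVlt; apply/orP; left; apply/eqP; rewrite exprS; field.
exact: lt0r_neq0.
Qed.

(** Fourth powers arise because the displacement is at most quadratic in the length and enters
    squared. With [d = 1 - rho], half of the decay [expR (- d)] absorbs [l ^ 4], by the term of
    order 4 of the exponential series. *)
Lemma sum_pow4_geometric (rho : R) : 0 <= rho -> rho < 1 ->
  exists2 C, 0 <= C &
    forall a k, \sum_(l <- iota a k) l%:R ^+ 4 * rho ^+ l <= C.
Proof.
move=> r0 r1; pose d := 1 - rho; have d0 : 0 < d by rewrite subr_gt0.
pose s := expR (- (d / 2)); pose K := (2 / d) ^+ 4 * 24%:R.
have s1 : s < 1 by rewrite -expR0 ltr_expR oppr_lt0 divr_gt0.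
have s0 : 0 < s by apply: expR_gt0.
have K0 : 0 <= K by rewrite mulr_ge0// exprn_ge0// divr_ge0// ltW.
exists (K / (1 - s)) => [|a k]; first by rewrite divr_ge0// subr_ge0 ltW.
have key l : l%:R ^+ 4 * rho ^+ l <= K * s ^+ l.
  have h1 : rho ^+ l <= expR (- d) ^+ l.
    apply: lerXn2r; rewrite ?nnegrE ?expR_ge0//.
    by apply: le_trans (expR_ge1Dx _); rewrite /d; lra.
  have ld : 0 <= l%:R * (d / 2) by rewrite mulr_ge0// divr_ge0// ltW.
  have h2 : l%:R ^+ 4 <= K * expR (l%:R * (d / 2)).
    have := expR_ge1Dxn 3 ld; rewrite (_ : 4`! = 24)%N// => h.
    have {}h : (l%:R * (d / 2)) ^+ 4 / 24%:R <= expR (l%:R * (d / 2)) by lra.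
    apply: le_trans (ler_wpM2l K0 h); rewrite /K.
    by rewrite le_eqVlt; apply/orP; left; apply/eqP; field; exact: lt0r_neq0.
  apply: (@le_trans _ _ (K * expR (l%:R * (d / 2)) * expR (- d) ^+ l)).
    by apply: ler_pM; rewrite ?exprn_ge0.
  rewrite /s !expRn -mulrA -expRD; apply: ler_wpM2l => //.
  by rewrite ler_expR; lra.
apply: le_trans (ler_sum _ (fun l _ => key l)) _.
rewrite -mulr_sumr ler_wpM2l//.
apply: le_trans (sum_geometric_le _ _ (ltW s0) s1) _.
rewrite ler_pdivrMr ?subr_gt0// mulVf ?subr_eq0 ?gt_eqF//.
by apply: exprn_ile1; rewrite ltW.
Qed.

Lemma bpmf_le x l : 0 < x -> (0 < l)%N ->
  bpmf x l <= x^-1 * (x * expR (1 - x)) ^+ l.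
Proof.
move=> x0 l0; have lR : 0 < l%:R :> R by rewrite ltr0n.
have f0 : 0 < l`!%:R :> R by rewrite ltr0n fact_gt0.
have h := @expn_le_fact R l.
have h2 : (l%:R ^+ l.-1 : R) <= l`!%:R * expR l%:R.
  by apply: le_trans h; rewrite ler_weXn2l ?ler1n// leq_pred.
rewrite /bpmf !exprMn expRn ler_pdivrMr//.
rewrite -[in x ^+ l](prednK l0) exprS.
have -> : l%:R * (1 - x) = l%:R + - (l%:R * x) by ring.
rewrite expRD; set E := expR (- _).
have -> : x^-1 * (x * x ^+ l.-1 * (expR l%:R * E)) * l`!%:R =
  E * ((l`!%:R * expR l%:R) * x ^+ l.-1) by field; rewrite lt0r_neq0.
by rewrite ler_wpM2l ?expR_ge0// ler_wpM2r// exprn_ge0// ltW.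
Qed.

Lemma sum_bpmf_tail_le x L m : 0 < x -> x * expR (1 - x) < 1 ->
  \sum_(l <- iota 1 m | (L < l)%N) bpmf x l <=
  x^-1 * ((x * expR (1 - x)) ^+ L / (1 - x * expR (1 - x))).
Proof.
move=> x0; set q := x * _ => q1.
have q0 : 0 < q by rewrite mulr_gt0 ?expR_gt0.
have f0 l : 0 <= x^-1 * q ^+ l by rewrite mulr_ge0 ?invr_ge0 ?exprn_ge0// ltW.
apply: (@le_trans _ _ (\sum_(l <- iota L.+1 m) x^-1 * q ^+ l)); last first.
  rewrite -mulr_sumr; apply: ler_wpM2l; first by rewrite invr_ge0 ltW.
  apply: le_trans (sum_geometric_le _ _ (ltW q0) q1) _.
  rewrite ler_pM2r ?invr_gt0 ?subr_gt0// exprS ler_piMl ?exprn_ge0 ?ltW//.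
apply: (@le_trans _ _ (\sum_(l <- iota 1 m | (L < l)%N) x^-1 * q ^+ l)).
  rewrite big_seq_cond [leRHS]big_seq_cond; apply: ler_sum => l /andP[+ Ll].
  by rewrite mem_iota => lm; apply: bpmf_le => //; lia.
apply: (@le_trans _ _ (\sum_(l <- iota 1 m ++ iota m.+1 L | (L < l)%N)
    x^-1 * q ^+ l)).
  by rewrite big_cat /= lerDl sumr_ge0.
rewrite -[m.+1]add1n -iotaD addnC iotaD big_cat /= add1n.
rewrite big1_seq ?add0r; last first.
  by move=> l /andP[Ll]; rewrite mem_iota; lia.
by rewrite big_mkcond; apply: ler_sum => l _; case: ifP.
Qed.

Lemma bdisp_le M b : b \in blocks M -> (bdisp b)%:R <= b.1%:R ^+ 2 / 2 :> R.
Proof.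
case/allpairsPdep=> l [u [+ + ->]]; rewrite mem_iota mem_filter => lM /andP[_ ul].
rewrite /bdisp /=; have := total_displacement_le (words_in_urns ul).
have [-> _] := mem_words ul => h.
rewrite ler_pdivlMr// -natrX -natrM ler_nat mulnC; apply: (leq_trans h).
by rewrite leq_exp2r// leq_pred.
Qed.

Lemma expR_le_quad t : 0 <= t -> expR t <= 1 + t + t ^+ 2 * expR t.
Proof.
move=> t0; have h1 : expR t <= 1 + t * expR t.
  have h := expR_ge1Dx (- t).
  have : (1 - t) * expR t <= 1.
    apply: (@le_trans _ _ (expR (- t) * expR t)).
      by rewrite ler_wpM2r ?expR_ge0.
    by rewrite -expRD addNr expR0.
  by lra.
have := ler_wpM2l t0 h1; rewrite expr2; lra.
Qed.

Lemma expRN_le_quad t : 0 <= t -> expR (- t) <= 1 - t + t ^+ 2.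
Proof.
move=> t0; have t1 : 0 < 1 + t by rewrite ltr_wpDr.
rewrite expRN; apply: (@le_trans _ _ (1 + t)^-1).
  by rewrite lef_pV2 ?posrE ?expR_gt0// expR_ge1Dx.
rewrite -div1r ler_pdivrMr//.
have -> : (1 - t + t ^+ 2) * (1 + t) = 1 + t ^+ 3 by ring.
by rewrite lerDl exprn_ge0.
Qed.

Definition bmean x m : R := \sum_(b <- blocks m) bweight x b * (bdisp b)%:R.
(** The second-order remainder in the Chernoff bound: for a truncated block, [expR (kappa * l)]
    dominates [expR (theta * k)] with [k] its displacement. *)
Definition bmoment kappa x m : R := \sum_(b <- blocks m)
  bweight x b * ((bdisp b)%:R ^+ 2 * expR (kappa * b.1%:R)).

Lemma bmean_ge0 x m : 0 <= x -> 0 <= bmean x m.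
Proof. by move=> x0; apply: sumr_ge0 => b _; rewrite mulr_ge0// bweight_ge0. Qed.

Lemma bmoment_ge0 kappa x m : 0 <= x -> 0 <= bmoment kappa x m.
Proof.
move=> x0; apply: sumr_ge0 => b _.
by rewrite mulr_ge0 ?bweight_ge0// mulr_ge0 ?expR_ge0// exprn_ge0.
Qed.

Lemma bmoment_le kappa x m : 0 < x ->
  bmoment kappa x m <= x^-1 *
    \sum_(l <- iota 1 m) l%:R ^+ 4 * (x * expR (1 - x) * expR kappa) ^+ l.
Proof.
move=> x0; apply: (@le_trans _ _ (\sum_(b <- blocks m)
   bweight x b * (b.1%:R ^+ 4 * expR (kappa * b.1%:R)))).
  rewrite /bmoment big_seq [leRHS]big_seq; apply: ler_sum => b bm.
  apply: ler_wpM2l; first exact/bweight_ge0/ltW.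
  apply: ler_wpM2r; first exact: expR_ge0.
  have -> : b.1%:R ^+ 4 = (b.1%:R ^+ 2) ^+ 2 :> R by rewrite -exprM.
  rewrite ler_sqr ?nnegrE ?exprn_ge0//.
  by apply: le_trans (bdisp_le bm) _; rewrite ler_pdivrMr// ler_peMr ?exprn_ge0// ler1n.
have -> : \sum_(b <- blocks m) bweight x b * (b.1%:R ^+ 4 * expR (kappa * b.1%:R))
  = \sum_(l <- iota 1 m) bpmf x l * (l%:R ^+ 4 * expR (kappa * l%:R)).
  rewrite (sum_blocks x m (fun l _ => l%:R ^+ 4 * expR (kappa * l%:R))).
  apply: eq_big_seq => l; rewrite mem_iota => lm; congr (_ * _).
  by rewrite unif_mean_cst//; lia.
rewrite mulr_sumr big_seq [leRHS]big_seq; apply: ler_sum => l.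
rewrite mem_iota => lm; rewrite mulrCA [leRHS]mulrCA.
apply: ler_wpM2l; first exact: exprn_ge0.
rewrite [in leRHS]exprMn mulrA expRn [kappa * _]mulrC.
by apply: ler_wpM2r; rewrite ?expR_ge0// bpmf_le//; lia.
Qed.

Lemma sum_bweight_le1 x m : 0 < x -> \sum_(b <- blocks m) bweight x b <= 1.
Proof. by move=> x0; rewrite sum_bweight sum_bpmf_le1. Qed.

(** For [l <= L] the displacement [k] satisfies [theta * k <= theta * l ^ 2 / 2 <= kappa * l], so
    [expR_le_quad] has an integrable remainder. The nonnegative bound is then summed over all
    blocks. *)
Lemma exp_moment_le theta kappa x L m : 0 < x -> 0 <= theta ->
  theta * L%:R <= 2 * kappa ->
  \sum_(b <- [seq b <- blocks m | b.1 <= L]%N) bweight x b * expR theta ^+ bdisp b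
  <= expR (theta * bmean x m + theta ^+ 2 * bmoment kappa x m).
Proof.
move=> x0 t0 tL; apply: le_trans (expR_ge1Dx _).
apply: (@le_trans _ _ (\sum_(b <- blocks m) (bweight x b +
  (theta * (bweight x b * (bdisp b)%:R) + theta ^+ 2 *
    (bweight x b * ((bdisp b)%:R ^+ 2 * expR (kappa * b.1%:R))))))).
  rewrite big_filter big_seq_cond [leRHS]big_seq [leRHS](bigID (fun b => b.1 <= L)%N) /=.
  have q0 b : 0 <= bweight x b by apply/bweight_ge0/ltW.
  rewrite ler_wpDr//.
    apply: sumr_ge0 => b _; apply: addr_ge0 => //.
    by rewrite addr_ge0// mulr_ge0 ?sqr_ge0// mulr_ge0// mulr_ge0 ?sqr_ge0 ?expR_ge0.
  apply: ler_sum => b /andP[bm bL].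
  have td : 0 <= theta * (bdisp b)%:R by rewrite mulr_ge0.
  have -> : bweight x b + (theta * (bweight x b * (bdisp b)%:R) + theta ^+ 2 *
    (bweight x b * ((bdisp b)%:R ^+ 2 * expR (kappa * b.1%:R)))) =
    bweight x b * (1 + theta * (bdisp b)%:R +
      (theta * (bdisp b)%:R) ^+ 2 * expR (kappa * b.1%:R)) by ring.
  apply: ler_wpM2l => //; rewrite expRn mulrC.
  apply: le_trans (expR_le_quad td) _; rewrite lerD2l.
  apply: ler_wpM2l; first exact: exprn_ge0.
  rewrite ler_expR; apply: le_trans (ler_wpM2l t0 (bdisp_le bm)) _.
  have b0 : 0 <= b.1%:R :> R by [].
  have bLR : b.1%:R <= L%:R :> R by rewrite ler_nat.
  have h1 := ler_wpM2l t0 bLR.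
  have h2 : theta * b.1%:R * b.1%:R <= 2 * kappa * b.1%:R.
    by apply: ler_wpM2r => //; apply: le_trans h1 tL.
  by rewrite expr2; lra.
rewrite !big_split /= -!mulr_sumr -/(bmean x m) -/(bmoment kappa x m).
by rewrite lerD2r sum_bweight_le1.
Qed.

(** With a negative exponent the quadratic bound holds for every length; the factor
    [expR (kappa * l) >= 1] is inserted to share [bmoment] with the upper tail. *)
Lemma exp_moment_neg_le theta kappa x m : 0 < x -> 0 <= theta -> 0 <= kappa ->
  \sum_(b <- blocks m) bweight x b * expR (- theta) ^+ bdisp b
  <= expR (- (theta * bmean x m) + theta ^+ 2 * bmoment kappa x m).
Proof.
move=> x0 t0 k0; apply: le_trans (expR_ge1Dx _).
apply: (@le_trans _ _ (\sum_(b <- blocks m) (bweight x b +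
  (- theta * (bweight x b * (bdisp b)%:R) + theta ^+ 2 *
    (bweight x b * ((bdisp b)%:R ^+ 2 * expR (kappa * b.1%:R))))))).
  apply: ler_sum => b _; have td : 0 <= theta * (bdisp b)%:R by rewrite mulr_ge0.
  have -> : bweight x b + (- theta * (bweight x b * (bdisp b)%:R) + theta ^+ 2 *
    (bweight x b * ((bdisp b)%:R ^+ 2 * expR (kappa * b.1%:R)))) =
    bweight x b * (1 - theta * (bdisp b)%:R +
      (theta * (bdisp b)%:R) ^+ 2 * expR (kappa * b.1%:R)) by ring.
  apply: ler_wpM2l; first exact/bweight_ge0/ltW.
  rewrite expRn mulrN [_ * theta]mulrC.
  apply: le_trans (expRN_le_quad td) _; rewrite lerD2l.
  rewrite ler_peMr ?exprn_ge0//; apply: le_trans (expR_ge1Dx _).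
  by rewrite lerDl mulr_ge0.
rewrite !big_split /= -!mulr_sumr -/(bmean x m) -/(bmoment kappa x m) mulNr.
by rewrite lerD2r sum_bweight_le1.
Qed.
End TailBounds.

(** * Tail bounds for the total displacement at fixed [m] and [n] *)

Section Deviations.
Variable R : realType.
Implicit Types (x y z theta kappa : R) (m n l u w M N : nat).

(** The inverse of the probability in [iidE_hit] at [x = n / m], that is, the cost of the
    conditioning. *)
Definition prefactor m n : R :=
  m%:R / (m - n)%:R * (n`!%:R * expR n%:R) / n%:R ^+ n.

Lemma prefactor_ge1 m n : (0 < n < m)%N -> 1 <= prefactor m n.
Proof.
move=> nm; have N0 : 0 < (m - n)%:R :> R by rewrite ltr0n; lia.
have n0 : 0 < n%:R ^+ n :> R by rewrite exprn_gt0// ltr0n; lia.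
rewrite /prefactor ler_pdivlMr// mul1r.
apply: (le_trans (@expn_le_fact R n)); rewrite ler_peMl// ?mulr_ge0 ?expR_ge0//.
by rewrite ler_pdivlMr// mul1r ler_nat; lia.
Qed.

Lemma prefactor_le m n : (0 < n < m)%N -> prefactor m n <= expR 1 * m%:R ^+ 2.
Proof.
move=> nm; have N0 : 0 < (m - n)%:R :> R by rewrite ltr0n; lia.
have n0 : 0 < n%:R ^+ n :> R by rewrite exprn_gt0// ltr0n; lia.
have N1 : (m - n)%:R^-1 <= 1 :> R by rewrite invf_le1// ler1n; lia.
rewrite /prefactor ler_pdivrMr//.
have h := @fact_le_expn R n ltac:(lia).
have mn : n%:R <= m%:R :> R by rewrite ler_nat; lia.
apply: (@le_trans _ _ (m%:R * (expR 1 * n%:R * n%:R ^+ n))).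
  by apply: ler_pM; rewrite ?divr_ge0 ?mulr_ge0 ?expR_ge0 ?ler_piMr ?(ltW N0).
have -> : m%:R * (expR 1 * n%:R * n%:R ^+ n) =
  expR 1 * (m%:R * n%:R) * n%:R ^+ n :> R by ring.
apply: ler_wpM2r; first exact: ltW.
by apply: ler_wpM2l; rewrite ?expR_ge0// expr2 ler_wpM2l.
Qed.

Lemma unif_mean_prefactor m n (F : nat -> R) : (0 < n < m)%N ->
  unif_mean m n F = prefactor m n *
  iidE (bweight (n%:R / m%:R)) fst bdisp (blocks m) (m - n)
    (fun m' k => (m' == m)%:R * F k).
Proof.
move=> nm; have m0 : m%:R != 0 :> R by rewrite pnatr_eq0; lia.
have x0 : 0 < n%:R / m%:R :> R by rewrite divr_gt0// ltr0n; lia.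
rewrite (@unif_mean_iidE _ _ m n m F x0); last by lia.
by rewrite [m%:R * (n%:R / m%:R)]mulrC divfK.
Qed.

Lemma iidE_upper_tail theta kappa x y L m N : 0 < x -> 0 <= theta ->
  theta * L%:R <= 2 * kappa ->
  iidE (bweight x) fst bdisp (blocks m) N
    (fun _ k => (N%:R * (bmean x m + y) <= k%:R)%R%:R) <=
  expR (- (N%:R * (theta * y - theta ^+ 2 * bmoment kappa x m))) +
  N%:R * \sum_(l <- iota 1 m | (L < l)%N) bpmf x l.
Proof.
move=> x0 t0 tL; set z := N%:R * _.
have q0 b : 0 <= bweight x b by apply/bweight_ge0/ltW.
apply: le_trans.
  apply: (iidE_truncate fst bdisp q0 (fun b => b.1 <= L)%N N).
    exact: sum_bweight_le1.
  by move=> m' k; rewrite ler0n lern1 leq_b1.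
apply: lerD; last first.
  rewrite ler_wpM2l// big_mkcond.
  have -> : \sum_(b <- blocks m) (if ~~ (b.1 <= L)%N then bweight x b else 0) =
     \sum_(b <- blocks m) bweight x b * (L < b.1)%N%:R.
    by apply: eq_bigr => b _; rewrite ltnNge; case: ifP; rewrite ?mulr1 ?mulr0.
  rewrite (sum_blocks x m (fun l _ => (L < l)%N%:R)) [leRHS]big_mkcond.
  rewrite big_seq [leRHS]big_seq; apply: ler_sum => l; rewrite mem_iota => lm.
  rewrite unif_mean_cst; last by lia.
  by case: ifP; rewrite ?mulr1 ?mulr0.
apply: le_trans.
  apply: (@iidE_le _ _ _ fst bdisp q0 _ N _
    (fun _ k => expR (- (theta * z)) * expR theta ^+ k)) => m' k.
  case: (boolP (z <= k%:R)) => zk; last by rewrite mulr_ge0 ?exprn_ge0 ?expR_ge0.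
  rewrite expRn -expRD; apply: le_trans (expR_ge1Dx _); rewrite lerDl.
  by rewrite addrC subr_ge0 mulrC ler_wpM2r.
rewrite iidEZ iidE_expr.
apply: (@le_trans _ _ (expR (- (theta * z)) *
  expR (theta * bmean x m + theta ^+ 2 * bmoment kappa x m) ^+ N)).
  apply: ler_wpM2l; first exact: expR_ge0.
  apply: lerXn2r; rewrite ?nnegrE ?expR_ge0//; last exact: exp_moment_le.
  by apply: sumr_ge0 => b _; rewrite mulr_ge0// exprn_ge0// expR_ge0.
by rewrite expRn -expRD ler_expR /z; lra.
Qed.

Lemma iidE_lower_tail theta kappa x z m N : 0 < x -> 0 <= theta -> 0 <= kappa ->
  iidE (bweight x) fst bdisp (blocks m) N (fun _ k => (k%:R < z)%R%:R) <=
  expR (theta * z - N%:R * (theta * bmean x m - theta ^+ 2 * bmoment kappa x m)).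
Proof.
move=> x0 t0 k0; have q0 b : 0 <= bweight x b by apply/bweight_ge0/ltW.
apply: le_trans.
  apply: (@iidE_le _ _ _ fst bdisp q0 _ N _
    (fun _ k => expR (theta * z) * expR (- theta) ^+ k)) => m' k.
  case: (boolP (k%:R < z)) => zk; last by rewrite mulr_ge0 ?exprn_ge0 ?expR_ge0.
  rewrite expRn -expRD; apply: le_trans (expR_ge1Dx _); rewrite lerDl.
  by rewrite mulrN subr_ge0 mulrC ler_wpM2l// ltW.
rewrite iidEZ iidE_expr.
apply: (@le_trans _ _ (expR (theta * z) *
  expR (- (theta * bmean x m) + theta ^+ 2 * bmoment kappa x m) ^+ N)).
  apply: ler_wpM2l; first exact: expR_ge0.
  apply: lerXn2r; rewrite ?nnegrE ?expR_ge0//; last exact: exp_moment_neg_le.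
  by apply: sumr_ge0 => b _; rewrite mulr_ge0// exprn_ge0// expR_ge0.
by rewrite expRn -expRD ler_expR; lra.
Qed.

Lemma unif_mean_upper_tail theta kappa y L m n : (0 < n < m)%N ->
  let x : R := n%:R / m%:R in 0 <= theta -> theta * L%:R <= 2 * kappa ->
  unif_mean m n (fun k => ((m - n)%:R * (bmean x m + y) <= k%:R)%R%:R) <=
  expR 1 * m%:R ^+ 2 *
  (expR (- ((m - n)%:R * (theta * y - theta ^+ 2 * bmoment kappa x m))) +
   (m - n)%:R * \sum_(l <- iota 1 m | (L < l)%N) bpmf x l).
Proof.
move=> nm x t0 tL; have x0 : 0 < x by rewrite divr_gt0// ltr0n; lia.
have q0 b : 0 <= bweight x b by apply/bweight_ge0/ltW.
rewrite unif_mean_prefactor// -/x; apply: ler_pM.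
- by apply: le_trans (prefactor_ge1 nm).
- by apply: (iidE_ge0 fst bdisp q0) => m' k; rewrite mulr_ge0.
- exact: prefactor_le.
apply: le_trans (iidE_upper_tail _ _ _ x0 t0 tL).
apply: (iidE_le fst bdisp q0) => m' k.
by rewrite ler_piMl// lern1 leq_b1.
Qed.

Lemma unif_mean_lower_tail theta kappa z m n : (0 < n < m)%N ->
  let x : R := n%:R / m%:R in 0 <= theta -> 0 <= kappa ->
  unif_mean m n (fun k => (k%:R < z)%R%:R) <=
  expR 1 * m%:R ^+ 2 *
  expR (theta * z - (m - n)%:R *
    (theta * bmean x m - theta ^+ 2 * bmoment kappa x m)).
Proof.
move=> nm x t0 k0; have x0 : 0 < x by rewrite divr_gt0// ltr0n; lia.
have q0 b : 0 <= bweight x b by apply/bweight_ge0/ltW.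
rewrite unif_mean_prefactor// -/x; apply: ler_pM.
- by apply: le_trans (prefactor_ge1 nm).
- by apply: (iidE_ge0 fst bdisp q0) => m' k; rewrite mulr_ge0.
- exact: prefactor_le.
apply: le_trans (iidE_lower_tail _ _ _ x0 t0 k0).
apply: (iidE_le fst bdisp q0) => m' k.
by rewrite ler_piMl// lern1 leq_b1.
Qed.

(** Here [x] need not be [n / m]: once a big block is removed, the remaining balls and urns have
    another ratio. The Poisson mass is then taken off its mean, hence the Gaussian factor. *)
Lemma iidE_hit_ge x m n M : 0 < x -> (0 < n < m)%N -> (m <= M)%N ->
  (expR 1 * m%:R ^+ 2)^-1 *
    expR (- ((n%:R - m%:R * x) ^+ 2 / (m%:R * x))) <=
  iidE (bweight x) fst bdisp (blocks M) (m - n) (fun m' k => (m' == m)%:R).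
Proof.
move=> x0 nm mM; rewrite iidE_hit//; last by lia.
have m0 : 0 < m%:R :> R by rewrite ltr0n; lia.
have n0 : 0 < n%:R :> R by rewrite ltr0n; lia.
set mu := m%:R * x; have mu0 : 0 < mu by rewrite mulr_gt0.
have f0 : 0 < n`!%:R :> R by rewrite ltr0n fact_gt0.
have key : expR (- ((n%:R - mu) ^+ 2 / mu)) <=
    expR (n%:R - mu) * (mu / n%:R) ^+ n.
  rewrite -[mu / n%:R](lnK (_ : _ \is Num.pos)) ?posrE ?divr_gt0//.
  rewrite expRn -expRD ler_expR.
  have := @ln_ge1V R (mu / n%:R) (divr_gt0 mu0 n0); rewrite invf_div => h.
  (* This rewriting makes the claim exactly [ln (mu / n) >= 1 - n / mu]. *)
  have -> : - ((n%:R - mu) ^+ 2 / mu) = n%:R - mu + n%:R * (1 - n%:R / mu).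
    by field; rewrite lt0r_neq0.
  by rewrite lerD2l ler_wpM2l// ltW.
have e1 : 0 < expR 1 :> R by apply: expR_gt0.
have h : (expR 1 * n%:R)^-1 * expR (- ((n%:R - mu) ^+ 2 / mu)) <=
    expR (- mu) * mu ^+ n / n`!%:R.
  have fact := @fact_le_expn R n ltac:(lia).
  have h1 : (expR 1 * n%:R)^-1 <= n%:R ^+ n / (n`!%:R * expR n%:R) :> R.
    rewrite ler_pdivlMr ?mulr_gt0 ?expR_gt0//.
    by rewrite ler_pdivrMl ?mulr_gt0.
  apply: (@le_trans _ _ (n%:R ^+ n / (n`!%:R * expR n%:R) *
     (expR (n%:R - mu) * (mu / n%:R) ^+ n))).
    by apply: ler_pM => //; rewrite ?expR_ge0// invr_ge0 mulr_ge0// ltW.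
  rewrite le_eqVlt; apply/orP; left; apply/eqP.
  rewrite expRD expr_div_n; field.
  by rewrite !lt0r_neq0 ?exprn_gt0 ?expR_gt0.
apply: le_trans (ler_wpM2l _ h); last by rewrite divr_ge0.
rewrite [leRHS]mulrA; apply: ler_wpM2r; first exact: expR_ge0.
have N1 : 1 <= (m - n)%:R :> R by rewrite ler1n; lia.
have -> : (m - n)%:R / m%:R / (expR 1 * n%:R) =
  (m - n)%:R / (expR 1 * (m%:R * n%:R)) :> R.
  by field; rewrite !lt0r_neq0.
rewrite ler_pdivlMr ?mulr_gt0//; apply: le_trans N1.
rewrite mulrC ler_pdivrMr ?mulr_gt0 ?exprn_gt0// mul1r ler_pM2l//.
by rewrite expr2 ler_pM2l// ler_nat; lia.
Qed.

(* One block carries [u] occupied urns followed by [w] more, as in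
   [unif_mean_ge_uw], and the other blocks behave typically. *)
Lemma unif_mean_lower theta kappa z m n u w : (0 < n < m.-1)%N ->
  (w <= u)%N -> (u + w < n)%N ->
  let x : R := n%:R / m%:R in let l : R := (u + w).+1%:R in
  0 <= theta -> 0 <= kappa ->
  expR (- (l * x)) * x ^+ (u + w) / (l * 2 ^+ w) *
  ((expR 1 * m%:R ^+ 2)^-1 * expR (- (l ^+ 2 / ((m%:R - l) * x))) -
   expR (theta * z - (m - n).-1%:R *
     (theta * bmean x m - theta ^+ 2 * bmoment kappa x m))) <=
  unif_mean m n (fun k => ((u * w)%:R + z <= k%:R)%R%:R).
Proof.
move=> nm wu uwn x l t0 k0.
have m0 : 0 < m%:R :> R by rewrite ltr0n; lia.
have n0 : 0 < n%:R :> R by rewrite ltr0n; lia.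
have x0 : 0 < x by rewrite divr_gt0.
have x1 : x < 1 by rewrite ltr_pdivrMr// mul1r ltr_nat; lia.
have q0 b : 0 <= bweight x b by apply/bweight_ge0/ltW.
rewrite unif_mean_prefactor -/x; last by lia.
set E := iidE _ _ _ _ _ _.
apply: (@le_trans _ _ E); last first.
  rewrite ler_peMl ?prefactor_ge1//; last by lia.
  by apply: (iidE_ge0 fst bdisp q0) => m' k; rewrite mulr_ge0.
have [N NE] : exists N, (m - n)%N = N.+1 by exists (m - n).-1; lia.
rewrite NE /= in E *; set L := (u + w).+1 in l *.
pose G := iidE (bweight x) fst bdisp (blocks m) N
  (fun m' k => (m' == m - L)%N%:R * (z <= k%:R)%R%:R).
have G0 : 0 <= G by apply: (iidE_ge0 fst bdisp q0) => m' k; rewrite mulr_ge0.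
(* The other [N] blocks must have total length [m - L] and total displacement at least [z]; the
   probability of both is at least that of the first event minus that of the failure of the
   second. *)
have GE : (expR 1 * m%:R ^+ 2)^-1 * expR (- (l ^+ 2 / ((m%:R - l) * x))) -
   expR (theta * z - N%:R *
     (theta * bmean x m - theta ^+ 2 * bmoment kappa x m)) <= G.
  rewrite lerBlDr; apply: (@le_trans _ _ (iidE (bweight x) fst bdisp (blocks m) N
     (fun m' k => (m' == m - L)%N%:R))).
    have := @iidE_hit_ge x (m - L) (n - (u + w)) m x0 ltac:(lia) ltac:(lia).
    rewrite (_ : (m - L - (n - (u + w)))%N = N); last by rewrite /L; lia.
    apply: le_trans; apply: ler_pM; rewrite ?expR_ge0//.
      have mL0 : 0 < (m - L)%:R :> R by rewrite ltr0n /L; lia.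
      rewrite lef_pV2 ?posrE ?mulr_gt0 ?expR_gt0 ?exprn_gt0//.
      rewrite ler_pM2l ?expR_gt0// lerXn2r ?nnegrE// ler_nat; lia.
    have -> : (m - L)%:R = m%:R - l :> R by rewrite natrB// /L; lia.
    rewrite ler_expR lerN2; apply: ler_wpM2r.
      rewrite invr_ge0 mulr_ge0 ?(ltW x0)// subr_ge0 ler_nat /L; lia.
    (* The distance from the Poisson mean is [1 - l * (1 - x)], which lies between [- l] and [l]. *)
    have -> : (n - (u + w))%:R - (m%:R - l) * x = 1 - l * (1 - x) :> R.
      rewrite natrB; last by lia.
      rewrite /l /L -natr1 mulrBl /x [m%:R * _]mulrC divfK ?lt0r_neq0//; ring.
    have l1 : 1 <= l by rewrite ler1n.
    have s1 : l * (1 - x) <= l by rewrite ler_piMr//; lra.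
    have s0 : 0 <= l * (1 - x) by rewrite mulr_ge0//; lra.
    rewrite -subr_ge0 subr_sqr; apply: mulr_ge0; lra.
  rewrite /G.
  apply: (@le_trans _ _ (G + iidE (bweight x) fst bdisp (blocks m) N
     (fun _ k => (k%:R < z)%R%:R))); last first.
    by rewrite lerD2l iidE_lower_tail.
  rewrite -iidED; apply: (iidE_le fst bdisp q0) => m' k.
  case: eqP => _ /=; rewrite ?mul1r ?mul0r ?add0r//.
  by case: leP; rewrite ?addr0 ?add0r.
apply: (@le_trans _ _ (bpmf x L * unif_mean L (u + w) (fun k => (u * w <= k)%N%:R) * G)).
  apply: (@le_trans _ _ (expR (- (l * x)) * x ^+ (u + w) / (l * 2 ^+ w) * G)).
    apply: ler_wpM2l => //; rewrite divr_ge0 ?mulr_ge0 ?expR_ge0 ?exprn_ge0//.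
    exact: ltW.
  apply: ler_wpM2r => //; apply: bpmf_unif_mean_ge_uw => //; exact: ltW.
(* The big block is taken as the first draw: its factor becomes a sum over the blocks of length [L]
   with displacement at least [u * w], to be compared with the outer sum of [E]. *)
have -> : bpmf x L * unif_mean L (u + w) (fun k => (u * w <= k)%N%:R) =
  \sum_(b <- blocks m) bweight x b * ((b.1 == L)%:R * (u * w <= bdisp b)%N%:R).
  rewrite (sum_blocks x m (fun l k => (l == L)%:R * (u * w <= k)%N%:R)).
  rewrite (bigD1_seq L) ?iota_uniq//=; last by rewrite mem_iota /L; lia.
  rewrite big1 ?addr0 => [|l' ll].
    by under [in RHS]eq_fun do rewrite eqxx mul1r.
  rewrite (_ : unif_mean _ _ _ = 0) ?mulr0// /unif_mean big1 ?mulr0// => v _.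
  by rewrite (negbTE ll) mul0r.
rewrite mulr_suml; apply: ler_sum => b _; rewrite -mulrA; apply: ler_wpM2l => //.
have [->|bL] := eqVneq b.1 L; last first.
  by rewrite !mul0r; apply: (iidE_ge0 fst bdisp q0) => m' k; rewrite mulr_ge0.
rewrite mul1r; case: leqP => uwb; last first.
  by rewrite mul0r; apply: (iidE_ge0 fst bdisp q0) => m' k; rewrite mulr_ge0.
rewrite mul1r; apply: (iidE_le fst bdisp q0) => m' k.
have -> : (L + m' == m)%N = (m' == m - L)%N by apply/eqP/eqP; rewrite /L; lia.
case: eqP => _; rewrite ?mul0r// !mul1r ler_nat; case: leP => // zk.
have -> : (u * w)%:R + z <= (bdisp b + k)%:R by rewrite natrD lerD// ler_nat.
by [].
Qed.
End Deviations.

(** * Asymptotics *)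

Section Asymptotics.
Variable R : realType.

Lemma near_forall_ge (F : set_system nat) {FF : Filter F} (g : nat -> R)
    (P : R -> Prop) :
  (forall K, \forall n \near F, K <= g n) ->
  (exists K, forall t, K <= t -> P t) -> \forall n \near F, P (g n).
Proof.
move=> gy [K KP]; have := gy K; apply: filterS => n; exact: KP.
Qed.

Lemma poly_le_expR_sqrt (C eps : R) (p : nat) : 0 < eps ->
  exists K, forall t, K <= t -> C * t ^+ p <= expR (eps * Num.sqrt t).
Proof.
move=> e0; set k := (p + p).+1.
have f0 : 0 < k`!%:R :> R by rewrite ltr0n fact_gt0.
pose S := `|C| * k`!%:R / eps ^+ k.
have S0 : 0 <= S by rewrite divr_ge0 ?mulr_ge0 ?exprn_ge0// ltW.
exists (S ^+ 2) => t St; set s := Num.sqrt t.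
have t0 : 0 <= t by apply: le_trans St; exact: sqr_ge0.
have s0 : 0 <= s by apply: sqrtr_ge0.
have Ss : S <= s.
  by rewrite -(ler_pXn2r (n := 2)) ?nnegrE// sqr_sqrtr.
have es : 0 <= eps * s by rewrite mulr_ge0// ltW.
have := expR_ge1Dxn (p + p) es; rewrite -/k => h.
have {}h : (eps * s) ^+ k / k`!%:R <= expR (eps * s) by lra.
apply: le_trans h; rewrite -(sqr_sqrtr t0) -/s -exprM mul2n -addnn.
rewrite ler_pdivlMr// exprMn [s ^+ k]exprS.
apply: (@le_trans _ _ (S * eps ^+ k * s ^+ (p + p))).
  rewrite /S divfK ?lt0r_neq0 ?exprn_gt0// mulrAC ler_wpM2r ?exprn_ge0//.
  by rewrite ler_wpM2r// ler_norm.
rewrite mulrA ler_wpM2r ?exprn_ge0// mulrC ler_wpM2l ?exprn_ge0// ltW//.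
Qed.

Lemma poly_le_expR (C eps : R) (p : nat) : 0 < eps ->
  exists K, forall t, K <= t -> C * t ^+ p <= expR (eps * t).
Proof.
move=> e0; have [K HK] := poly_le_expR_sqrt C p e0.
exists (Num.max K 1) => t; rewrite ge_max => /andP[Kt t1].
apply: le_trans (HK _ Kt) _; rewrite ler_expR ler_pM2l//.
rewrite -(ler_pXn2r (n := 2)) ?nnegrE ?sqrtr_ge0//; last by lra.
rewrite sqr_sqrtr ?expr2 ?ler_peMr//; lra.
Qed.

Lemma lt_of_lt_pred n m : (0 < n)%N -> (n < m.-1)%N -> (0 < n < m)%N.
Proof. lia. Qed.

Variables (mm nn : nat -> nat) (a : R).
Hypothesis lt_nn_mm : forall n : nat, (1 <= n)%N -> (nn n < mm n)%N.
Hypothesis N_cvg : (mm n - nn n)%N @[n --> \oo] --> \oo.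
Hypothesis a_gt1 : 1 < a.
Hypothesis ratio_cvg : (mm n)%:R / (mm n - nn n)%:R @[n --> \oo] --> a.

Let N n : R := (mm n - nn n)%:R.
Let x n : R := (nn n)%:R / (mm n)%:R.
Let xl : R := 1 - 1 / a.
(** Equal to [- ln lam - 1] for [lam = xl * expR (- xl)], where [xl] is the limit of [x n]. *)
Let kappa : R := xl - ln xl - 1.

Lemma near_lt_nn_mm : \forall n \near \oo, (nn n < mm n)%N.
Proof.
near=> n; apply: lt_nn_mm; near: n; exact: nbhs_infty_ge.
Unshelve. all: by end_near. Qed.

Lemma near_N_ge K : \forall n \near \oo, K <= N n.
Proof.
have /cvgnyPge/(_ (Num.bound `|K|)) := N_cvg; apply: filterS => n h.
apply: le_trans (ler_norm K) _; apply: ltW.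
apply: lt_le_trans (archi_boundP (normr_ge0 K)) _.
by rewrite /N ler_nat.
Qed.

Lemma a_gt0 : 0 < a. Proof. exact: lt_trans ltr01 a_gt1. Qed.

Lemma xl_gt0 : 0 < xl.
Proof. by rewrite /xl subr_gt0 div1r invf_lt1 ?a_gt0. Qed.

Lemma xl_lt1 : xl < 1.
Proof. by rewrite /xl ltrBlDr ltrDl div1r invr_gt0 a_gt0. Qed.

Lemma kappa_gt0 : 0 < kappa.
Proof.
have x0 := xl_gt0; have x1 := xl_lt1.
have h : xl - 1 != 0 by rewrite lt_eqF//; lra.
rewrite /kappa; suff : ln xl < xl - 1 by lra.
rewrite -ltr_expR lnK ?posrE//; have := expR_gt1Dx h; lra.
Qed.

Lemma x_cvg : x n @[n --> \oo] --> xl.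
Proof.
have a0 : a != 0 by rewrite gt_eqF ?a_gt0.
have h : 1 - ((mm n)%:R / (mm n - nn n)%:R)^-1 @[n --> \oo] --> 1 - a^-1.
  by apply: cvgB; [exact: cvg_cst|apply: cvgV].
rewrite /xl div1r; apply: cvg_trans h; apply: near_eq_cvg; near=> n.
have nm : (nn n < mm n)%N by near: n; exact: near_lt_nn_mm.
rewrite invf_div natrB 1?ltnW// mulrBl divff ?pnatr_eq0 1?opprB; last by lia.
by rewrite addrC subrK.
Unshelve. all: by end_near. Qed.

Lemma near_x_gt (b : R) : b < xl -> \forall n \near \oo, b < x n.
Proof. by move=> bx; apply: (cvgr_gt _ x_cvg). Qed.

Lemma near_x_lt (b : R) : xl < b -> \forall n \near \oo, x n < b.
Proof. by move=> bx; apply: (cvgr_lt _ x_cvg). Qed.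

Lemma rate_cvg : x n - ln (x n) @[n --> \oo] --> xl - ln xl.
Proof.
apply: cvgB; first exact: x_cvg.
by apply: continuous_cvg; [apply: continuous_ln; exact: xl_gt0|exact: x_cvg].
Qed.

Lemma near_mm_le : \forall n \near \oo, (mm n)%:R <= 2 * a * N n.
Proof.
near=> n.
have N0 : 0 < N n by near: n; have := near_N_ge 1; apply: filterS => n; lra.
rewrite -ler_pdivrMr// ltW//; near: n; apply: (cvgr_lt _ ratio_cvg).
by rewrite ltr_pMl ?a_gt0// ltr1n.
Unshelve. all: by end_near. Qed.

Lemma near_base : \forall n \near \oo,
  [/\ (0 < nn n)%N, (nn n < (mm n).-1)%N, xl / 2 < x n & x n < 1].
Proof.
near=> n.
have nm : (nn n < mm n)%N by near: n; exact: near_lt_nn_mm.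
have N2 : 2 <= N n by near: n; exact: near_N_ge.
have x2 : xl / 2 < x n by near: n; apply: near_x_gt; have := xl_gt0; lra.
have x1 : x n < 1 by near: n; apply: near_x_lt; exact: xl_lt1.
split=> //; last by move: N2; rewrite /N ler_nat; lia.
rewrite lt0n; apply/eqP => nn0; move: x2.
by rewrite /x nn0 mul0r; have := xl_gt0; lra.
Unshelve. all: by end_near. Qed.

Lemma q_cvg_expR n : 0 < x n -> x n * expR (1 - x n) = expR (1 - (x n - ln (x n))).
Proof.
move=> x0; have -> : 1 - (x n - ln (x n)) = ln (x n) + (1 - x n) by ring.
by rewrite expRD lnK ?posrE.
Qed.

(** The tail ratio eventually falls below the exponential of minus the midpoint of [kappa] and [k'];
    against the weight [expR k'] this leaves the fixed ratio [rho < 1], hence a bound uniform in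
    [n]. *)
Lemma near_bmoment_le (k' : R) : k' < kappa ->
  exists2 B, 0 < B & \forall n \near \oo,
    bmoment k' (x n) (mm n) <= B /\
    x n * expR (1 - x n) <= expR (- ((kappa + k') / 2)).
Proof.
move=> kk; pose rho := expR (- ((kappa - k') / 2)).
have r0 : 0 < rho by apply: expR_gt0.
have r1 : rho < 1 by rewrite -expR0 ltr_expR oppr_lt0 divr_gt0// subr_gt0.
have [C C0 HC] := sum_pow4_geometric (ltW r0) r1.
have x0 := xl_gt0.
exists (2 / xl * C + 1).
  by rewrite ltr_wpDl// mulr_ge0// divr_ge0// ltW.
near=> n.
have [nn0 _ x2 x1] : [/\ (0 < nn n)%N, (nn n < (mm n).-1)%N, xl / 2 < x n & x n < 1].
  by near: n; exact: near_base.
have xn0 : 0 < x n by apply: lt_trans x2; lra.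
have q : x n * expR (1 - x n) <= expR (- ((kappa + k') / 2)).
  rewrite q_cvg_expR// ler_expR.
  have : xl - ln xl - (kappa - k') / 2 < x n - ln (x n).
    near: n; apply: (cvgr_gt _ rate_cvg); rewrite ltrBlDr ltrDl divr_gt0//.
    by rewrite subr_gt0.
  by rewrite /kappa; lra.
split=> //.
apply: le_trans (bmoment_le _ _ xn0) _; apply: ler_wpDr => //.
apply: ler_pM.
- by rewrite invr_ge0 ltW.
- apply: sumr_ge0 => l _; rewrite mulr_ge0 ?exprn_ge0// mulr_ge0 ?expR_ge0//.
  by rewrite mulr_ge0 ?expR_ge0// ltW.
- have xl2 : 0 < xl / 2 by rewrite divr_gt0.
  by rewrite -[leRHS]invf_div lef_pV2 ?posrE// ltW.
apply: le_trans (HC 1%N (mm n)); apply: ler_sum => l _.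
apply: ler_wpM2l; first exact: exprn_ge0.
apply: lerXn2r; rewrite ?nnegrE ?expR_ge0//.
  by rewrite mulr_ge0 ?expR_ge0// mulr_ge0 ?expR_ge0// ltW.
apply: le_trans (ler_wpM2r (expR_ge0 _) q) _.
by rewrite -expRD ler_expR; lra.
Unshelve. all: by end_near. Qed.

Let meanY n : R := bmean (x n) (mm n).

Lemma near_upper_tail (y delta : R) : 0 < y -> 0 < delta ->
  \forall n \near \oo,
    unif_mean (mm n) (nn n) (fun k => (N n * (meanY n + y) <= k%:R)%R%:R) <=
    expR (- (Num.sqrt (N n) * (kappa * Num.sqrt (2 * y) - delta))).
Proof.
move=> y0 d0; set S := Num.sqrt (2 * y).
have y2 : 0 < 2 * y by rewrite mulr_gt0.
have S0 : 0 < S by rewrite sqrtr_gt0.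
have yE : y = S ^+ 2 / 2 by rewrite sqr_sqrtr 1?ltW//; field.
have k0 := kappa_gt0; have x0 := xl_gt0; have a0 := a_gt0.
(* The first bound keeps [k'] positive, the second limits the loss [eta * S] in the exponent to
   [delta / 4]. *)
pose eta := Num.min (kappa / 2) (delta / (4 * S)).
have eta0 : 0 < eta by rewrite lt_min !divr_gt0// mulr_gt0.
have etak : eta <= kappa / 2 by rewrite ge_min lexx.
have etaS : eta * S <= delta / 4.
  apply: (@le_trans _ _ (delta / (4 * S) * S)).
    by rewrite ler_pM2r// ge_min lexx orbT.
  by rewrite le_eqVlt; apply/orP; left; apply/eqP; field; exact: lt0r_neq0.
pose k' := kappa - eta; have k'0 : 0 < k' by rewrite /k'; lra.
have kk : k' < kappa by rewrite /k'; lra.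
have [B B0 HB] := near_bmoment_le kk.
pose rho := expR (- ((kappa + k') / 2)).
have r1 : rho < 1 by rewrite -expR0 ltr_expR oppr_lt0; lra.
have r0 : 0 < rho by apply: expR_gt0.
pose D := 4 * k' ^+ 2 / S ^+ 2 * B.
pose C1 := 2 / xl / (1 - rho) * expR k'.
have C10 : 0 < C1 by rewrite mulr_gt0 ?expR_gt0// divr_gt0 ?subr_gt0// divr_gt0.
pose C := expR 1 * (2 * a) ^+ 2 * (expR D + C1).
near=> n.
have [nn0 nm x2 x1] : [/\ (0 < nn n)%N, (nn n < (mm n).-1)%N, xl / 2 < x n & x n < 1].
  by near: n; exact: near_base.
have [HBn Hq] : bmoment k' (x n) (mm n) <= B /\ x n * expR (1 - x n) <= rho.
  by near: n; exact: HB.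
have N1 : 1 <= N n by near: n; exact: near_N_ge.
have mN : (mm n)%:R <= 2 * a * N n by near: n; exact: near_mm_le.
have poly : C * N n ^+ 3 <= expR (delta / 2 * Num.sqrt (N n)).
  near: n; apply: (near_forall_ge (P := fun t =>
    C * t ^+ 3 <= expR (delta / 2 * Num.sqrt t)) near_N_ge).
  by apply: poly_le_expR_sqrt; rewrite divr_gt0.
have xn0 : 0 < x n by apply: lt_trans x2; rewrite divr_gt0.
set s := Num.sqrt (N n) in poly *.
have NE : N n = s ^+ 2 by rewrite sqr_sqrtr//; apply: le_trans N1.
have s0 : 0 < s by rewrite sqrtr_gt0; apply: lt_le_trans N1.
pose T := s * S; have T0 : 0 < T by rewrite mulr_gt0.
(* As [T ^ 2 = 2 * N n * y], the linear term [N n * theta * y] equals [k' * T], while the quadratic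
   term stays bounded by [D]. A block longer than [L] also has probability of order
   [expR (- (k' * T))]. *)
pose L := Num.truncn T; pose theta := 2 * k' / T.
have t0 : 0 <= theta by rewrite divr_ge0 ?mulr_ge0 ?ltW.
have LT : L%:R <= T by rewrite truncn_le ltW.
have TL : T < L%:R + 1 by rewrite natr1; exact: truncnS_gt.
have tL : theta * L%:R <= 2 * k'.
  apply: (le_trans (ler_wpM2l t0 LT)); rewrite /theta divfK// lt0r_neq0//.
have nm' := lt_of_lt_pred nn0 nm.
apply: le_trans (unif_mean_upper_tail _ nm' t0 tL) _.
rewrite -/(N n) -/(x n).
have e1 : expR (- (N n * (theta * y - theta ^+ 2 * bmoment k' (x n) (mm n)))) <=
    expR D * expR (- (k' * T)).
  rewrite -expRD ler_expR mulrBr opprB addrC [leRHS]addrC.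
  have -> : N n * (theta * y) = k' * T.
    by rewrite NE yE /theta /T; field; rewrite !lt0r_neq0.
  rewrite lerD2l.
  have -> : N n * (theta ^+ 2 * bmoment k' (x n) (mm n)) =
      4 * k' ^+ 2 / S ^+ 2 * bmoment k' (x n) (mm n).
    by rewrite NE /theta /T; field; rewrite !lt0r_neq0.
  by rewrite ler_pM2l// divr_gt0 ?mulr_gt0 ?exprn_gt0.
have e2 : \sum_(l <- iota 1 (mm n) | (L < l)%N) bpmf (x n) l <=
    C1 * expR (- (k' * T)).
  have q1 : x n * expR (1 - x n) < 1 by apply: le_lt_trans r1.
  have qn0 : 0 <= x n * expR (1 - x n) by rewrite mulr_ge0 ?expR_ge0 ?ltW.
  apply: (le_trans (sum_bpmf_tail_le _ _ xn0 q1)).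
  have -> : C1 * expR (- (k' * T)) =
    2 / xl * (expR (- (k' * (T - 1))) / (1 - rho)).
    rewrite /C1; have -> : - (k' * (T - 1)) = k' + - (k' * T) by ring.
    have r1' : 0 < 1 - rho by rewrite subr_gt0.
    by rewrite expRD; field; rewrite !lt0r_neq0.
  have q1' : 0 <= 1 - x n * expR (1 - x n) by rewrite subr_ge0; exact: ltW q1.
  apply: ler_pM.
  - by rewrite invr_ge0 ltW.
  - by apply: divr_ge0 => //; exact: exprn_ge0.
  - have xl2 : 0 < xl / 2 by rewrite divr_gt0.
    by rewrite -[leRHS]invf_div lef_pV2 ?posrE// ltW.
  apply: ler_pM; rewrite ?exprn_ge0 ?invr_ge0 ?subr_ge0 ?(ltW q1)//; last first.
    by rewrite lef_pV2 ?posrE ?subr_gt0// lerD2l lerN2.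
  apply: (@le_trans _ _ (rho ^+ L)).
    by apply: lerXn2r; rewrite ?nnegrE// ltW.
  rewrite expRn ler_expR mulrN lerN2 [L%:R * _]mulrC.
  apply: (@le_trans _ _ (k' * L%:R)).
    by apply: ler_wpM2l; [exact: ltW|rewrite lerBlDr ltW].
  by apply: ler_wpM2r => //; lra.
apply: (@le_trans _ _ (C * N n ^+ 3 * expR (- (k' * T)))).
  have -> : C * N n ^+ 3 * expR (- (k' * T)) =
    expR 1 * (2 * a * N n) ^+ 2 *
     (N n * (expR D * expR (- (k' * T))) + N n * (C1 * expR (- (k' * T)))).
    by rewrite /C; ring.
  apply: ler_pM.
  - by rewrite mulr_ge0 ?expR_ge0// exprn_ge0.
  - by rewrite addr_ge0 ?expR_ge0// mulr_ge0 ?sumr_ge0// => l _; rewrite bpmf_ge0// ltW.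
  - rewrite ler_pM2l ?expR_gt0//; apply: lerXn2r; rewrite ?nnegrE//.
    by apply: le_trans mN.
  apply: lerD; last by rewrite ler_wpM2l//; apply: le_trans N1.
  apply: le_trans e1 _; rewrite ler_peMl// mulr_ge0 ?expR_ge0//.
apply: (@le_trans _ _ (expR (delta / 2 * s) * expR (- (k' * T)))).
  by rewrite ler_wpM2r ?expR_ge0.
rewrite -expRD ler_expR /T /k'.
have : s * (eta * S) <= s * (delta / 4) by rewrite ler_pM2l.
have : 0 <= s * delta by rewrite mulr_ge0 ?ltW.
lra.
Unshelve. all: by end_near. Qed.

Lemma bmean_le_bmoment (k' : R) m (z : R) : 0 <= k' -> 0 < z -> bmean z m <= bmoment k' z m.
Proof.
move=> k0 z0; apply: ler_sum => b _; apply: ler_wpM2l; first exact/bweight_ge0/ltW.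
apply: (@le_trans _ _ ((bdisp b)%:R ^+ 2)).
  by rewrite -natrX ler_nat; case: (bdisp b) => // d; rewrite -mulnn leq_pmulr.
rewrite ler_peMr ?exprn_ge0//; apply: le_trans (expR_ge1Dx _).
by rewrite lerDl mulr_ge0.
Qed.

(** The second estimate, with one block fewer, serves [unif_mean_lower], where one block is set
    aside. *)
Lemma near_lower_moment (eps : R) : 0 < eps ->
  exists theta k' C c : R, [/\ 0 <= theta, 0 <= k', 0 < C, 0 < c &
  \forall n \near \oo,
    let z := N n * (meanY n - eps) in
    let b := theta * meanY n - theta ^+ 2 * bmoment k' (x n) (mm n) in
    expR (theta * z - N n * b) <= expR (- (c * N n)) /\
    expR (theta * z - (mm n - nn n).-1%:R * b) <= C * expR (- (c * N n))].
Proof.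
move=> e0; have k0 := kappa_gt0; pose k' := kappa / 2.
have kk : k' < kappa by rewrite /k'; lra.
have k'0 : 0 <= k' by rewrite /k'; lra.
have [B B0 HB] := near_bmoment_le kk.
(* [theta] maximizes [theta * eps - theta ^+ 2 * B], and [c] is the maximum. The missing block
   changes the exponent by at most [theta * B = eps / 2], whence the factor [expR (eps / 2)]. *)
pose theta := eps / (2 * B); pose c := eps ^+ 2 / (4 * B).
have t0 : 0 < theta by rewrite divr_gt0// mulr_gt0.
exists theta, k', (expR (eps / 2)), c; split=> //.
- exact: ltW.
- exact: expR_gt0.
- by rewrite divr_gt0 ?exprn_gt0// mulr_gt0.
have x0 := xl_gt0; near=> n.
set z := N n * (meanY n - eps); set b := theta * meanY n - _.
have [HBn _] : bmoment k' (x n) (mm n) <= B /\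
    x n * expR (1 - x n) <= expR (- ((kappa + k') / 2)).
  by near: n; exact: HB.
have [nn0 nm x2 x1] : [/\ (0 < nn n)%N, (nn n < (mm n).-1)%N, xl / 2 < x n & x n < 1].
  by near: n; exact: near_base.
have xn0 : 0 < x n by apply: lt_trans x2; rewrite divr_gt0.
have N1 : 1 <= N n by near: n; exact: near_N_ge.
have Bn0 : 0 <= bmoment k' (x n) (mm n) by rewrite bmoment_ge0// ltW.
have Y0 : 0 <= meanY n by rewrite bmean_ge0// ltW.
have YB : meanY n <= B by apply: le_trans HBn; apply: bmean_le_bmoment.
have h1 : theta * z - N n * b <= - (c * N n).
  have : theta ^+ 2 * bmoment k' (x n) (mm n) <= theta ^+ 2 * B.
    by rewrite ler_pM2l// exprn_gt0.
  have cE : c = theta * eps - theta ^+ 2 * B.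
    by rewrite /c /theta; field; exact: lt0r_neq0.
  rewrite /z /b cE => h.
  have := ler_wpM2l (le_trans ler01 N1) h; lra.
split; first by rewrite ler_expR.
rewrite -expRD ler_expR.
have NE : N n = (mm n - nn n).-1%:R + 1 by rewrite natr1 prednK//; move: nn0 nm; clear; lia.
have -> : theta * z - (mm n - nn n).-1%:R * b = theta * z - N n * b + b.
  by rewrite [X in _ = _ - X * b + b]NE; ring.
have bE : b <= eps / 2.
  apply: (@le_trans _ _ (theta * meanY n)).
    by rewrite /b lerBlDr lerDl mulr_ge0// exprn_ge0// ltW.
  apply: (@le_trans _ _ (theta * B)); first by rewrite ler_pM2l.
  by rewrite le_eqVlt; apply/orP; left; apply/eqP; rewrite /theta; field; exact: lt0r_neq0.
by lra.
Unshelve. all: by end_near. Qed.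

Let meanD n : R := unif_mean (mm n) (nn n) (fun k => k%:R).

Lemma unif_mean_eq m n (F G : nat -> R) :
  (forall k, (2 * k <= n ^ 2)%N -> F k = G k) -> unif_mean m n F = unif_mean m n G.
Proof.
move=> FG; congr (_ * _); apply: eq_big_seq => w ww; apply: FG.
have [<- _] := mem_words ww.
by apply: total_displacement_le; exact: words_in_urns ww.
Qed.

Lemma unif_meanD m n (F G : nat -> R) :
  unif_mean m n (fun k => F k + G k) = unif_mean m n F + unif_mean m n G.
Proof. by rewrite /unif_mean big_split mulrDr. Qed.

Lemma unif_meanZ m n (c : R) (F : nat -> R) :
  unif_mean m n (fun k => c * F k) = c * unif_mean m n F.
Proof. by rewrite /unif_mean -mulr_sumr mulrCA. Qed.

(** The mean is at least [z] times the probability of reaching [z], and the lower tail is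
    exponentially small in [N n] even after the polynomial cost of the conditioning. *)
Lemma near_meanD_ge (eps : R) : 0 < eps ->
  \forall n \near \oo, N n * (meanY n - eps) <= meanD n.
Proof.
move=> e0; have e2 : 0 < eps / 2 by rewrite divr_gt0.
have [theta [k' [C [c [t0 k0 C0 c0 H]]]]] := near_lower_moment e2.
have kk : kappa / 2 < kappa by have := kappa_gt0; lra.
have [B B0 HB] := near_bmoment_le kk.
pose K := B * (expR 1 * (2 * a) ^+ 2) / (eps / 2).
near=> n; set z := N n * (meanY n - eps / 2).
have [nn0 nm x2 x1] : [/\ (0 < nn n)%N, (nn n < (mm n).-1)%N, xl / 2 < x n & x n < 1].
  by near: n; exact: near_base.
have [HBn _] : bmoment (kappa / 2) (x n) (mm n) <= B /\
    x n * expR (1 - x n) <= expR (- ((kappa + kappa / 2) / 2)).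
  by near: n; exact: HB.
have x0 := xl_gt0; have xn0 : 0 < x n by apply: lt_trans x2; rewrite divr_gt0.
have N1 : 1 <= N n by near: n; exact: near_N_ge.
have N0 : 0 < N n by apply: lt_le_trans N1.
have mN : (mm n)%:R <= 2 * a * N n by near: n; exact: near_mm_le.
have D0 : 0 <= meanD n by apply: unif_mean_ge0.
have [z0|z0] := ltP z 0.
  apply: le_trans D0; apply: le_trans (ltW z0).
  by rewrite /z ler_pM2l//; lra.
have [h1 _] : let z := N n * (meanY n - eps / 2) in
    let b := theta * meanY n - theta ^+ 2 * bmoment k' (x n) (mm n) in
    expR (theta * z - N n * b) <= expR (- (c * N n)) /\
    expR (theta * z - (mm n - nn n).-1%:R * b) <= C * expR (- (c * N n)).
  by near: n; exact: H.
have poly : K * N n ^+ 2 <= expR (c * N n).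
  near: n; apply: (near_forall_ge (P := fun t =>
    K * t ^+ 2 <= expR (c * t)) near_N_ge); exact: poly_le_expR.
have nm' := lt_of_lt_pred nn0 nm.
have m0 : (0 < mm n)%N by move: nn0 nm; clear; lia.
pose p : R := unif_mean (mm n) (nn n) (fun k => (k%:R < z)%R%:R).
have pE : p <= expR 1 * (mm n)%:R ^+ 2 * expR (- (c * N n)).
  apply: (le_trans (unif_mean_lower_tail z nm' t0 k0)).
  by apply: ler_wpM2l => //; rewrite mulr_ge0 ?expR_ge0// exprn_ge0.
have zB : z <= N n * B.
  rewrite ler_pM2l//; apply: (@le_trans _ _ (meanY n)); first lra.
  by apply: le_trans HBn; apply: bmean_le_bmoment => //; have := kappa_gt0; lra.
have zp : z * p <= N n * (eps / 2).
  apply: (@le_trans _ _ (N n * B *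
      (expR 1 * (2 * a * N n) ^+ 2 * expR (- (c * N n))))).
    apply: ler_pM => //; first exact: unif_mean_ge0.
    apply: le_trans pE _; rewrite ler_pM2r ?expR_gt0// ler_pM2l ?expR_gt0//.
    by apply: lerXn2r; rewrite ?nnegrE//; apply: le_trans mN.
  rewrite -mulrA ler_pM2l//.
  have -> : B * (expR 1 * (2 * a * N n) ^+ 2 * expR (- (c * N n))) =
     eps / 2 * (K * N n ^+ 2) / expR (c * N n).
    by rewrite expRN /K; field; rewrite !lt0r_neq0 ?expR_gt0.
  by rewrite ler_pdivrMr ?expR_gt0// ler_pM2l.
have : z - z * p <= meanD n.
  have -> : z - z * p = unif_mean (mm n) (nn n)
      (fun k => z + - z * (k%:R < z)%R%:R).
    by rewrite unif_meanD unif_mean_cst// unif_meanZ mulNr.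
  apply: unif_mean_le => k; case: ltP => h; rewrite ?mulr1 ?mulr0 ?addr0//.
  by rewrite subrr.
by move: zp; rewrite /z; lra.
Unshelve. all: by end_near. Qed.

(** Beyond [z] the displacement is bounded by the square of [mm n], a polynomial factor that the
    upper tail absorbs. *)
Lemma near_meanD_le (eps : R) : 0 < eps ->
  \forall n \near \oo, meanD n <= N n * (meanY n + eps).
Proof.
move=> e0; have e2 : 0 < eps / 2 by rewrite divr_gt0.
pose S := kappa * Num.sqrt (2 * (eps / 2)).
have S0 : 0 < S by rewrite mulr_gt0 ?kappa_gt0// sqrtr_gt0 mulr_gt0.
have S20 : 0 < S / 2 by rewrite divr_gt0.
pose K := (2 * a) ^+ 2 / (eps / 2).
have up0 := near_upper_tail e2 S20.
near=> n; set z := N n * (meanY n + eps / 2).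
have N1 : 1 <= N n by near: n; exact: near_N_ge.
have N0 : 0 < N n by apply: lt_le_trans N1.
have mN : (mm n)%:R <= 2 * a * N n by near: n; exact: near_mm_le.
have [nn0 nm x2 x1] : [/\ (0 < nn n)%N, (nn n < (mm n).-1)%N, xl / 2 < x n & x n < 1].
  by near: n; exact: near_base.
have x0 := xl_gt0; have xn0 : 0 < x n by apply: lt_trans x2; rewrite divr_gt0.
have m0 : (0 < mm n)%N by move: nn0 nm; clear; lia.
have z0 : 0 <= z.
  by rewrite mulr_ge0 ?(ltW N0)// addr_ge0 ?(ltW e2)// bmean_ge0// ltW.
have up : unif_mean (mm n) (nn n) (fun k =>
    (N n * (meanY n + eps / 2) <= k%:R)%R%:R) <=
    expR (- (Num.sqrt (N n) * (S - S / 2))).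
  by near: n; exact: up0.
rewrite -/z in up.
have poly : K * N n ^+ 1 <= expR (S / 2 * Num.sqrt (N n)).
  near: n; apply: (near_forall_ge (P := fun t =>
    K * t ^+ 1 <= expR (S / 2 * Num.sqrt t)) near_N_ge); exact: poly_le_expR_sqrt.
set p := unif_mean _ _ _ in up.
have : meanD n <= z + (mm n)%:R ^+ 2 * p.
  have -> : z + (mm n)%:R ^+ 2 * p = unif_mean (mm n) (nn n)
      (fun k => z + (mm n)%:R ^+ 2 * (z <= k%:R)%R%:R).
    by rewrite unif_meanD unif_mean_cst// unif_meanZ.
  have -> : meanD n = unif_mean (mm n) (nn n)
      (fun k => if (2 * k <= nn n ^ 2)%N then k%:R else 0).
    by apply: unif_mean_eq => k ->.
  apply: unif_mean_le => k; case: leqP => kn; last first.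
    by rewrite addr_ge0// mulr_ge0// exprn_ge0.
  case: (lerP z k%:R) => h /=; last by rewrite mulr0 addr0 ltW.
  rewrite mulr1.
  apply: ler_wpDl => //; rewrite -natrX ler_nat.
  have : (nn n ^ 2 <= mm n ^ 2)%N by rewrite leq_exp2r//; move: nn0 nm; clear; lia.
  by move: kn; clear; lia.
suff : (mm n)%:R ^+ 2 * p <= N n * (eps / 2) by rewrite /z; lra.
apply: (@le_trans _ _ ((2 * a * N n) ^+ 2 * expR (- (Num.sqrt (N n) * (S - S / 2))))).
  apply: ler_pM; rewrite ?exprn_ge0//; first exact: unif_mean_ge0.
  by apply: lerXn2r; rewrite ?nnegrE//; apply: le_trans mN.
have -> : (2 * a * N n) ^+ 2 * expR (- (Num.sqrt (N n) * (S - S / 2))) =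
    N n * (eps / 2 * (K * N n ^+ 1) / expR (S / 2 * Num.sqrt (N n))).
  have -> : Num.sqrt (N n) * (S - S / 2) = S / 2 * Num.sqrt (N n) by field.
  by rewrite expRN /K expr1; field; rewrite !lt0r_neq0 ?expR_gt0.
rewrite ler_pM2l// ler_pdivrMr ?expR_gt0// ler_pM2l//.
Unshelve. all: by end_near. Qed.

Let beta : R :=
  2 * kappa * Num.sqrt ((1 + 1 / kappa) * (1 + (1 + ln 2) / kappa)).

Lemma beta_ge0 : 0 <= beta.
Proof.
by rewrite mulr_ge0 ?sqrtr_ge0// mulr_ge0// ltW ?kappa_gt0.
Qed.

(* [p = sqrt (y * b / A)] and [r = sqrt (y * A / b)], where [A = kappa + 1] and
   [b = A + ln 2], minimize [A * p + b * r] subject to [p * r = y]. *)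
Lemma beta_optimal (y : R) : 0 < y -> exists p r : R, [/\ 0 < r, r <= p,
  p * r = y & (kappa + 1) * p + (kappa + 1 + ln 2) * r = beta * Num.sqrt y].
Proof.
move=> y0; have k0 := kappa_gt0; set A := kappa + 1; set b := A + ln 2.
have l2 : 0 <= ln 2 :> R by rewrite ln_ge0// ler1n.
have A0 : 0 < A by rewrite /A; lra.
have b0 : 0 < b by rewrite /b; lra.
pose sA := Num.sqrt A; pose sb := Num.sqrt b; pose sy := Num.sqrt y.
have sA0 : 0 < sA by rewrite sqrtr_gt0.
have sb0 : 0 < sb by rewrite sqrtr_gt0.
have sy0 : 0 < sy by rewrite sqrtr_gt0.
have AE : A = sA ^+ 2 by rewrite sqr_sqrtr// ltW.
have bE : b = sb ^+ 2 by rewrite sqr_sqrtr// ltW.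
have yE : y = sy ^+ 2 by rewrite sqr_sqrtr// ltW.
have betaE : beta = 2 * (sA * sb).
  have e : (1 + 1 / kappa) * (1 + (1 + ln 2) / kappa) =
      (sA * sb / kappa) ^+ 2.
    rewrite expr_div_n exprMn -AE -bE /b /A; field; exact: lt0r_neq0.
  rewrite /beta e sqrtr_sqr ger0_norm; last first.
    by rewrite divr_ge0 ?mulr_ge0// ltW.
  by field; exact: lt0r_neq0.
exists (sy * sb / sA), (sy * sA / sb); split.
- by rewrite divr_gt0// mulr_gt0.
- rewrite ler_pdivrMr// mulrAC ler_pdivlMr// -!mulrA ler_pM2l// -!expr2.
  by rewrite -AE -bE /b lerDl.
- by rewrite yE; field; rewrite !lt0r_neq0.
- rewrite -/sy betaE AE bE; field; rewrite !lt0r_neq0//.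
Qed.

(** [u] and [w] are [sqrt N * p] and [sqrt N * r], rounded up so that [u * w] still reaches [N * y].
    Their cost is the optimum of [beta_optimal], up to [delta * sqrt N]. *)
Lemma near_block (y delta : R) : 0 < y -> 0 < delta ->
  exists2 K : R, 0 < K & \forall n \near \oo, exists u w : nat,
  [/\ (w <= u)%N, N n * y <= (u * w)%:R, (u + w).+1%:R <= K * Num.sqrt (N n) &
   expR (- (Num.sqrt (N n) * (beta * Num.sqrt y + delta))) <=
   expR (- ((u + w).+1%:R * x n)) * x n ^+ (u + w) /
     ((u + w).+1%:R * 2 ^+ w)].
Proof.
move=> y0 d0; have [p [r [r0 rp pr optimal]]] := beta_optimal y0.
have p0 : 0 < p by apply: lt_le_trans rp.
have k0 := kappa_gt0; have x0 := xl_gt0.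
have l2 : 0 <= ln 2 :> R by rewrite ln_ge0// ler1n.
pose eta := delta / (4 * (p + r)).
have pr0 : 0 < p + r by rewrite addr_gt0.
have eta0 : 0 < eta by rewrite divr_gt0// mulr_gt0.
have etaE : eta * (p + r) = delta / 4 by rewrite /eta; field; exact: lt0r_neq0.
(* [c0] bounds the cost of rounding [u] and [w] up by at most 1 each and of the empty urn closing
   the block. It, the slack [eta] in the rate and the factor [(u + w).+1] use a quarter of [delta]
   each. *)
pose c0 := 2 * (kappa + 1 + eta) + 1 + ln 2.
have c00 : 0 <= c0 by rewrite /c0; lra.
pose K := p + r + 3; have K0 : 0 < K by rewrite /K addr_gt0.
exists K => //; near=> n.
have [nn0 nm x2 x1] : [/\ (0 < nn n)%N, (nn n < (mm n).-1)%N, xl / 2 < x n & x n < 1].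
  by near: n; exact: near_base.
have xn0 : 0 < x n by apply: lt_trans x2; rewrite divr_gt0.
have N1 : 1 <= N n by near: n; exact: near_N_ge.
have Nc : (4 * c0 / delta) ^+ 2 <= N n by near: n; exact: near_N_ge.
have rate : x n - ln (x n) < kappa + 1 + eta.
  near: n; apply: (cvgr_lt _ rate_cvg).
  by rewrite /kappa subrK ltrDl.
have poly : K * N n ^+ 1 <= expR (delta / 4 * Num.sqrt (N n)).
  near: n; apply: (near_forall_ge (P := fun t =>
    K * t ^+ 1 <= expR (delta / 4 * Num.sqrt t)) near_N_ge).
  by apply: poly_le_expR_sqrt; rewrite divr_gt0.
set s := Num.sqrt (N n) in poly *.
have NE : N n = s ^+ 2 by rewrite sqr_sqrtr//; apply: le_trans N1.
have s1 : 1 <= s.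
  by rewrite -(ler_pXn2r (n := 2)) ?nnegrE ?sqrtr_ge0// -NE expr1n.
have s0 : 0 < s by apply: lt_le_trans s1.
have sc : c0 <= delta / 4 * s.
  have h : 4 * c0 / delta <= s.
    by rewrite -(ler_pXn2r (n := 2)) ?nnegrE ?(ltW s0) -?NE// divr_ge0 ?mulr_ge0// ltW.
  move: h; rewrite ler_pdivrMr//; lra.
pose u := (Num.truncn (s * p)).+1; pose w := (Num.truncn (s * r)).+1.
have sp0 : 0 <= s * p by rewrite mulr_ge0// ltW.
have sr0 : 0 <= s * r by rewrite mulr_ge0// ltW.
have u1 : s * p <= u%:R by apply: ltW; exact: truncnS_gt.
have w1 : s * r <= w%:R by apply: ltW; exact: truncnS_gt.
have u2 : u%:R <= s * p + 1 by rewrite /u -natr1 lerD2r truncn_le.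
have w2 : w%:R <= s * r + 1 by rewrite /w -natr1 lerD2r truncn_le.
have lE : (u + w).+1%:R = u%:R + w%:R + 1 :> R by rewrite -natr1 natrD.
have lK : (u + w).+1%:R <= K * s by rewrite lE /K; lra.
exists u, w; split=> //.
- by rewrite ltnS; apply: le_truncn; rewrite ler_pM2l.
- rewrite natrM NE -pr (_ : s ^+ 2 * (p * r) = s * p * (s * r)); last by ring.
  exact: ler_pM.
have -> : x n ^+ (u + w) = expR (ln (x n)) ^+ (u + w) by rewrite lnK ?posrE.
have two : 2 = expR (ln 2) :> R by rewrite lnK ?posrE.
have -> : 2 ^+ w = expR (ln 2) ^+ w :> R by rewrite -two.
rewrite !expRn -expRD lE.
have l0 : 0 < u%:R + w%:R + 1 :> R by rewrite -lE.
have lpoly : u%:R + w%:R + 1 <= expR (delta / 4 * s).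
  rewrite -lE; apply: le_trans lK _; apply: le_trans poly; rewrite ler_pM2l//.
  by rewrite expr1 NE expr2 ler_pMr.
rewrite ler_pdivlMr ?mulr_gt0 ?expR_gt0//.
apply: (@le_trans _ _ (expR (- (s * (beta * Num.sqrt y + delta))) *
   (expR (delta / 4 * s) * expR (w%:R * ln 2)))).
  by rewrite ler_pM2l ?expR_gt0// ler_pM2r ?expR_gt0.
rewrite -!expRD ler_expR -optimal natrD.
have h1 : (u%:R + w%:R) * (x n - ln (x n)) <=
    (s * p + 1 + (s * r + 1)) * (kappa + 1 + eta).
  apply: ler_pM.
  - by rewrite addr_ge0.
  - by rewrite subr_ge0; apply: le_trans (ltW xn0); apply: ln_le0; exact: ltW.
  - exact: lerD.
  - exact: ltW.
have h2 : w%:R * ln 2 <= (s * r + 1) * ln 2 by rewrite ler_wpM2r.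
have h3 : s * (eta * (p + r)) = s * (delta / 4) by rewrite etaE.
move: h1 h2 h3 sc; rewrite /c0; lra.
Unshelve. all: by end_near. Qed.

Lemma sqrtrD_sqr_le (y t : R) : 0 <= y -> 0 <= t ->
  Num.sqrt (y + t ^+ 2) <= Num.sqrt y + t.
Proof.
move=> y0 t0; have s0 := sqrtr_ge0 y.
rewrite -[leRHS]ger0_norm ?addr_ge0// -sqrtr_sqr ler_wsqrtr//.
have := mulr_ge0 s0 t0; rewrite sqrrD sqr_sqrtr// mulr2n; lra.
Qed.

Lemma near_lower_tail (y delta : R) : 0 < y -> 0 < delta ->
  \forall n \near \oo,
    expR (- (Num.sqrt (N n) * (beta * Num.sqrt y + delta))) <=
    unif_mean (mm n) (nn n) (fun k => (meanD n + N n * y <= k%:R)%R%:R).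
Proof.
move=> y0 d0; have b0 := beta_ge0.
(* With [y' = y + 2 * eps], the block makes up for the mean being up to [N * eps] above [N * meanY]
   and for the other blocks falling [N * eps] below it. This raises [beta * sqrt y] by at most
   [delta / 4]. *)
pose t := delta / (4 * (beta + 1)); pose eps := t ^+ 2 / 2.
have b1 : 0 < beta + 1 by rewrite ltr_wpDl.
have t0 : 0 < t by rewrite divr_gt0// mulr_gt0.
have e0 : 0 < eps by rewrite divr_gt0// exprn_gt0.
pose y' := y + t ^+ 2.
have y'0 : 0 < y' by rewrite addr_gt0// exprn_gt0.
have beta_y' : beta * Num.sqrt y' <= beta * Num.sqrt y + delta / 4.
  apply: (@le_trans _ _ (beta * (Num.sqrt y + t))).
    by rewrite ler_wpM2l// sqrtrD_sqr_le// ltW.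
  rewrite mulrDr lerD2l; apply: (@le_trans _ _ ((beta + 1) * t)).
    by rewrite ler_pM2r// lerDl.
  by rewrite le_eqVlt; apply/orP; left; apply/eqP; rewrite /t; field; exact: lt0r_neq0.
have d4 : 0 < delta / 4 by rewrite divr_gt0.
have d2 : 0 < delta / 2 by rewrite divr_gt0.
have [K K0 HK] := near_block y'0 d4.
have [theta [k' [C [c [th0 k0 C0 c0 H]]]]] := near_lower_moment e0.
have x0 := xl_gt0; have xl1 := xl_lt1; have a0 := a_gt0.
(* [D] bounds the Gaussian exponent for [l <= K * sqrt N], [m - l >= N / 2] and [x >= xl / 2]. The
   factor 2 in [P0] makes the hitting probability at least twice [1 / (P0 * N ^ 2)], so half of it
   survives the subtraction of the lower tail. *)
pose D := 4 * K ^+ 2 / xl; pose P0 := 2 * (expR 1 * (2 * a) ^+ 2) * expR D.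
have P00 : 0 < P0 by rewrite !mulr_gt0 ?expR_gt0// exprn_gt0// mulr_gt0.
have mean := near_meanD_le e0.
near=> n.
have [u [w [wu uw lK big]]] : exists u w : nat,
  [/\ (w <= u)%N, N n * y' <= (u * w)%:R, (u + w).+1%:R <= K * Num.sqrt (N n) &
   expR (- (Num.sqrt (N n) * (beta * Num.sqrt y' + delta / 4))) <=
   expR (- ((u + w).+1%:R * x n)) * x n ^+ (u + w) /
     ((u + w).+1%:R * 2 ^+ w)].
  by near: n; exact: HK.
have [_ low] : let z := N n * (meanY n - eps) in
    let b := theta * meanY n - theta ^+ 2 * bmoment k' (x n) (mm n) in
    expR (theta * z - N n * b) <= expR (- (c * N n)) /\
    expR (theta * z - (mm n - nn n).-1%:R * b) <= C * expR (- (c * N n)).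
  by near: n; exact: H.
have Dle : meanD n <= N n * (meanY n + eps) by near: n; exact: mean.
have [nn0 nm x2 x1] : [/\ (0 < nn n)%N, (nn n < (mm n).-1)%N, xl / 2 < x n & x n < 1].
  by near: n; exact: near_base.
have xn0 : 0 < x n by apply: lt_trans x2; rewrite divr_gt0.
have N1 : 1 <= N n by near: n; exact: near_N_ge.
have Nc : (4 * K / xl) ^+ 2 <= N n by near: n; exact: near_N_ge.
have mN : (mm n)%:R <= 2 * a * N n by near: n; exact: near_mm_le.
have poly1 : P0 * N n ^+ 2 <= expR (delta / 2 * Num.sqrt (N n)).
  near: n; apply: (near_forall_ge (P := fun t =>
    P0 * t ^+ 2 <= expR (delta / 2 * Num.sqrt t)) near_N_ge).
  exact: poly_le_expR_sqrt.
have poly2 : C * P0 * N n ^+ 2 <= expR (c * N n).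
  near: n; apply: (near_forall_ge (P := fun t =>
    C * P0 * t ^+ 2 <= expR (c * t)) near_N_ge).
  exact: poly_le_expR.
set s := Num.sqrt (N n) in poly1 big lK *.
have N0 : 0 < N n by apply: lt_le_trans N1.
have NE : N n = s ^+ 2 by rewrite sqr_sqrtr// ltW.
have s0 : 0 < s by rewrite sqrtr_gt0.
have sK : 4 * K / xl <= s.
  rewrite -(ler_pXn2r (n := 2)) ?nnegrE ?(ltW s0) -?NE//.
  by rewrite divr_ge0 ?mulr_ge0// ltW.
have mE : (nn n)%:R = x n * (mm n)%:R.
  by rewrite /x divfK// pnatr_eq0; move: nn0 nm; clear; lia.
have NM : N n <= (mm n)%:R by rewrite ler_nat leq_subr.
set l := (u + w).+1%:R in big lK *.
have Ks : K * s <= xl / 4 * N n.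
  rewrite NE expr2 mulrA ler_pM2r//.
  by move: sK; rewrite ler_pdivrMr//; lra.
have lxN : l <= xl / 4 * N n by apply: le_trans Ks.
have l0 : 0 < l by rewrite ltr0n.
have xN : xl / 2 * N n <= x n * (mm n)%:R.
  by apply: ler_pM => //; rewrite ?divr_ge0 ?ltW.
have uwn : (u + w < nn n)%N.
  rewrite -(ler_nat R) -/l mE; apply: le_trans xN; apply: le_trans lxN _.
  by rewrite ler_pM2r//; lra.
have ml : (mm n)%:R / 2 <= (mm n)%:R - l.
  have : xl / 4 * N n <= 1 / 4 * N n by rewrite ler_pM2r//; lra.
  by move: lxN NM N0; lra.
have Dl : l ^+ 2 / (((mm n)%:R - l) * x n) <= D.
  have m20 : 0 < (mm n)%:R / 2 :> R by rewrite divr_gt0//; apply: lt_le_trans NM.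
  have ml0 : 0 < (mm n)%:R - l by apply: lt_le_trans ml.
  rewrite ler_pdivrMr; last exact: mulr_gt0.
  apply: (@le_trans _ _ ((K * s) ^+ 2)).
    by apply: lerXn2r; rewrite ?nnegrE ?(ltW l0)// mulr_ge0// ltW.
  apply: (@le_trans _ _ (D * (N n / 2 * (xl / 2)))).
    rewrite le_eqVlt; apply/orP; left; apply/eqP; rewrite NE /D; field.
    exact: lt0r_neq0.
  rewrite ler_pM2l; last by rewrite divr_gt0// mulr_gt0// exprn_gt0.
  apply: ler_pM; rewrite ?divr_ge0 ?(ltW N0) ?(ltW x0) ?(ltW x2)//.
  by apply: le_trans ml; rewrite ler_pM2r.
have m0 : 0 < (mm n)%:R :> R by apply: lt_le_trans NM.
set hit := (expR 1 * (mm n)%:R ^+ 2)^-1 *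
    expR (- (l ^+ 2 / (((mm n)%:R - l) * x n))).
have hitE : 2 / (P0 * N n ^+ 2) <= hit.
  have -> : 2 / (P0 * N n ^+ 2) = (expR 1 * (2 * a * N n) ^+ 2)^-1 * expR (- D).
    by rewrite expRN /P0; field; rewrite !lt0r_neq0 ?expR_gt0.
  apply: ler_pM; rewrite ?expR_ge0 ?invr_ge0//.
  - by rewrite mulr_ge0 ?expR_ge0// sqr_ge0.
  - have aN : 0 < 2 * a * N n by rewrite mulr_gt0// mulr_gt0.
    rewrite lef_pV2 ?posrE; last 2 first.
    + by rewrite mulr_gt0 ?expR_gt0// exprn_gt0.
    + by rewrite mulr_gt0 ?expR_gt0// exprn_gt0.
    rewrite ler_pM2l ?expR_gt0//; apply: lerXn2r; rewrite ?nnegrE ?(ltW m0)//.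
    by apply: le_trans mN; exact: ltW.
  by rewrite ler_expR lerN2.
have PN : 0 < P0 * N n ^+ 2 by rewrite mulr_gt0// exprn_gt0.
have low2 : C * expR (- (c * N n)) <= 1 / (P0 * N n ^+ 2).
  rewrite expRN ler_pdivrMr ?expR_gt0// mulrAC mul1r ler_pdivlMr//.
  by rewrite mulrA.
have half : expR (- (delta / 2 * s)) <= 1 / (P0 * N n ^+ 2).
  by rewrite expRN div1r lef_pV2 ?posrE ?expR_gt0.
have nm' : (0 < nn n < (mm n).-1)%N by rewrite nn0.
set z := N n * (meanY n - eps).
apply: (@le_trans _ _ (unif_mean (mm n) (nn n)
    (fun k => ((u * w)%:R + z <= k%:R)%R%:R))); last first.
  apply: unif_mean_le => k; case: (lerP ((u * w)%:R + z) k%:R) => h; last exact: ler0n.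
  rewrite (le_trans _ h)//; apply: le_trans (lerD Dle (lexx _)) _.
  apply: le_trans (lerD uw (lexx z)).
  by rewrite /y' /z /eps; lra.
apply: le_trans (unif_mean_lower z nm' wu uwn th0 k0).
rewrite -/(x n) -/l -/hit.
apply: (@le_trans _ _ (expR (- (s * (beta * Num.sqrt y' + delta / 4))) *
   expR (- (delta / 2 * s)))).
  rewrite -expRD ler_expR.
  have := ler_wpM2l (ltW s0) beta_y'; lra.
apply: ler_pM; rewrite ?expR_ge0//.
apply: le_trans half _.
rewrite lerBrDr; apply: (@le_trans _ _ (1 / (P0 * N n ^+ 2) + 1 / (P0 * N n ^+ 2))).
  by rewrite lerD2l; apply: le_trans low2.
by apply: le_trans hitE; rewrite -mulrDl.
Unshelve. all: by end_near. Qed.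

End Asymptotics.

(** * Upper and lower limits from eventual bounds *)

Section EventualBounds.
Variable R : realType.
Local Open Scope ereal_scope.

Lemma limn_esup_le (u : (\bar R)^nat) (c : R) :
  (forall delta : R, (0 < delta)%R -> \forall n \near \oo, u n <= (c + delta)%:E) ->
  limn_esup u <= c%:E.
Proof.
move=> H; apply/lee_addgt0Pr => e e0; rewrite -EFinD.
apply: ereal_inf_le; exists (ereal_sup (u @` [set n | u n <= (c + e)%:E])).
  by exists [set n | u n <= (c + e)%:E] => //; exact: H.
by apply: ge_ereal_sup => _ [n /= h <-].
Qed.

Lemma limn_einf_ge (u : (\bar R)^nat) (c : R) :
  (forall delta : R, (0 < delta)%R -> \forall n \near \oo, (c - delta)%:E <= u n) ->
  c%:E <= limn_einf u.
Proof.
move=> H; rewrite /limn_einf leeNr -EFinN; apply: limn_esup_le => delta d0.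
apply: filterS (H _ d0) => n h; rewrite leeNl; apply: le_trans h.
by rewrite -EFinN lee_fin; lra.
Qed.
End EventualBounds.

(** * Integer-valued random variables *)

Section NatRandomVariables.
Context d (T : measurableType d) (R : realType) (P : probability T R).
Variable X : {RV P >-> nat}.
Local Open Scope ereal_scope.

Lemma measurable_nat_preimage (A : set nat) : measurable (X @^-1` A).
Proof. by rewrite -[_ @^-1` _]setTI; exact: measurable_funPT. Qed.

Lemma bigcup_nat_levels : \bigcup_k (X @^-1` [set k]) = setT.
Proof. by apply/seteqP; split=> // w _; exists (X w). Qed.

Lemma trivIset_nat_levels (B : set nat) : trivIset B (fun k => X @^-1` [set k]).
Proof. by move=> i j _ _ [w [/= <- <-]]. Qed.

Lemma expectation_nat (g : nat -> R) : (forall k, 0 <= g k)%R ->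
  'E_P[fun w => g (X w)] = \sum_(0 <= k <oo) (g k)%:E * P (X @^-1` [set k]).
Proof.
move=> g0; rewrite unlock -bigcup_nat_levels ge0_integral_bigcup//=.
- apply: eq_eseriesr => k _.
  rewrite (eq_integral (cst (g k)%:E)); first last.
    by move=> w; rewrite inE => /= ->.
  by rewrite integral_cst//; exact: measurable_nat_preimage.
- by move=> k; exact: measurable_nat_preimage.
- rewrite bigcup_nat_levels; apply/measurable_EFinP.
  have -> : (fun w => g (X w)) = g \o X by [].
  by apply: measurableT_comp => //.
- by move=> w _; rewrite lee_fin.
- exact: trivIset_nat_levels.
Qed.

Lemma expectation_nat_le (g : nat -> R) (p : nat -> R) (c : R) :
  (forall k, 0 <= g k)%R -> (forall k, P (X @^-1` [set k]) = (p k)%:E) ->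
  (forall K, \sum_(k <- iota 0 K) g k * p k <= c)%R ->
  'E_P[fun w => g (X w)] <= c%:E.
Proof.
move=> g0 pE H; rewrite expectation_nat//; apply: lime_le.
  apply: is_cvg_ereal_nneg_natsum_cond => k _ _.
  by rewrite mule_ge0// lee_fin.
near=> K; rewrite (eq_bigr (fun k => (g k * p k)%:E)); last first.
  by move=> k _; rewrite pE EFinM.
by rewrite sumEFin lee_fin /index_iota subn0 H.
Unshelve. all: by end_near. Qed.

Lemma expectation_nat_ge (g : nat -> R) k :
  (forall j, 0 <= g j)%R ->
  (g k)%:E * P (X @^-1` [set k]) <= 'E_P[fun w => g (X w)].
Proof.
move=> g0; rewrite expectation_nat//.
have f0 j : 0 <= (g j)%:E * P (X @^-1` [set j]) by rewrite mule_ge0// lee_fin.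
apply: le_trans (nneseries_lim_ge k.+1 (fun j _ _ => f0 j)).
rewrite big_nat_recr//= leeDr// sume_ge0//.
Qed.

Lemma expectation_nat_cvg (g : nat -> R) (p : nat -> R) (c : R) :
  (forall k, 0 <= g k)%R -> (forall k, P (X @^-1` [set k]) = (p k)%:E) ->
  (\sum_(k <- iota 0 K) g k * p k)%R @[K --> \oo] --> c ->
  'E_P[fun w => g (X w)] = c%:E.
Proof.
move=> g0 pE H; rewrite expectation_nat//; apply/cvg_lim => //.
have e K : \sum_(0 <= k < K) (g k)%:E * P (X @^-1` [set k]) =
    (\sum_(k <- iota 0 K) g k * p k)%:E.
  rewrite -sumEFin /index_iota subn0; apply: eq_bigr => k _.
  by rewrite pE EFinM.
rewrite (_ : (fun K => _) = EFin \o (fun K => \sum_(k <- iota 0 K) g k * p k)%R).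
  by apply: cvg_EFin => //; near=> K.
by apply/funext => K; rewrite e.
Unshelve. all: by end_near. Qed.

Lemma nat_preimage_le (A : set nat) (p : nat -> R) (c : R) :
  (forall k, P (X @^-1` [set k]) = (p k)%:E) ->
  (forall K, \sum_(k <- iota 0 K) (k \in A)%:R * p k <= c)%R ->
  P (X @^-1` A) <= c%:E.
Proof.
move=> pE H; have := expectation_nat_le (g := fun k => (k \in A)%:R) _ pE H.
have -> : (fun w => (X w \in A)%:R) = \1_(X @^-1` A) :> (T -> R).
  by apply/funext => w; rewrite indicE; congr (_%:R); apply/idP/idP; rewrite !inE.
by rewrite expectation_indic; [apply|exact: measurable_nat_preimage].
Qed.
End NatRandomVariables.

(** * The law of the total displacement *)

Section Hashing.
Context d (T : measurableType d) (R : realType) (Q : probability T R).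
Variables (m n : nat) (h : 'I_n -> {RV Q >-> nat}).
Hypothesis h_unif : forall i, uniform_on_urns m (h i).
Hypothesis h_indep : mutually_independent h.
Hypothesis m_gt0 : (0 < m)%N.

Let addresses w : seq nat := [seq h i w | i <- enum 'I_n].

Lemma size_addresses w : size (addresses w) = n.
Proof. by rewrite size_map size_enum_ord. Qed.

Lemma addresses_set (v : seq nat) : size v = n ->
  [set w | addresses w = v] =
  \bigcap_(i in [set` [set: 'I_n]%SET]) (h i @^-1` [set nth 0%N v i]).
Proof.
move=> sv; apply/seteqP; split=> [w /= e i _|w /= H].
  by rewrite /= -e (nth_map i) ?size_enum_ord// nth_ord_enum.
apply: (@eq_from_nth _ 0%N); first by rewrite size_addresses sv.
move=> i; rewrite size_addresses => ni.
have hi : [set` [set: 'I_n]%SET] (Ordinal ni) by rewrite /= inE.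
rewrite -(H _ hi) /= /addresses (nth_map (Ordinal ni)) ?size_enum_ord//.
by congr (h _ w); apply: val_inj; rewrite /= nth_enum_ord.
Qed.

Lemma measurable_addresses_eq (v : seq nat) :
  measurable [set w | addresses w = v].
Proof.
have [sv|sv] := eqVneq (size v) n; last first.
  rewrite (_ : [set w | _] = set0) //; apply/seteqP; split=> // w /= e.
  by move: sv; rewrite -e size_addresses eqxx.
rewrite (addresses_set sv); apply: fin_bigcap_measurable => // i _.
exact: measurable_nat_preimage.
Qed.

Lemma measurable_addresses (B : set (seq nat)) :
  measurable [set w | B (addresses w)].
Proof.
rewrite (_ : [set w | _] =
    \bigcup_v ([set w | addresses w = v] `&` [set _ | B v])).
  apply: countable_bigcupT_measurable => [|v]; first exact: countableP.
  have [Bv|Bv] := pselect (B v).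
    rewrite (_ : [set _ | B v] = setT) ?setIT; last by apply/seteqP; split.
    exact: measurable_addresses_eq.
  by rewrite (_ : [set _ | B v] = set0) ?setI0//; apply/seteqP; split.
by apply/seteqP; split=> [w /= Bw|w /= [v _ [/= -> //]]]; exists (addresses w).
Qed.

Lemma addresses_eq_prob (v : seq nat) : v \in words (iota 1 m) n ->
  Q [set w | addresses w = v] = ((m%:R ^+ n)^-1)%:E.
Proof.
move=> vw; have [sv sub] := mem_words vw.
rewrite (addresses_set sv) h_indep.
rewrite (eq_bigr (fun=> (m%:R^-1)%:E)); last first.
  move=> i _; rewrite h_unif.
  have : nth 0%N v i \in iota 1 m by apply: sub; rewrite mem_nth// sv.
  by rewrite mem_iota add1n ltnS => ->.
by rewrite -(big_morph EFin (@EFinM R) erefl) prodr_const cardsT card_ord exprVn.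
Qed.

(** Summing over the address lists in the urns gives only a lower bound [ge]. Applied to [p] and to
    its complement, whose uniform means add up to 1, it forces equality. *)
Lemma hash_displacement_prob (p : pred nat) :
  measurable [set w | p (hash_displacement m h w)] /\
  Q [set w | p (hash_displacement m h w)] =
    (unif_mean m n (fun k => (p k)%:R))%:E.
Proof.
have mE (p' : pred nat) : measurable [set w | p' (hash_displacement m h w)].
  exact: (measurable_addresses [set v | p' (total_displacement m v)]).
split=> //; pose W := words (iota 1 m) n.
have uW : uniq W by apply: words_uniq; exact: iota_uniq.
have ge (p' : pred nat) : ((unif_mean m n (fun k => (p' k)%:R))%:E <=
    Q [set w | p' (hash_displacement m h w)])%E.
  rewrite /unif_mean mulr_sumr -/W.
  have [V [VW uV sub eqV]] : exists V, [/\ {subset V <= W}, uniq V,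
      (forall v, v \in V -> p' (total_displacement m v)) &
      \sum_(v <- W) (m%:R ^+ n)^-1 * (p' (total_displacement m v))%:R =
      \sum_(v <- V) (m%:R ^+ n)^-1 :> R].
    exists [seq v <- W | p' (total_displacement m v)]; split.
    - by move=> v; rewrite mem_filter => /andP[].
    - exact: filter_uniq.
    - by move=> v; rewrite mem_filter => /andP[].
    - rewrite big_filter [RHS]big_mkcond; apply: eq_bigr => v _.
      by case: ifP; rewrite ?mulr1 ?mulr0.
  rewrite eqV; pose U (V : seq (seq nat)) := [set w | addresses w \in V].
  have mU V' : measurable (U V').
    exact: (measurable_addresses [set v | v \in V']).
  apply: (@le_trans _ _ (Q (U V))); last first.
    by apply: le_measure; rewrite ?inE; [exact: mU|exact: mE|move=> w /sub].
  move: VW uV; elim: (V) => [|v V' IH] VW /=; first by rewrite big_nil.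
  case/andP=> vV uV'; have UE : U (v :: V') = [set w | addresses w = v] `|` U V'.
    apply/seteqP; split=> w /=; rewrite /U /= inE.
      by case/orP => [/eqP->|->]; [left|right].
    by case=> [->|->]; rewrite ?eqxx ?orbT.
  rewrite UE measureU; [|exact: measurable_addresses_eq|exact: mU|]; last first.
    apply/seteqP; split=> // w [/= ev]; rewrite /U /= ev => vV'.
    by rewrite vV' in vV.
  rewrite big_cons EFinD; apply: leeD.
    by rewrite -(@addresses_eq_prob v)//; apply: VW; rewrite mem_head.
  by apply: IH => // u uV; apply: VW; rewrite inE uV orbT.
apply/eqP; rewrite eq_le ge andbT.
have := ge (predC p).
have -> : [set w | (predC p) (hash_displacement m h w)] =
    ~` [set w | p (hash_displacement m h w)].
  by apply/seteqP; split=> w /= /negP.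
rewrite probability_setC//.
have fin : Q [set w | p (hash_displacement m h w)] \is a fin_num.
  exact: fin_num_measure.
rewrite -(fineK fin) -EFinB !lee_fin => H.
have : unif_mean m n (fun k => (p k)%:R) +
    unif_mean m n (fun k => ((predC p) k)%:R) = 1 :> R.
  rewrite -unif_meanD -[RHS](unif_mean_cst n 1 m_gt0); congr unif_mean.
  by apply/funext => k /=; case: (p k); rewrite ?addr0 ?add0r.
by move: H; lra.
Qed.
End Hashing.

(** * Normalization and mean of the Borel law *)

Section Borel.
Variable R : realType.
Implicit Types (x : R) (m n l L : nat).

Lemma x_expR_lt1 x : 0 < x < 1 -> x * expR (1 - x) < 1.
Proof.
move=> /andP[x0 x1]; have h : x - 1 != 0 by rewrite lt_eqF// subr_lt0.
have := expR_gt1Dx h; rewrite addrC subrK => lt.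
by rewrite -opprB expRN ltr_pdivrMr ?expR_gt0// mul1r.
Qed.

Lemma sum_iota1S (f : nat -> R) L :
  \sum_(l <- iota 1 L.+1) f l = \sum_(l <- iota 1 L) f l + f L.+1.
Proof. by rewrite -[in iota _ _](addn1 L) iotaD big_cat big_seq1 add1n. Qed.

Lemma sum_iota1_cvg (f : nat -> R) (c : R) : (forall l, 0 <= f l) ->
  (forall L, \sum_(l <- iota 1 L) f l <= c) ->
  exists2 s, \sum_(l <- iota 1 L) f l @[L --> \oo] --> s &
    (forall L, \sum_(l <- iota 1 L) f l <= s) /\ s <= c.
Proof.
move=> f0 fc; pose u L := \sum_(l <- iota 1 L) f l.
have nu : nondecreasing_seq u.
  by apply/nondecreasing_seqP => L; rewrite /u sum_iota1S lerDl.
have cu : cvgn u.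
  by apply: nondecreasing_is_cvgn => //; exists c => _ [L _ <-]; exact: fc.
exists (limn u) => //; split.
  by move=> L; exact: nondecreasing_cvgn_le.
by apply: limr_le => //; near=> L; exact: fc.
Unshelve. all: by end_near. Qed.

Lemma sum_bpmf_cvg m n : (0 < n < m)%N ->
  \sum_(l <- iota 1 L) bpmf (n%:R / m%:R) l @[L --> \oo] --> (1 : R).
Proof.
move=> nm; have x0 : 0 < n%:R / m%:R :> R by rewrite divr_gt0// ltr0n; lia.
have [s cs [les s1]] := sum_iota1_cvg (fun l => bpmf_ge0 l (ltW x0))
  (fun L => sum_bpmf_le1 L x0).
have s1' := le1_sum_bpmf nm les.
have e : s = 1 by apply/eqP; rewrite eq_le s1 s1'.
by rewrite e in cs.
Qed.

(** The terms of the tree series at [x * expR (- x)] are [x * bpmf x l], so this is the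
    normalization of [bpmf], available at the ratios [n / m] because it comes from urn counts. *)
Lemma tree_function_ratio m n : (0 < n < m)%N ->
  let x : R := n%:R / m%:R in tree_function (x * expR (- x)) = x.
Proof.
move=> nm x; have x0 : 0 < x by rewrite divr_gt0// ltr0n; lia.
rewrite /tree_function; apply/cvg_lim => //.
rewrite -(cvg_shiftS _) /=.
rewrite (_ : (fun _ => _) = (fun L => x * \sum_(l <- iota 1 L) bpmf x l)).
  have h : x * \sum_(l <- iota 1 L) bpmf x l @[L --> \oo] --> x * 1.
    by apply: cvgM; [exact: cvg_cst|exact: sum_bpmf_cvg].
  by rewrite mulr1 in h.
apply/funext => L; rewrite mulr_sumr /index_iota subn1 /=.
apply: eq_big_seq => l; rewrite mem_iota => lL.
rewrite /bpmf; move: (x) => y; rewrite !exprMn expRn mulrN.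
have -> : y ^+ l = y * y ^+ l.-1 by rewrite -exprS prednK//; lia.
by ring.
Qed.

Lemma borel_pmf_ratio m n l : (n < m)%N ->
  let x : R := n%:R / m%:R in
  borel_pmf (x * expR (- x)) l = if l == 0%N then 0 else bpmf x l.
Proof.
move=> nm x; have [n0|n0] := posnP n.
  have -> : x = 0 by rewrite /x n0 mul0r.
  rewrite mul0r /borel_pmf eqxx /bpmf mulr0 oppr0 expR0 mul1r.
  case: l => [//|[|l]] /=; first by rewrite expr0 divr1.
  by rewrite expr0n mul0r.
have x0 : 0 < x by rewrite divr_gt0// ltr0n; lia.
have e0 : 0 < expR (- x) by exact: expR_gt0.
have tx : tree_function (x * expR (- x)) = x.
  by apply: tree_function_ratio; rewrite n0.
have xe0 : 0 < x * expR (- x) by exact: mulr_gt0.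
rewrite /borel_pmf gt_eqF// tx.
case: eqP => // l0; rewrite /bpmf -/x; move: (x) x0 => y y0.
rewrite !exprMn expRn mulrN.
have -> : y ^+ l = y * y ^+ l.-1 by rewrite -exprS prednK//; lia.
by field; rewrite !lt0r_neq0// ltr0n fact_gt0.
Qed.

Lemma bpmf_moment4 x rho (C : R) L : 0 < x -> x * expR (1 - x) <= rho ->
  (forall a k, \sum_(l <- iota a k) l%:R ^+ 4 * rho ^+ l <= C) ->
  \sum_(l <- iota 1 L) l%:R ^+ 4 * bpmf x l <= x^-1 * C.
Proof.
move=> x0 xr HC; have q0 : 0 <= x * expR (1 - x).
  by rewrite mulr_ge0 ?expR_ge0// ltW.
apply: (@le_trans _ _ (x^-1 * \sum_(l <- iota 1 L) l%:R ^+ 4 * rho ^+ l)).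
  rewrite mulr_sumr big_seq [leRHS]big_seq; apply: ler_sum => l.
  rewrite mem_iota => lL; rewrite [leRHS]mulrCA; apply: ler_wpM2l.
    exact: exprn_ge0.
  apply: le_trans (bpmf_le x0 _) _; first by lia.
  apply: ler_wpM2l; first by rewrite invr_ge0 ltW.
  by apply: lerXn2r; rewrite ?nnegrE// (le_trans q0).
by apply: ler_wpM2l; rewrite ?invr_ge0 ?HC// ltW.
Qed.

(* [bpmf (x * (1 + t))] has mass at most 1 for every [t], with equality at
   [t = 0]: differentiating at [t = 0] gives the mean. *)
Lemma bpmf_tilt x t l : 0 < x -> -1 < t -> (0 < l)%N ->
  bpmf x l * (1 - l%:R * (x * t) + (l%:R - 1) * ln (1 + t)) <=
  bpmf (x * (1 + t)) l.
Proof.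
move=> x0 t1 l0; have t0 : 0 < 1 + t by lra.
have -> : bpmf (x * (1 + t)) l =
    bpmf x l * expR (- (l%:R * (x * t)) + (l%:R - 1) * ln (1 + t)).
  have -> : (l%:R - 1) * ln (1 + t) = l.-1%:R * ln (1 + t) :> R.
    by rewrite -subn1 natrB.
  rewrite expRD -expRn lnK ?posrE// /bpmf.
  have -> : - (l%:R * (x * (1 + t))) = - (l%:R * x) + - (l%:R * (x * t)) by ring.
  by rewrite expRD [l%:R * (x * (1 + t))]mulrA [(_ * (1 + t)) ^+ _]exprMn; ring.
apply: ler_wpM2l; first exact/bpmf_ge0/ltW.
by rewrite -addrA; exact: expR_ge1Dx.
Qed.

(** Summing [bpmf_tilt] over [l] gives [(M - 1) * ln (1 + t) <= M * (x * t)] for all [t > -1], with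
    [M] the mean; small [t] of either sign then force [M - 1 = M * x]. *)
Lemma bpmf_mean_cvg m n : (0 < n < m)%N -> let x : R := n%:R / m%:R in
  \sum_(l <- iota 1 L) l%:R * bpmf x l @[L --> \oo] --> (1 - x)^-1.
Proof.
move=> nm x; have m0 : 0 < m%:R :> R by rewrite ltr0n; lia.
have x0 : 0 < x by rewrite divr_gt0// ltr0n; lia.
have x1 : x < 1 by rewrite ltr_pdivrMr// mul1r ltr_nat; lia.
have q1 : x * expR (1 - x) < 1 by apply: x_expR_lt1; rewrite x0.
have q0 : 0 <= x * expR (1 - x) by rewrite mulr_ge0 ?expR_ge0// ltW.
have [C C0 HC] := sum_pow4_geometric q0 q1.
have f0 l : 0 <= l%:R * bpmf x l by rewrite mulr_ge0// bpmf_ge0// ltW.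
have bound L : \sum_(l <- iota 1 L) l%:R * bpmf x l <= x^-1 * C.
  apply: le_trans (bpmf_moment4 L x0 (lexx _) HC); apply: ler_sum => l _.
  apply: ler_wpM2r; first exact/bpmf_ge0/ltW.
  by rewrite -natrX ler_nat; case: l => // l; rewrite -[leqLHS]expn1 leq_pexp2l.
have [M cM [leM _]] := sum_iota1_cvg f0 bound.
have M1 : 1 <= M.
  have cS := sum_bpmf_cvg nm.
  rewrite -(cvg_lim _ cS)//; apply: limr_le; first by apply/cvg_ex; exists 1.
  near=> L; apply: le_trans (leM L); rewrite big_seq [leRHS]big_seq.
  apply: ler_sum => l; rewrite mem_iota => lL.
  by apply: ler_peMl; [exact/bpmf_ge0/ltW|rewrite ler1n; lia].
have ineq t : -1 < t -> (M - 1) * ln (1 + t) <= M * (x * t).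
  move=> t1; have t0 : 0 < x * (1 + t) by rewrite mulr_gt0//; lra.
  have c : \sum_(l <- iota 1 L) bpmf x l - (x * t) * \sum_(l <- iota 1 L) l%:R * bpmf x l +
      (\sum_(l <- iota 1 L) l%:R * bpmf x l - \sum_(l <- iota 1 L) bpmf x l) * ln (1 + t)
      @[L --> \oo] --> 1 - (x * t) * M + (M - 1) * ln (1 + t).
    have cS := sum_bpmf_cvg nm.
    apply: cvgD; first by apply: cvgB => //; apply: cvgM => //; exact: cvg_cst.
    by apply: cvgM; [exact: cvgB|exact: cvg_cst].
  have : 1 - (x * t) * M + (M - 1) * ln (1 + t) <= 1.
    rewrite -(cvg_lim _ c)//; apply: limr_le; first by apply/cvg_ex; eexists; exact: c.
    near=> L; apply: le_trans (sum_bpmf_le1 L t0).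
    rewrite mulr_sumr -!sumrB mulr_suml -big_split big_seq [leRHS]big_seq /=.
    apply: ler_sum => l; rewrite mem_iota => lL.
    apply: le_trans (bpmf_tilt x0 t1 _); last by lia.
    by rewrite le_eqVlt; apply/orP; left; apply/eqP; ring.
  by lra.
suff -> : (1 - x)^-1 = M by [].
have x1' : 1 - x != 0 by rewrite subr_eq0 gt_eqF.
apply: (mulIf x1'); rewrite mulVf//; apply/eqP; rewrite eq_le; apply/andP; split.
  suff : M * x <= M - 1 by lra.
  apply/ler_addgt0Pr => e e0.
  pose s := Num.min (1 / 2) (e / (M * x)).
  have Mx : 0 < M * x by rewrite mulr_gt0//; lra.
  have s0 : 0 < s by rewrite lt_min; rewrite !divr_gt0.
  have s1 : s <= 1 / 2 by rewrite ge_min lexx.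
  have se : M * x * s <= e by rewrite mulrC -ler_pdivlMr// ge_min lexx orbT.
  have := ineq (- s) ltac:(lra).
  have h1 : 0 < 1 + - s by lra.
  have := ln_ge1V h1; set L := ln _ => hL h.
  have : (M - 1) * (1 - (1 + - s)^-1) <= (M - 1) * L by rewrite ler_wpM2l//; lra.
  have -> : 1 - (1 + - s)^-1 = - s / (1 + - s) by field; rewrite lt0r_neq0.
  move=> h2; have {h2} : (M - 1) * (- s / (1 + - s)) <= - (M * x * s) by lra.
  rewrite mulrA ler_pdivrMr// => h3.
  have : s * (M * x * (1 - s)) <= s * (M - 1) by lra.
  by rewrite ler_pM2l//; lra.
suff : M - 1 <= M * x by lra.
apply/ler_addgt0Pr => e e0.
have Mx : 0 < M * x by rewrite mulr_gt0//; lra.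
pose s := e / (M * x); have s0 : 0 < s by rewrite divr_gt0.
have se : M * x * s = e by rewrite /s; field; rewrite !lt0r_neq0//; lra.
have := ineq s ltac:(lra); have h1 : 0 < 1 + s by lra.
have := ln_ge1V h1; set L := ln _ => hL h.
have : (M - 1) * (1 - (1 + s)^-1) <= (M - 1) * L by rewrite ler_wpM2l//; lra.
have -> : 1 - (1 + s)^-1 = s / (1 + s) by field; rewrite lt0r_neq0.
move=> h2; have {h2} : (M - 1) * (s / (1 + s)) <= M * x * s by lra.
rewrite mulrA ler_pdivrMr// => h3.
have : s * (M - 1) <= s * (M * x * (1 + s)) by lra.
by rewrite ler_pM2l//; lra.
Unshelve. all: by end_near. Qed.
End Borel.

(** * Bound for the characteristic function *)

Section CharacteristicFunction.
Variable R : realType.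
Implicit Types (s t u v a b : R).

Lemma sin_ge_half t : 0 <= t <= pi / 4 -> t / 2 <= sin t.
Proof.
move=> /andP[t0 t4]; have [->|tn] := eqVneq t 0; first by rewrite mul0r sin0.
have t0' : 0 < t by rewrite lt_neqAle eq_sym tn.
have [c] := @MVT R (@sin R) (@cos R) 0 t t0' (fun x _ => is_derive_sin x)
  (continuous_subspaceT (@continuous_sin R)).
rewrite in_itv /= => /andP[c0 ct]; rewrite sin0 !subr0 => ->.
rewrite mulrC ler_pM2r//.
have pi0 := pi_gt0 R.
have c4 : 0 <= cos (pi / 4 : R) by apply: cos_ge0_pihalf; apply/andP; split; lra.
have h := @cos_mulr2n R (pi / 4).
have e : pi / 4 *+ 2 = pi / 2 :> R by rewrite mulr2n; field.
rewrite e cos_pihalf in h.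
have h2 : cos (pi / 4) <= cos c.
  apply: ltW; rewrite ltr_cos ?in_itv/=; first exact: lt_le_trans t4.
    by apply/andP; split; lra.
  by apply/andP; split; lra.
apply: le_trans h2; rewrite -(ler_pXn2r (n := 2)) ?nnegrE//.
by rewrite mulr2n in h; lra.
Qed.

(** [cos t = 1 - 2 * sin (t / 2) ^ 2] and [sin (t / 2) >= t / 4] for [t >= 0]. *)
Lemma cos_le_quad t : - (pi / 2) <= t <= pi / 2 -> cos t <= 1 - t ^+ 2 / 8.
Proof.
wlog t0 : t / 0 <= t => [H|] tp.
  have [t0|t0] := leP 0 t; first exact: H.
  by rewrite -cosN -sqrrN; apply: H; [rewrite oppr_ge0 ltW|apply/andP; split; lra].
pose z := t / 2; have tE : t = z *+ 2 by rewrite mulr2n /z; field.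
have /andP[_ t2] := tp.
have hz : 0 <= z <= pi / 4 by apply/andP; split; rewrite /z; lra.
have := sin_ge_half hz; rewrite tE cos_mulr2n => h.
have z0 : 0 <= z by case/andP: hz.
have h2 : (z / 2) ^+ 2 <= sin z ^+ 2.
  by apply: lerXn2r; rewrite ?nnegrE ?divr_ge0//; apply: le_trans h; rewrite divr_ge0.
have := cos2Dsin2 z; rewrite !mulr2n; move: h2; clear; move: (cos z) (sin z) (z) => c s y; lra.
Qed.

Lemma unit_dot_le1 u v t : u ^+ 2 + v ^+ 2 = 1 -> u * cos t + v * sin t <= 1.
Proof.
move=> uv; have := cos2Dsin2 t; have := sqr_ge0 (u - cos t).
have := sqr_ge0 (v - sin t); rewrite !sqrrB !mulr2n; lra.
Qed.

Context d (T : measurableType d) (P : probability T R).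
Variable X : {RV P >-> nat}.

Lemma bounded_nat_Lfun (g : nat -> R) : (forall k, `|g k| <= 1) ->
  (fun w => g (X w)) \in Lfun P 1.
Proof.
move=> g1; apply/Lfun1_integrable.
apply: measurable_bounded_integrable => //.
- by apply: fin_num_fun_lty; exact: fin_num_measure.
- have -> : (fun w => g (X w)) = g \o X by [].
  exact: measurableT_comp.
by exists 1; split => // M M1 w _ /=; apply: le_trans (g1 _) (ltW M1).
Qed.

(** The atoms 1 and 2 suffice, as their phases differ by exactly [s]. Projecting on the direction
    [(u, v)] of the characteristic function turns one minus its modulus into the mean of a
    nonnegative [F]. *)
Lemma char_fun_le (p : nat -> R) s :
  (forall k, P (X @^-1` [set k]) = (p k)%:E) -> - pi <= s <= pi ->
  ComplexField.Normc.normc (char_fun P (real_of R X) s) <=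
  1 - Num.min (p 1%N) (p 2%N) * (s ^+ 2 / 16).
Proof.
move=> pE sp; rewrite /char_fun /real_of /=.
pose cs w := cos (s * (X w)%:R); pose sn w := sin (s * (X w)%:R).
rewrite -[fun w => cos _]/cs -[fun w => sin _]/sn.
have csL : cs \in Lfun P 1.
  by apply: (bounded_nat_Lfun (g := fun k => cos (s * k%:R))) => k; exact: cos_max.
have snL : sn \in Lfun P 1.
  by apply: (bounded_nat_Lfun (g := fun k => sin (s * k%:R))) => k; exact: sin_max.
set C := fine 'E_P[cs]; set S := fine 'E_P[sn].
have CE : 'E_P[cs]%E = C%:E by rewrite /C fineK// expectation_fin_num.
have SE : 'E_P[sn]%E = S%:E by rewrite /S fineK// expectation_fin_num.
have p0 k : 0 <= p k by rewrite -lee_fin -pE measure_ge0.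
have [u [v [uv normE]]] : exists u v : R, u ^+ 2 + v ^+ 2 = 1 /\
    Num.sqrt (C ^+ 2 + S ^+ 2) = u * C + v * S.
  set n := Num.sqrt _; have n2 : n ^+ 2 = C ^+ 2 + S ^+ 2.
    by rewrite sqr_sqrtr// addr_ge0 ?sqr_ge0.
  have [n0|n0] := eqVneq n 0.
    exists 1, 0; rewrite expr1n expr0n addr0 mul0r mul1r addr0; split=> //.
    have : C ^+ 2 + S ^+ 2 = 0 by rewrite -n2 n0 expr0n.
    move/eqP; rewrite paddr_eq0 ?sqr_ge0// => /andP[].
    by rewrite sqrf_eq0 => /eqP->; rewrite n0.
  exists (C / n), (S / n); split.
    by rewrite !expr_div_n -mulrDl -n2 divff// sqrf_eq0.
  apply: (mulIf n0); rewrite -expr2 n2; field.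
  exact: n0.
rewrite normE; pose F k := 1 - (u * cos (s * k%:R) + v * sin (s * k%:R)).
have F0 k : 0 <= F k by rewrite subr_ge0 unit_dot_le1.
have EF : 'E_P[fun w => F (X w)]%E = (1 - (u * C + v * S))%:E.
  have -> : (fun w => F (X w)) = cst 1 \- ((u \o* cs) \+ (v \o* sn)).
    by apply/funext => w; rewrite /F /cs /sn /= ![_ * u]mulrC ![_ * v]mulrC.
  have uL : u \o* cs \in Lfun P 1.
    rewrite (_ : u \o* cs = u *: cs) ?rpredZ//.
    by apply/funext => w /=; rewrite mulrC.
  have vL : v \o* sn \in Lfun P 1.
    rewrite (_ : v \o* sn = v *: sn) ?rpredZ//.
    by apply/funext => w /=; rewrite mulrC.
  rewrite expectationB ?Lfun_cst//; last by rewrite rpredD.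
  by rewrite expectation_cst expectationD// !expectationZl// CE SE.
have : ((F 1%N * p 1%N + F 2%N * p 2%N)%R%:E <= 'E_P[fun w => F (X w)])%E.
  rewrite expectation_nat//.
  have f0 j : (0 <= (F j)%:E * P (X @^-1` [set j]))%E.
    by rewrite mule_ge0// lee_fin.
  apply: le_trans (nneseries_lim_ge 3 (fun j _ _ => f0 j)).
  rewrite !big_nat_recr//= big_geq// add0e !pE -!EFinM -!EFinD lee_fin.
  by rewrite -addrA lerDr mulr_ge0.
rewrite EF lee_fin; set mu := Num.min _ _ => H.
have mu1 : mu <= p 1%N by rewrite ge_min lexx.
have mu2 : mu <= p 2%N by rewrite ge_min lexx orbT.
have mu0 : 0 <= mu by rewrite le_min !p0.
have m1 : F 1%N * mu <= F 1%N * p 1%N by rewrite ler_wpM2l.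
have m2 : F 2%N * mu <= F 2%N * p 2%N by rewrite ler_wpM2l.
have FE : s ^+ 2 / 16 <= F 1%N + F 2%N.
  (* [e^(is) + e^(2is) = 2 cos(b) e^(ia)], and [cos b >= 0] as [|b| <= pi / 2]; so
     [F 1 + F 2 >= 2 - 2 * cos b >= b ^ 2 / 4]. *)
  pose a := s + s / 2; pose b := s / 2.
  have e1 : s * 1%:R = a - b by rewrite /a /b; field.
  have e2 : s * 2%:R = a + b by rewrite /a /b; field.
  have /andP[s1 s2] := sp.
  have bp : - (pi / 2) <= b <= pi / 2 by apply/andP; split; rewrite /b; lra.
  have cb : 0 <= cos b by exact: cos_ge0_pihalf.
  have cq := cos_le_quad bp.
  have dot := ler_wpM2l cb (unit_dot_le1 a uv).
  rewrite /F e1 e2 cosB cosD sinB sinD.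
  have -> : s ^+ 2 / 16 = b ^+ 2 / 4 by rewrite /b; field.
  lra.
have := ler_wpM2l mu0 FE; lra.
Qed.
End CharacteristicFunction.

(** * A pair of Borel length and displacement *)

Section BorelPair.
Context d (T : measurableType d) (R : realType) (P : probability T R).
Variables (X Y : {RV P >-> nat}) (m n : nat).
Hypothesis lt_nm : (n < m)%N.
Let x : R := n%:R / m%:R.
Hypothesis X_borel : has_borel_law (x * expR (- x)) X.
Hypothesis Y_given_X : forall l k, (1 <= l)%N ->
  P (X @^-1` [set l] `&` Y @^-1` [set k]) =
  (P (X @^-1` [set l]) * (unif_mean l l.-1 (fun j => (j == k)%:R))%:E)%E.

(** The case [l = 0] is separate because [bpmf x 0] is 1. *)
Definition borel_mass (l : nat) : R := if l == 0%N then 0 else bpmf x l.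

Lemma X_mass l : P (X @^-1` [set l]) = (borel_mass l)%:E.
Proof. by rewrite X_borel; congr EFin; apply: borel_pmf_ratio. Qed.

Lemma x_ge0 : 0 <= x. Proof. by rewrite divr_ge0. Qed.

Lemma sum_borel_mass (g : nat -> R) K :
  \sum_(k <- iota 0 K) g k * borel_mass k =
  \sum_(l <- iota 1 K.-1) g l * bpmf x l.
Proof.
case: K => [|K]; first by rewrite !big_nil.
rewrite /= big_cons {1}/borel_mass eqxx mulr0 add0r.
by apply: eq_big_seq => l; rewrite mem_iota /borel_mass; case: eqP => // ->.
Qed.

(** Read off the probability [P], so that it also holds for [n = 0]. *)
Lemma sum_borel_mass_le1 K : \sum_(k <- iota 0 K) borel_mass k <= 1.
Proof.
have H : (\sum_(k <- iota 0 K) (borel_mass k)%:E <= 1)%E.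
  rewrite -(eq_bigr _ (fun k _ => X_mass k)).
  rewrite -(@probability_setT _ _ _ P) -(bigcup_nat_levels X).
  rewrite measure_bigcup /=; last 2 first.
  - by move=> k _; exact: measurable_nat_preimage.
  - exact: trivIset_nat_levels.
  apply: le_trans (nneseries_lim_ge K _); last by move=> k _ _; exact: measure_ge0.
  rewrite /index_iota subn0 [leRHS]big_mkcond /=.
  by apply: lee_sum => k _; rewrite in_setT.
by move: H; rewrite sumEFin lee_fin.
Qed.

Lemma measurable_Y_gt_X : measurable [set w | (X w ^ 2 < 2 * Y w)%N].
Proof.
have -> : [set w | (X w ^ 2 < 2 * Y w)%N] =
    \bigcup_l (X @^-1` [set l] `&` Y @^-1` [set k | (l ^ 2 < 2 * k)%N]).
  by apply/seteqP; split=> [w /= h|w [l _ [/= -> h]]//]; exists (X w).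
apply: bigcupT_measurable => l.
by apply: measurableI; exact: measurable_nat_preimage.
Qed.

(** The event is a countable union of level sets with [l ^ 2 < 2 * k], each null since [d_{l,l-1}]
    is at most [(l - 1) ^ 2 / 2]. *)
Lemma Y_le_X : P [set w | (X w ^ 2 < 2 * Y w)%N] = 0%E.
Proof.
have mXY l k : measurable (X @^-1` [set l] `&` Y @^-1` [set k]).
  by apply: measurableI; exact: measurable_nat_preimage.
have null l k : (l ^ 2 < 2 * k)%N ->
    P (X @^-1` [set l] `&` Y @^-1` [set k]) = 0%E.
  case: l => [|l] lk.
    apply/eqP; rewrite eq_le measure_ge0 andbT.
    have <- : P (X @^-1` [set 0%N]) = 0%E by rewrite X_mass.
    by apply: le_measure; rewrite ?inE;
      [exact: mXY|exact: measurable_nat_preimage|move=> w []].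
  rewrite Y_given_X// (_ : unif_mean _ _ _ = 0) ?mule0//.
  rewrite -(@unif_mean_cst R l.+1 l 0)//; apply: unif_mean_eq => j jl.
  have : (l ^ 2 <= l.+1 ^ 2)%N by rewrite leq_exp2r.
  by case: eqP => // jk; move: jl lk; rewrite jk /=; clear; lia.
have E_eq : [set w | (X w ^ 2 < 2 * Y w)%N] =
    \bigcup_l \bigcup_k ([set w | (l ^ 2 < 2 * k)%N] `&`
      (X @^-1` [set l] `&` Y @^-1` [set k])).
  apply/seteqP; split=> [w /= h|w [l _ [k _ [/= h [/= -> ->]]]]//].
  by exists (X w) => //; exists (Y w).
have [N [mN N0 sub]] : P.-negligible [set w | (X w ^ 2 < 2 * Y w)%N].
  rewrite E_eq; apply: negligible_bigcup => l; apply: negligible_bigcup => k.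
  have [h|h] := ltnP (l ^ 2) (2 * k).
    exists (X @^-1` [set l] `&` Y @^-1` [set k]); split=> //; exact: null.
  by exists set0; split; [exact: measurable0|exact: measure0|move=> w []].
have mE := measurable_Y_gt_X.
by apply/eqP; rewrite eq_le measure_ge0 andbT -N0; apply: le_measure; rewrite ?inE.
Qed.

Lemma measurable_nat_real (Z : {RV P >-> nat}) (g : nat -> R) :
  measurable_fun setT (fun w => g (Z w)).
Proof.
have -> : (fun w => g (Z w)) = g \o Z by [].
exact: measurableT_comp.
Qed.

Lemma expectation_Y_le (g f : nat -> R) : (forall k, 0 <= g k) ->
  (forall k, 0 <= f k) -> (forall j k, (2 * k <= j ^ 2)%N -> g k <= f j) ->
  ('E_P[fun w => g (Y w)] <= 'E_P[fun w => f (X w)])%E.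
Proof.
move=> g0 f0 gf; apply: expectation_le => //; try exact: measurable_nat_real.
have [N [mN N0 sub]] : P.-negligible [set w | (X w ^ 2 < 2 * Y w)%N].
  by exists [set w | (X w ^ 2 < 2 * Y w)%N]; split=> //; [exact: measurable_Y_gt_X|exact: Y_le_X].
exists N; split=> // w /= h; apply: sub => /=; rewrite ltnNge; apply/negP => /gf.
exact: h.
Qed.

Lemma variance_nat (Z : {RV P >-> nat}) (mu : R) :
  mu = fine 'E_P[real_of R Z] ->
  ('V_P[real_of R Z] = 'E_P[fun w => (((Z w)%:R - mu) ^+ 2)%R])%E.
Proof.
move=> ->; rewrite /variance unlock; congr expectation.body.
Qed.

Variables M : R.
Hypothesis M_ge : forall L, \sum_(l <- iota 1 L) l%:R ^+ 4 * bpmf x l <= M.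

Lemma M_ge0 : 0 <= M.
Proof. by have := M_ge 0; rewrite big_nil. Qed.

Let mu : R := fine 'E_P[real_of R X].

Lemma mu_ge0 : 0 <= mu.
Proof. by apply: fine_ge0; apply: expectation_ge0 => w. Qed.

Lemma expectation_X_pow_le (f : nat -> R) (c : R) : 0 <= c ->
  (forall k, 0 <= f k) -> (forall k, (0 < k)%N -> f k <= c * k%:R ^+ 4) ->
  ('E_P[fun w => f (X w)] <= (c * M)%:E)%E.
Proof.
move=> c0 f0 fc; apply: (expectation_nat_le (p := borel_mass)) => // [k|K].
  exact: X_mass.
rewrite sum_borel_mass; apply: le_trans (ler_wpM2l c0 (M_ge K.-1)).
rewrite mulr_sumr big_seq [leRHS]big_seq; apply: ler_sum => l.
rewrite mem_iota => lK; rewrite [leRHS]mulrA; apply: ler_wpM2r.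
  by rewrite bpmf_ge0// x_ge0.
by apply: fc; lia.
Qed.

Lemma centered_pow_le k p : (0 < k)%N -> (p <= 4)%N ->
  `|k%:R - mu| ^+ p <= (1 + mu) ^+ p * k%:R ^+ 4.
Proof.
move=> k0 p4; have k1 : 1 <= k%:R :> R by rewrite ler1n.
have mu0 := mu_ge0.
apply: (@le_trans _ _ (((1 + mu) * k%:R) ^+ p)).
  apply: lerXn2r; rewrite ?nnegrE ?mulr_ge0 ?addr_ge0//.
  apply: le_trans (ler_normB _ _) _; rewrite !ger0_norm// mulrDl mul1r lerD2l.
  by rewrite ler_peMr.
rewrite exprMn; apply: ler_wpM2l; first by rewrite exprn_ge0// addr_ge0.
exact: ler_weXn2l.
Qed.

Lemma variance_X_le : ('V_P[real_of R X] <= ((1 + mu) ^+ 2 * M)%:E)%E.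
Proof.
rewrite (@variance_nat _ mu)//.
apply: (expectation_X_pow_le (f := fun k => (k%:R - mu) ^+ 2)).
- exact: sqr_ge0.
- by move=> k; exact: sqr_ge0.
by move=> k k0; rewrite -real_normK ?num_real//; exact: centered_pow_le.
Qed.

Lemma moment3_X_le :
  ('E_P[fun w => (`|real_of R X w - mu| ^+ 3)%R] <= ((1 + mu) ^+ 3 * M)%:E)%E.
Proof.
apply: (expectation_X_pow_le (f := fun k => `|k%:R - mu| ^+ 3)).
- by rewrite exprn_ge0// addr_ge0// mu_ge0.
- by move=> k; exact: exprn_ge0.
by move=> k k0; exact: centered_pow_le.
Qed.

(** The atom at 1 alone keeps the variance away from 0, since the mean [1 / (1 - x)] exceeds 1 for
    [x > 0]. *)
Lemma variance_X_ge : (((1 - mu) ^+ 2 * bpmf x 1)%:E <= 'V_P[real_of R X])%E.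
Proof.
rewrite (@variance_nat _ mu)//.
have := @expectation_nat_ge _ _ _ P X (fun k => (k%:R - mu) ^+ 2) 1%N
  (fun k => sqr_ge0 _).
by rewrite X_mass -EFinM.
Qed.

Lemma variance_Y_le : ('V_P[real_of R Y] <= (2 * M + 2 * M ^+ 2)%:E)%E.
Proof.
pose e := fine 'E_P[real_of R Y].
have kj (j k : nat) : (2 * k <= j ^ 2)%N -> (k ^ 2 <= j ^ 4)%N.
  move=> h; have -> : (j ^ 4 = (j ^ 2) ^ 2)%N by rewrite -expnM.
  by rewrite leq_exp2r//; move: h; clear; lia.
have e0 : 0 <= e by apply: fine_ge0; apply: expectation_ge0.
have eM : e <= M.
  have h : ('E_P[real_of R Y] <= M%:E)%E.
    apply: (@le_trans _ _ 'E_P[fun w => ((X w)%:R ^+ 4)%R]%E).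
      apply: (expectation_Y_le (g := fun k => k%:R) (f := fun k => k%:R ^+ 4)) => //.
      move=> j k /kj h; rewrite -natrX ler_nat; apply: leq_trans h.
      by case: (k) => // k'; rewrite -mulnn leq_pmulr.
    rewrite -[M]mul1r.
    apply: (expectation_X_pow_le (f := fun k => k%:R ^+ 4)) => // k.
    by rewrite mul1r.
  have fin : 'E_P[real_of R Y]%E \is a fin_num.
    rewrite ge0_fin_numE; last exact: expectation_ge0.
    by apply: le_lt_trans h _; rewrite ltry.
  by rewrite -lee_fin fineK.
rewrite (@variance_nat _ e)//.
apply: (@le_trans _ _ 'E_P[fun w => (2 * (X w)%:R ^+ 4 + 2 * M ^+ 2)%R]%E).
  apply: (expectation_Y_le (g := fun k => (k%:R - e) ^+ 2)
    (f := fun k => 2 * k%:R ^+ 4 + 2 * M ^+ 2)).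
  - by move=> k; exact: sqr_ge0.
  - by move=> k; rewrite addr_ge0// mulr_ge0// ?exprn_ge0 ?M_ge0.
  move=> j k /kj h; have {}h : k%:R ^+ 2 <= j%:R ^+ 4 :> R.
    by rewrite -!natrX ler_nat.
  have e2 : e ^+ 2 <= M ^+ 2 by apply: lerXn2r; rewrite ?nnegrE// M_ge0.
  have := sqr_ge0 (k%:R + e); rewrite sqrrB sqrrD !mulr2n; lra.
apply: (expectation_nat_le (p := borel_mass)
    (g := fun k => 2 * k%:R ^+ 4 + 2 * M ^+ 2)) => [k|k|K].
- by rewrite addr_ge0// mulr_ge0// ?exprn_ge0 ?M_ge0.
- exact: X_mass.
under eq_bigr do rewrite mulrDl.
rewrite big_split /= -mulr_sumr; apply: lerD; last first.
  by rewrite ler_piMr ?sum_borel_mass_le1// mulr_ge0// sqr_ge0.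
rewrite (sum_borel_mass (fun k => 2 * k%:R ^+ 4)).
under eq_bigr do rewrite -mulrA.
by rewrite -mulr_sumr ler_wpM2l.
Qed.

(** Joint masses are given level by level; the levels of [Y] below [K] are removed from the event
    [X = l] one at a time, and what is left bounds the tail. *)
Lemma Y_tail_ge l K : (0 < l)%N ->
  ((bpmf x l * unif_mean l l.-1 (fun k => (K <= k)%N%:R))%:E <=
   P (Y @^-1` [set k | (K <= k)%N]))%E.
Proof.
move=> l0; pose A k := X @^-1` [set l] `&` Y @^-1` [set j | (k <= j)%N].
have mA k : measurable (A k) by apply: measurableI; exact: measurable_nat_preimage.
have key k : ((bpmf x l)%:E <= P (A k) + (bpmf x l *
    unif_mean l l.-1 (fun j => (j < k)%N%:R))%:E)%E.
  elim: k => [|k IH].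
    rewrite (_ : A 0%N = X @^-1` [set l]); last first.
      by apply/seteqP; split=> w //= [].
    rewrite X_mass /borel_mass; case: eqP l0 => [->//|_ _].
    rewrite leeDl// lee_fin mulr_ge0 ?bpmf_ge0 ?x_ge0//.
    exact: unif_mean_ge0.
  apply: le_trans IH _.
  have -> : unif_mean l l.-1 (fun j => (j < k.+1)%N%:R) =
      unif_mean l l.-1 (fun j => (j < k)%N%:R) +
      unif_mean l l.-1 (fun j => (j == k)%:R) :> R.
    rewrite -unif_meanD; congr unif_mean; apply/funext => j.
    by rewrite ltnS leq_eqVlt; case: ltngtP => // _; rewrite ?addr0 ?add0r.
  rewrite mulrDr EFinD [X in (_ <= _ + X)%E]addeC addeA; apply: leeD2r.
  have -> : A k = (X @^-1` [set l] `&` Y @^-1` [set k]) `|` A k.+1.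
    apply/seteqP; split=> [w [/= Xl kY]|w [[/= Xl Yk]|[/= Xl kY]]].
    - move: kY; rewrite leq_eqVlt => /orP[/eqP e|h]; [left|right]; split=> //=.
    - by split=> //=; rewrite Yk.
    - by split=> //=; exact: ltnW.
  apply: (@le_trans _ _ (P (X @^-1` [set l] `&` Y @^-1` [set k]) + P (A k.+1))%E).
    apply: measureU2 => //.
    by apply: measurableI; exact: measurable_nat_preimage.
  rewrite Y_given_X// X_mass /borel_mass; case: eqP l0 => [->//|_ _].
  by rewrite addeC -EFinM.
have l1 : unif_mean l l.-1 (fun j => (K <= j)%N%:R) +
    unif_mean l l.-1 (fun j => (j < K)%N%:R) = 1 :> R.
  rewrite -unif_meanD -[RHS](unif_mean_cst l.-1 1 l0); congr unif_mean.
  by apply/funext => j; case: leqP; rewrite ?addr0 ?add0r.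
have : ((bpmf x l * unif_mean l l.-1 (fun k => (K <= k)%N%:R))%:E <= P (A K))%E.
  have := key K; have fin : P (A K) \is a fin_num by exact: fin_num_measure.
  rewrite -(fineK fin) -EFinD !lee_fin => h.
  have := congr1 (fun t => bpmf x l * t) l1; rewrite /= mulrDr mulr1; lra.
move=> h; apply: le_trans h _; apply: le_measure; rewrite ?inE.
- exact: mA.
- exact: measurable_nat_preimage.
by move=> w [].
Qed.

Lemma Y_tail_le (u : R) L : 0 < x -> x * expR (1 - x) < 1 ->
  (forall l : nat, 2 * u <= l%:R ^+ 2 -> (L < l)%N) ->
  (P [set w | (u <= real_of R Y w)%R] <=
   (x^-1 * ((x * expR (1 - x)) ^+ L / (1 - x * expR (1 - x))))%:E)%E.
Proof.
move=> x0 q1 uL; pose B := [set l | (L < l)%N].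
have mB := measurable_nat_preimage X B.
have mY : measurable [set w | (u <= real_of R Y w)%R].
  exact: (measurable_nat_preimage Y [set k | u <= k%:R]).
have mG := measurable_Y_gt_X.
apply: (@le_trans _ _ (P (X @^-1` B `|` [set w | (X w ^ 2 < 2 * Y w)%N]))).
  apply: le_measure; rewrite ?inE//; first exact: measurableU.
  move=> w /= uY; have [h|h] := ltnP (X w ^ 2) (2 * Y w); [by right|left].
  apply: uL; apply: (@le_trans _ _ (2 * (Y w)%:R)); first by rewrite ler_pM2l.
  by rewrite -natrX -natrM ler_nat.
apply: (@le_trans _ _ (P (X @^-1` B) + P [set w | (X w ^ 2 < 2 * Y w)%N])%E).
  exact: measureU2.
rewrite Y_le_X adde0.
apply: (nat_preimage_le (p := borel_mass)) => [k|K]; first exact: X_mass.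
rewrite sum_borel_mass; apply: le_trans (sum_bpmf_tail_le L K.-1 x0 q1).
rewrite [leRHS]big_mkcond; apply: ler_sum => l _.
have -> : (l \in B) = (L < l)%N by apply/idP/idP; rewrite inE.
by case: ifP; rewrite ?mul1r ?mul0r.
Qed.
End BorelPair.

(** * Moments and deviations of Borel pairs *)

Section Items.
Variables (R : realType) (mm nn : nat -> nat) (a : R).
Hypothesis lt_nn_mm : forall n : nat, (1 <= n)%N -> (nn n < mm n)%N.
Hypothesis N_cvg : (mm n - nn n)%N @[n --> \oo] --> \oo.
Hypothesis a_gt1 : 1 < a.
Hypothesis ratio_cvg : (mm n)%:R / (mm n - nn n)%:R @[n --> \oo] --> a.
Variables (dX : nat -> measure_display)
  (T : forall n : nat, measurableType (dX n))
  (P : forall n : nat, probability (T n) R)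
  (X Y : forall n : nat, {RV (P n) >-> nat}).
Hypothesis X_borel : forall n : nat, (1 <= n)%N ->
  has_borel_law ((nn n)%:R / (mm n)%:R * expR (- ((nn n)%:R / (mm n)%:R))) (X n).
Hypothesis Y_given_X : forall n : nat, (1 <= n)%N -> forall l k, (1 <= l)%N ->
  P n (X n @^-1` [set l] `&` Y n @^-1` [set k]) =
  (P n (X n @^-1` [set l]) * (unif_mean l l.-1 (fun j => (j == k)%:R))%:E)%E.

Let N n : R := (mm n - nn n)%:R.
Let x n : R := (nn n)%:R / (mm n)%:R.
Let xl : R := 1 - 1 / a.
Let kappa : R := xl - ln xl - 1.
Let beta : R :=
  2 * kappa * Num.sqrt ((1 + 1 / kappa) * (1 + (1 + ln 2) / kappa)).
Let EX n : R := fine 'E_(P n)[real_of R (X n)].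
Let sigma n : R := stddev (P n) (real_of R (X n)).

Lemma xl0 : 0 < xl. Proof. exact: xl_gt0 a_gt1. Qed.
Lemma xl1 : xl < 1. Proof. exact: xl_lt1 a_gt1. Qed.
Lemma kap0 : 0 < kappa. Proof. exact: kappa_gt0 a_gt1. Qed.

Lemma near_ge1 : \forall n \near \oo, (1 <= n)%N.
Proof. exact: nbhs_infty_ge. Qed.

Lemma EX_eq n : (1 <= n)%N -> (0 < nn n)%N -> EX n = (1 - x n)^-1.
Proof.
move=> n1 nn0; have nm := lt_nn_mm n1.
suff -> : EX n = fine ((1 - x n)^-1)%:E by [].
congr fine; apply: (expectation_nat_cvg (g := fun k => k%:R)
  (p := borel_mass R (mm n) (nn n))) => //.
  by move=> k; apply: X_mass => //; exact: X_borel.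
rewrite -(cvg_shiftS _) /=.
rewrite (_ : (fun K => _) =
    (fun K => \sum_(l <- iota 1 K) l%:R * bpmf (x n) l)).
  by apply: bpmf_mean_cvg; rewrite nn0.
by apply/funext => K; rewrite -(sum_borel_mass (mm n) (nn n) (fun k => k%:R) K.+1).
Qed.

Lemma near_x_bounds : \forall n \near \oo,
  [/\ (1 <= n)%N, (0 < nn n)%N, xl / 2 < x n & x n < (1 + xl) / 2].
Proof.
near=> n; have [nn0 _ x2 _] : [/\ (0 < nn n)%N, (nn n < (mm n).-1)%N, xl / 2 < x n & x n < 1].
  by near: n; exact: (near_base lt_nn_mm N_cvg a_gt1 ratio_cvg).
split=> //; first by near: n; exact: near_ge1.
near: n; apply: (near_x_lt lt_nn_mm a_gt1 ratio_cvg).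
by rewrite -/xl; have := xl1; lra.
Unshelve. all: by end_near. Qed.

Lemma near_moment4 : exists M, \forall n \near \oo,
  forall L, \sum_(l <- iota 1 L) l%:R ^+ 4 * bpmf (x n) l <= M.
Proof.
have k0 : 0 < kappa := kap0.
have [B B0 HB] := near_bmoment_le lt_nn_mm N_cvg a_gt1 ratio_cvg k0.
pose rho := expR (- ((kappa + 0) / 2)).
have r1 : rho < 1 by rewrite -expR0 ltr_expR oppr_lt0 divr_gt0// addr0.
have [C C0 HC] := sum_pow4_geometric (expR_ge0 _ : 0 <= rho) r1.
have x0 := xl0; exists (2 / xl * C); near=> n => L.
have [n1 nn0 x2 _] : [/\ (1 <= n)%N, (0 < nn n)%N, xl / 2 < x n & x n < (1 + xl) / 2].
  by near: n; exact: near_x_bounds.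
have [_ q] : bmoment 0 (x n) (mm n) <= B /\ x n * expR (1 - x n) <= rho.
  by near: n; exact: HB.
have xl2 : 0 < xl / 2 by rewrite divr_gt0.
have xn0 : 0 < x n by apply: lt_trans x2.
apply: (le_trans (bpmf_moment4 L xn0 q HC)); apply: ler_wpM2r => //.
by rewrite -[leRHS]invf_div lef_pV2 ?posrE// ltW.
Unshelve. all: by end_near. Qed.

(** All quantities in items 1, 2, 4 and 5 are bounded, with [sigma n] also bounded below, while
    [N n] tends to infinity; those items follow from this. The lower bound uses the atom at 1: the
    mean is at distance [x / (1 - x) >= xl / 2] from it, and its mass is [expR (- x)]. *)
Lemma near_moments : exists v0 C : R, [/\ 0 < v0, 0 <= C &
  \forall n \near \oo, [/\
    v0 <= sigma n ^+ 2 <= C,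
    ('E_(P n)[fun w => (`|real_of R (X n) w - EX n| ^+ 3)%R] <= C%:E)%E,
    ('V_(P n)[real_of R (Y n)] <= C%:E)%E &
    N n * EX n = (mm n)%:R]].
Proof.
have x0 := xl0; have x1 := xl1; have [M HM] := near_moment4.
pose e := (1 - (1 + xl) / 2)^-1.
have e0 : 0 <= e by rewrite invr_ge0; lra.
pose C := (1 + (1 + e) ^+ 3) * `|M| + (2 * `|M| + 2 * `|M| ^+ 2).
have e1 : 1 <= (1 + e) ^+ 3 by rewrite exprn_ege1// lerDl.
exists ((xl / 2) ^+ 2 * expR (- 1)), C; split.
- by rewrite mulr_gt0 ?expR_gt0// exprn_gt0// divr_gt0.
- by rewrite addr_ge0 ?mulr_ge0 ?addr_ge0 ?mulr_ge0 ?exprn_ge0// addr_ge0.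
near=> n.
have [n1 nn0 x2 x3] : [/\ (1 <= n)%N, (0 < nn n)%N, xl / 2 < x n & x n < (1 + xl) / 2].
  by near: n; exact: near_x_bounds.
have nm := lt_nn_mm n1; have hX := X_borel n1; have hY := Y_given_X n1.
have M4 : forall L, \sum_(l <- iota 1 L) l%:R ^+ 4 * bpmf (x n) l <= M.
  by near: n; exact: HM.
have M0 : 0 <= M by have := M4 0%N; rewrite big_nil.
have MN : `|M| = M by rewrite ger0_norm.
have xl2 : 0 < xl / 2 by rewrite divr_gt0.
have xn0 : 0 < x n by apply: lt_trans x2.
have xn1 : 0 < 1 - x n by lra.
have EXe : EX n <= e.
  by rewrite EX_eq// /e lef_pV2 ?posrE//; lra.
have EX0 : 0 <= EX n by rewrite EX_eq// invr_ge0 ltW.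
have Vge := variance_X_ge nm hX.
have Vle := variance_X_le nm hX M4.
have C3 : (1 + EX n) ^+ 3 * M <= C.
  rewrite /C MN; have : (1 + EX n) ^+ 3 <= (1 + e) ^+ 3.
    by apply: lerXn2r; rewrite ?nnegrE ?addr_ge0// lerD2l.
  move=> /(ler_wpM2r M0) h; have : 0 <= M ^+ 2 by rewrite sqr_ge0.
  by lra.
have C2 : (1 + EX n) ^+ 2 * M <= C.
  apply: le_trans C3; apply: ler_wpM2r => //.
  by apply: ler_weXn2l => //; rewrite lerDl.
have fin : 'V_(P n)[real_of R (X n)]%E \is a fin_num.
  rewrite ge0_fin_numE ?variance_ge0//; apply: le_lt_trans Vle _.
  by rewrite ltry.
have s2 : sigma n ^+ 2 = fine 'V_(P n)[real_of R (X n)].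
  by rewrite /sigma /stddev sqr_sqrtr// fine_ge0// variance_ge0.
rewrite -(fineK fin) -s2 !lee_fin -/(EX n) in Vge Vle.
split.
- apply/andP; split; last exact: le_trans C2.
  apply: le_trans Vge; apply: ler_pM; rewrite ?sqr_ge0 ?expR_ge0//.
    rewrite EX_eq//.
    have -> : 1 - (1 - x n)^-1 = - (x n / (1 - x n)) by field; rewrite lt0r_neq0.
    have xd : x n <= x n / (1 - x n).
      by rewrite ler_pdivlMr// ler_piMr ?(ltW xn0)//; lra.
    have xx : xl / 2 <= x n / (1 - x n) by apply: le_trans xd; exact: ltW.
    rewrite sqrrN; apply: lerXn2r; rewrite ?nnegrE ?(ltW xl2)//.
    by apply: le_trans xx; exact: ltW.
  have -> : bpmf (x n) 1 = expR (- x n) by rewrite /bpmf expr0 mulr1 mul1r divr1.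
  by rewrite ler_expR lerN2; lra.
- by apply: le_trans (moment3_X_le nm hX M4) _; rewrite lee_fin.
- apply: le_trans (variance_Y_le nm hX hY M4) _; rewrite lee_fin /C MN.
  by rewrite lerDr mulr_ge0// addr_ge0// exprn_ge0// addr_ge0.
- rewrite EX_eq// /N /x natrB 1?ltnW//.
  have m0 : 0 < (mm n)%:R :> R by rewrite ltr0n; apply: leq_ltn_trans nm.
  have d0 : 0 < (mm n)%:R - (nn n)%:R :> R by rewrite subr_gt0 ltr_nat.
  by field; rewrite !lt0r_neq0.
Unshelve. all: by end_near. Qed.

Lemma near_sqrtN_ge (K : R) : \forall n \near \oo, K <= Num.sqrt (N n).
Proof.
near=> n; have h : `|K| ^+ 2 <= N n by near: n; exact: (near_N_ge N_cvg).
apply: le_trans (ler_norm K) _; rewrite -(ler_pXn2r (n := 2)) ?nnegrE ?sqrtr_ge0//.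
by rewrite sqr_sqrtr//; apply: le_trans h; exact: sqr_ge0.
Unshelve. all: by end_near. Qed.

Lemma log_stddev_littleo :
  elittleo (fun n => lne (sigma n)%:E) (fun n => Num.sqrt (N n)).
Proof.
have [v0 [C [v00 C0 H]]] := near_moments.
move=> eps e0; near=> n.
have [/andP[s1 s2] _ _ _] : [/\ v0 <= sigma n ^+ 2 <= C,
    ('E_(P n)[fun w => (`|real_of R (X n) w - EX n| ^+ 3)%R] <= C%:E)%E,
    ('V_(P n)[real_of R (Y n)] <= C%:E)%E &
    N n * EX n = (mm n)%:R] by near: n; exact: H.
have sN : (`|ln v0| + `|ln C|) / eps <= Num.sqrt (N n) by near: n; exact: near_sqrtN_ge.
have s2p : 0 < sigma n ^+ 2 by apply: lt_le_trans s1.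
have s0 : 0 < sigma n.
  by rewrite lt_neqAle sqrtr_ge0 andbT eq_sym; apply/eqP => s0; rewrite s0 expr0n ltxx in s2p.
rewrite lne_EFin// abse_EFin lee_fin [`|Num.sqrt _|]ger0_norm ?sqrtr_ge0//.
apply: (@le_trans _ _ (`|ln v0| + `|ln C|)); last first.
  by rewrite [leRHS]mulrC -ler_pdivrMr.
have l1 : ln v0 <= ln (sigma n ^+ 2) by rewrite ler_ln ?posrE.
have l2 : ln (sigma n ^+ 2) <= ln C.
  by rewrite ler_ln ?posrE//; apply: lt_le_trans s2.
rewrite lnXn// mulr2n in l1 l2.
have := ler_norm (ln C); have := ler_norm (- ln v0); rewrite normrN.
have := normr_ge0 (ln v0); have := normr_ge0 (ln C).
rewrite ler_norml; move=> h1 h2 h3 h4; apply/andP; split; lra.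
Unshelve. all: by end_near. Qed.

Lemma moment3_littleo :
  elittleo (fun n => 'E_(P n)[fun w => (`|real_of R (X n) w - EX n| ^+ 3)%R]%E)
    (fun n => Num.sqrt (N n) * sigma n ^+ 3).
Proof.
have [v0 [C [v00 C0 H]]] := near_moments.
move=> eps e0; near=> n.
have [/andP[s1 s2] m3 _ _] : [/\ v0 <= sigma n ^+ 2 <= C,
    ('E_(P n)[fun w => (`|real_of R (X n) w - EX n| ^+ 3)%R] <= C%:E)%E,
    ('V_(P n)[real_of R (Y n)] <= C%:E)%E &
    N n * EX n = (mm n)%:R] by near: n; exact: H.
pose t0 := Num.sqrt v0; have t00 : 0 < t0 by rewrite sqrtr_gt0.
have sN : C / (eps * t0 ^+ 3) <= Num.sqrt (N n) by near: n; exact: near_sqrtN_ge.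
have st : t0 <= sigma n.
  rewrite -(ler_pXn2r (n := 2)) ?nnegrE ?sqrtr_ge0//.
  by rewrite sqr_sqrtr// ltW.
have s0 : 0 <= sigma n by apply: le_trans st; exact: ltW.
rewrite gee0_abs; last by apply: expectation_ge0 => w; exact: exprn_ge0.
apply: (le_trans m3); rewrite lee_fin ger0_norm ?mulr_ge0 ?sqrtr_ge0 ?exprn_ge0//.
move: sN; rewrite ler_pdivrMr ?mulr_gt0 ?exprn_gt0// => h; apply: (le_trans h).
rewrite mulrCA ler_pM2l//; apply: ler_wpM2l; first exact: sqrtr_ge0.
by apply: lerXn2r; rewrite ?nnegrE// ltW.
Unshelve. all: by end_near. Qed.

Lemma variance_Y_littleo :
  elittleo (fun n => 'V_(P n)[real_of R (Y n)]%E) (fun n => Num.sqrt (N n)).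
Proof.
have [v0 [C [v00 C0 H]]] := near_moments.
move=> eps e0; near=> n.
have [_ _ vY _] : [/\ v0 <= sigma n ^+ 2 <= C,
    ('E_(P n)[fun w => (`|real_of R (X n) w - EX n| ^+ 3)%R] <= C%:E)%E,
    ('V_(P n)[real_of R (Y n)] <= C%:E)%E &
    N n * EX n = (mm n)%:R] by near: n; exact: H.
have sN : C / eps <= Num.sqrt (N n) by near: n; exact: near_sqrtN_ge.
rewrite gee0_abs ?variance_ge0//; apply: (le_trans vY).
by rewrite lee_fin ger0_norm ?sqrtr_ge0// [leRHS]mulrC -ler_pdivrMr.
Unshelve. all: by end_near. Qed.

Lemma mean_bigO :
  (fun n => (mm n)%:R - N n * EX n : R) =O_\oo
    (fun n => sigma n * Num.sqrt (N n) : R).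
Proof.
have [v0 [C [v00 C0 H]]] := near_moments.
apply/eqOP; near=> k; near=> n.
have [_ _ _ ->] : [/\ v0 <= sigma n ^+ 2 <= C,
    ('E_(P n)[fun w => (`|real_of R (X n) w - EX n| ^+ 3)%R] <= C%:E)%E,
    ('V_(P n)[real_of R (Y n)] <= C%:E)%E &
    N n * EX n = (mm n)%:R] by near: n; exact: H.
by rewrite subrr normr0 mulr_ge0.
Unshelve. all: by end_near. Qed.

Lemma expectation_X0 n (g : nat -> R) : (1 <= n)%N -> nn n = 0%N ->
  (forall k, 0 <= g k) -> ('E_(P n)[fun w => g (X n w)] = (g 1%N)%:E)%E.
Proof.
move=> n1 nn0 g0; have nm := lt_nn_mm n1.
apply: (expectation_nat_cvg (p := borel_mass R (mm n) (nn n))) => //.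
  by move=> k; apply: X_mass => //; exact: X_borel.
apply: cvg_near_cst; near=> K; rewrite sum_borel_mass nn0 mul0r.
have K2 : (1 < K)%N by near: K; exact: nbhs_infty_gt.
have -> : K.-1 = (1 + (K.-1 - 1))%N by move: K2; clear; lia.
move: (K.-1 - 1)%N => j; rewrite iotaD big_cat /= big_cons big_nil addr0.
have -> : \sum_(l <- iota 2 j) g l * bpmf 0 l = 0; last first.
  by rewrite addr0 /bpmf mulr0 oppr0 expR0 expr0 divr1 !mulr1.
rewrite big1_seq// => l /andP[_]; rewrite mem_iota => l2.
rewrite /bpmf mulr0 expr0n (_ : (l.-1 == 0)%N = false) ?mulr0 ?mul0r ?mulr0//.
by move: l2; clear; lia.
Unshelve. all: by end_near. Qed.

(** Item 3 concerns all [n], including those without balls, where the length is almost surely 1. *)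
Lemma sigma0 n : (1 <= n)%N -> nn n = 0%N -> sigma n = 0.
Proof.
move=> n1 nn0; rewrite /sigma /stddev (@variance_nat _ _ _ _ _ (EX n))//.
have -> : EX n = 1.
  by rewrite /EX (expectation_X0 (g := fun k => k%:R)).
rewrite (expectation_X0 (g := fun k => (k%:R - 1) ^+ 2))// => [|k].
  by rewrite subrr expr0n sqrtr0.
exact: sqr_ge0.
Qed.

Lemma exists_pos_lower_bound (c : nat -> R) (c0 : R) : (forall n, 0 < c n) ->
  0 < c0 -> (\forall n \near \oo, c0 <= c n) ->
  exists2 b, 0 < b & forall n, b <= c n.
Proof.
move=> c_gt0 c00 [M _ HM].
have [b b0 Hb] : exists2 b, 0 < b & forall n, (n < M)%N -> b <= c n.
  elim: M {HM} => [|M [b b0 Hb]]; first by exists 1.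
  exists (Num.min b (c M)) => [|n]; first by rewrite lt_min b0 c_gt0.
  rewrite ltnS leq_eqVlt => /orP[/eqP->|nM]; rewrite ge_min ?lexx ?orbT//.
  by rewrite Hb.
exists (Num.min b c0) => [|n]; first by rewrite lt_min b0.
have [Mn|nM] := leqP M n; first by rewrite ge_min HM ?orbT.
by rewrite ge_min Hb.
Qed.

Lemma char_fun_bound : exists c : R, 0 < c /\
  forall n : nat, (1 <= n)%N -> forall s : R, - pi <= s <= pi ->
    ComplexField.Normc.normc (char_fun (P n) (real_of R (X n)) s)
      <= 1 - c * sigma n ^+ 2 * s ^+ 2.
Proof.
pose p n := borel_mass R (mm n) (nn n).
pose mu n := Num.min (p n 1%N) (p n 2%N).
have p1 n : p n 1%N = expR (- x n).
  by rewrite /p /borel_mass /= /bpmf expr0 mulr1 mul1r divr1.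
have p2 n : p n 2%N = x n * expR (- (2 * x n)).
  rewrite /p /borel_mass /= /bpmf expr1 (_ : 2`! = 2)%N//.
  by rewrite -/(x n); field.
have mu0 n : 0 <= mu n.
  by rewrite le_min p1 p2 expR_ge0 mulr_ge0 ?expR_ge0// divr_ge0.
(* For each [n] this constant works: without balls [sigma n = 0], and otherwise [char_fun_le]
   applies, the summand 1 keeping the denominator positive. It stays away from 0 for large [n], and
   finitely many [n] remain. *)
pose c n := if nn n == 0%N then 1 else
  if (1 <= n)%N then mu n / (16 * (sigma n ^+ 2 + 1)) else 1.
have s1 n : 0 < sigma n ^+ 2 + 1 by rewrite ltr_wpDl ?sqr_ge0.
have c_gt0 n : 0 < c n.
  rewrite /c; case: eqP => // nn0; case: ifP => // n1.
  rewrite divr_gt0 ?mulr_gt0// lt_min p1 p2 expR_gt0 mulr_gt0 ?expR_gt0//.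
  have nm := lt_nn_mm n1; rewrite divr_gt0 ?ltr0n ?lt0n//; first exact/eqP.
  by move: nm; case: (mm n).
have [v0 [C [v00 C0 H]]] := near_moments.
have x0 := xl0; have x1 := xl1; have xl2 : 0 < xl / 2 by rewrite divr_gt0.
pose m0 := xl / 2 * expR (- 2); pose c0 := Num.min 1 (m0 / (16 * (C + 1))).
have m00 : 0 < m0 by rewrite mulr_gt0 ?expR_gt0.
have C1 : 0 < C + 1 by rewrite ltr_wpDl.
have c00 : 0 < c0 by rewrite lt_min ltr01 divr_gt0// mulr_gt0.
have nc : \forall n \near \oo, c0 <= c n.
  near=> n.
  have [n1 nn0 x2 x3] : [/\ (1 <= n)%N, (0 < nn n)%N, xl / 2 < x n & x n < (1 + xl) / 2].
    by near: n; exact: near_x_bounds.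
  have [/andP[_ s2] _ _ _] : [/\ v0 <= sigma n ^+ 2 <= C,
    ('E_(P n)[fun w => (`|real_of R (X n) w - EX n| ^+ 3)%R] <= C%:E)%E,
    ('V_(P n)[real_of R (Y n)] <= C%:E)%E &
    N n * EX n = (mm n)%:R] by near: n; exact: H.
  rewrite /c n1 (negbTE (lt0n_neq0 nn0)) /c0 ge_min; apply/orP; right.
  apply: ler_pM; first exact: ltW.
  - by rewrite invr_ge0 mulr_ge0// ltW.
  - have h2 : m0 <= x n * expR (- (2 * x n)).
      apply: ler_pM; rewrite ?expR_ge0 ?(ltW xl2) ?(ltW x2)//.
      by rewrite ler_expR lerN2; lra.
    rewrite le_min p1 p2 h2 andbT; apply: (le_trans h2).
    apply: (@le_trans _ _ (1 * expR (- (2 * x n)))).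
      by rewrite ler_wpM2r ?expR_ge0//; lra.
    by rewrite mul1r ler_expR lerN2; lra.
  by rewrite lef_pV2 ?posrE ?mulr_gt0// ler_pM2l// lerD2r.
have [b b0 Hb] := exists_pos_lower_bound c_gt0 c00 nc.
exists b; split=> // n n1 s sp.
have nm := lt_nn_mm n1.
have pE k : P n (X n @^-1` [set k]) = (p n k)%:E.
  by apply: X_mass => //; exact: X_borel.
apply: (le_trans (char_fun_le pE sp)); rewrite lerD2l lerN2 -/(mu n).
have [nn0|nn0] := eqVneq (nn n) 0%N.
  rewrite sigma0// expr0n mulr0 mul0r.
  by rewrite mulr_ge0// divr_ge0// sqr_ge0.
have cE : c n = mu n / (16 * (sigma n ^+ 2 + 1)) by rewrite /c (negbTE nn0) n1.
have -> : mu n * (s ^+ 2 / 16) = mu n / 16 * s ^+ 2 by field.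
rewrite ler_wpM2r ?sqr_ge0//.
apply: (@le_trans _ _ (c n * (sigma n ^+ 2 + 1))).
  apply: ler_pM; rewrite ?sqr_ge0 ?(ltW b0) ?Hb// lerDl//.
by rewrite cE le_eqVlt; apply/orP; left; apply/eqP; field; rewrite lt0r_neq0.
Unshelve. all: by end_near. Qed.

Lemma le_lne (p : \bar R) (t : R) : ((expR t)%:E <= p -> t%:E <= lne p)%E.
Proof.
case: p => [p| |]//; last by move=> _; rewrite /= leey.
rewrite lee_fin => h; have p0 : 0 < p by apply: lt_le_trans h; exact: expR_gt0.
by rewrite lne_EFin// lee_fin -ler_expR lnK ?posrE.
Qed.

Lemma lne_le (p : \bar R) (t : R) : (p <= (expR t)%:E -> lne p <= t%:E)%E.
Proof.
case: p => [p| |]//; last by move=> _; rewrite le0_lneNy ?leNye.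
rewrite lee_fin => h; have [p0|p0] := ltP 0 p; last first.
  by rewrite le0_lneNy ?leNye// lee_fin.
by rewrite lne_EFin// lee_fin -ler_expR lnK ?posrE.
Qed.

Lemma Y_rate_ge (y : R) : 0 < y ->
  ((- beta)%:E <= limn_einf (fun n =>
     ((Num.sqrt (N n * y))^-1)%:E *
     lne (P n [set w | (N n * y <= real_of R (Y n) w)%R])))%E.
Proof.
move=> y0; apply: limn_einf_ge => delta d0.
have sy0 : 0 < Num.sqrt y by rewrite sqrtr_gt0.
have dy0 : 0 < delta * Num.sqrt y by rewrite mulr_gt0.
have [K K0 HK] := near_block lt_nn_mm N_cvg a_gt1 ratio_cvg y0 dy0.
near=> n.
have [u [w [wu uw _ big]]] : exists u w : nat,
  [/\ (w <= u)%N, N n * y <= (u * w)%:R, (u + w).+1%:R <= K * Num.sqrt (N n) &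
   expR (- (Num.sqrt (N n) * (beta * Num.sqrt y + delta * Num.sqrt y))) <=
   expR (- ((u + w).+1%:R * x n)) * x n ^+ (u + w) /
     ((u + w).+1%:R * 2 ^+ w)].
  by near: n; exact: HK.
have n1 : (1 <= n)%N by near: n; exact: near_ge1.
have N1 : 1 <= N n by near: n; exact: (near_N_ge N_cvg).
have N0 : 0 < N n by apply: lt_le_trans N1.
have nm := lt_nn_mm n1; have hX := X_borel n1; have hY := Y_given_X n1.
have sE : Num.sqrt (N n * y) = Num.sqrt (N n) * Num.sqrt y by rewrite sqrtrM// ltW.
have s0 : 0 < Num.sqrt (N n * y) by rewrite sqrtr_gt0 mulr_gt0.
have key : ((- (Num.sqrt (N n * y) * (beta + delta)))%:E <=
    lne (P n [set w | (N n * y <= real_of R (Y n) w)%R]))%E.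
  apply: le_lne; have := Y_tail_ge nm hX hY (u * w) (isT : (0 < (u + w).+1)%N).
  have mY : measurable [set w | (N n * y <= real_of R (Y n) w)%R].
    exact: (measurable_nat_preimage (Y n) [set k | N n * y <= k%:R]).
  move=> h; apply: (@le_trans _ _ (P n (Y n @^-1` [set k | (u * w <= k)%N]))).
    apply: le_trans h; rewrite lee_fin.
    have -> : Num.sqrt (N n * y) * (beta + delta) =
      Num.sqrt (N n) * (beta * Num.sqrt y + delta * Num.sqrt y) by rewrite sE; ring.
    apply: (le_trans big); apply: bpmf_unif_mean_ge_uw => //.
    by rewrite divr_ge0.
  apply: le_measure; rewrite ?inE//; first exact: measurable_nat_preimage.
  by move=> z /= uwY; apply: (le_trans uw); rewrite ler_nat.
have i0 : (0 <= ((Num.sqrt (N n * y))^-1)%:E)%E by rewrite lee_fin invr_ge0 ltW.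
apply: le_trans (lee_wpmul2l i0 key); rewrite -EFinM lee_fin.
rewrite mulrN mulrA mulVf ?lt0r_neq0// mul1r; lra.
Unshelve. all: by end_near. Qed.

(** [Y >= u] forces [X >= sqrt (2 u)]. The constants of the geometric tail are negligible uniformly
    in [u], because even the smallest [u] allowed tends to infinity. *)
Lemma Y_rate_le (y : R) : 0 < y ->
  (limn_esup (fun n => ereal_sup
     [set (((Num.sqrt u)^-1)%:E *
       lne (P n [set w | (u <= real_of R (Y n) w)%R]))%E
     | u in [set u : R | (Num.sqrt (N n * y) <= u)%R]])
   <= (- (kappa * Num.sqrt 2))%:E)%E.
Proof.
move=> y0; apply: limn_esup_le => delta d0; have k0 := kap0.
have s2 : 0 < Num.sqrt 2 :> R by rewrite sqrtr_gt0.
have s2' : Num.sqrt 2 <= 2 :> R.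
  by rewrite -(ler_pXn2r (n := 2)) ?nnegrE ?sqrtr_ge0// sqr_sqrtr// expr2; lra.
pose eta := Num.min kappa (delta / 2).
have eta0 : 0 < eta by rewrite lt_min k0 divr_gt0.
have etak : eta <= kappa by rewrite ge_min lexx.
have etad : eta <= delta / 2 by rewrite ge_min lexx orbT.
pose k1 := kappa - eta; have kk : k1 < kappa by rewrite /k1; lra.
pose k' := (kappa + k1) / 2; have k'0 : 0 < k' by rewrite /k' /k1; lra.
have [B B0 HB] := near_bmoment_le lt_nn_mm N_cvg a_gt1 ratio_cvg kk.
have x0 := xl0; have xl2 : 0 < xl / 2 by rewrite divr_gt0.
pose rho := expR (- k'); have r1 : rho < 1 by rewrite -expR0 ltr_expR oppr_lt0.
pose C := 2 / xl / (1 - rho).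
have r1' : 0 < 1 - rho by rewrite subr_gt0.
have C0 : 0 < C by rewrite divr_gt0// divr_gt0.
pose c1 := ln C + 2 * k'.
near=> n; apply: ge_ereal_sup => _ [u /= uN <-].
have n1 : (1 <= n)%N by near: n; exact: near_ge1.
have nm := lt_nn_mm n1; have hX := X_borel n1; have hY := Y_given_X n1.
have [_ nn0 x2 x3] : [/\ (1 <= n)%N, (0 < nn n)%N, xl / 2 < x n & x n < (1 + xl) / 2].
  by near: n; exact: near_x_bounds.
have [_ q] : bmoment k1 (x n) (mm n) <= B /\ x n * expR (1 - x n) <= rho.
  by near: n; exact: HB.
have xn0 : 0 < x n by apply: lt_trans x2.
have Nbig : ((2 * `|c1| / delta + 1) ^+ 2) / Num.sqrt y <= Num.sqrt (N n).
  by near: n; exact: near_sqrtN_ge.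
have N1 : 1 <= N n by near: n; exact: (near_N_ge N_cvg).
have sy0 : 0 < Num.sqrt y by rewrite sqrtr_gt0.
have ub : (2 * `|c1| / delta + 1) ^+ 2 <= u.
  apply: le_trans uN; rewrite sqrtrM; last by apply: le_trans N1.
  by rewrite -ler_pdivrMr.
have cd0 : 0 <= 2 * `|c1| / delta by rewrite divr_ge0 ?mulr_ge0// ltW.
have u1 : 1 <= u.
  by apply: le_trans ub; rewrite exprn_ege1// lerDr.
have u0 : 0 < u by apply: lt_le_trans u1.
set su := Num.sqrt u; have su0 : 0 < su by rewrite sqrtr_gt0.
have uE : u = su ^+ 2 by rewrite sqr_sqrtr// ltW.
have sub : 2 * `|c1| / delta <= su.
  apply: (@le_trans _ _ (2 * `|c1| / delta + 1)); first by rewrite lerDl.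
  by rewrite -(ler_pXn2r (n := 2)) ?nnegrE ?sqrtr_ge0 -?uE// addr_ge0.
pose t := Num.truncn (Num.sqrt 2 * su); pose L := t.-1.
have ss0 : 0 <= Num.sqrt 2 * su by rewrite mulr_ge0// ltW.
have uL (l : nat) : 2 * u <= l%:R ^+ 2 -> (L < l)%N.
  move=> h; have l0 : (0 < l)%N.
    rewrite lt0n; apply/eqP => l0; move: h; rewrite l0 expr0n /=.
    by rewrite leNgt mulr_gt0.
  have : Num.sqrt 2 * su <= l%:R.
    rewrite -(ler_pXn2r (n := 2)) ?nnegrE// exprMn sqr_sqrtr// -uE//.
  move=> h2; have : (t <= l)%N.
    by rewrite -(ler_nat R); apply: le_trans h2; rewrite truncn_le.
  by rewrite /L; move: l0; clear; lia.
have q1 : x n * expR (1 - x n) < 1 by apply: le_lt_trans r1.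
have q0 : 0 <= x n * expR (1 - x n) by rewrite mulr_ge0 ?expR_ge0// ltW.
have Ltail := Y_tail_le nm hX hY xn0 q1 uL.
have LL : Num.sqrt 2 * su - 2 <= L%:R.
  have h1 : Num.sqrt 2 * su < t.+1%:R by exact: truncnS_gt.
  have h2 : t%:R <= L%:R + 1 :> R.
    by rewrite natr1 ler_nat /L; clear; lia.
  by rewrite -natr1 in h1; lra.
have key : (lne (P n [set w | (u <= real_of R (Y n) w)%R]) <=
    (c1 - k' * (Num.sqrt 2 * su))%:E)%E.
  apply: lne_le.
  apply: (le_trans Ltail); rewrite lee_fin.
  have -> : expR (c1 - k' * (Num.sqrt 2 * su)) =
    2 / xl * (expR (- (k' * (Num.sqrt 2 * su - 2))) / (1 - rho)).
    have -> : c1 - k' * (Num.sqrt 2 * su) =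
      ln C + (- (k' * (Num.sqrt 2 * su - 2))) by rewrite /c1; ring.
    by rewrite expRD lnK ?posrE// /C; field; rewrite !lt0r_neq0.
  have q1' : 0 <= 1 - x n * expR (1 - x n) by rewrite subr_ge0; exact: ltW q1.
  apply: ler_pM.
  - by rewrite invr_ge0 ltW.
  - by apply: divr_ge0 => //; exact: exprn_ge0.
  - by rewrite -[leRHS]invf_div lef_pV2 ?posrE// ltW.
  apply: ler_pM; rewrite ?exprn_ge0 ?invr_ge0//; last first.
    by rewrite lef_pV2 ?posrE ?subr_gt0// lerD2l lerN2.
  apply: (@le_trans _ _ (rho ^+ L)).
    by apply: lerXn2r; rewrite ?nnegrE// expR_ge0.
  rewrite expRn ler_expR mulrN lerN2 [L%:R * _]mulrC.
  by apply: ler_wpM2l => //; exact: ltW.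
have i0 : (0 <= (su^-1)%:E)%E by rewrite lee_fin invr_ge0 ltW.
apply: (le_trans (lee_wpmul2l i0 key)); rewrite -EFinM lee_fin.
rewrite mulrC ler_pdivrMr//.
have h1 : k' * Num.sqrt 2 >= kappa * Num.sqrt 2 - delta / 2.
  have -> : k' = kappa - eta / 2 by rewrite /k' /k1; field.
  have : eta / 2 * Num.sqrt 2 <= delta / 4 * 2.
    by apply: ler_pM; [rewrite divr_ge0// ltW|exact: ltW|lra|exact: s2'].
  by lra.
have h2 : `|c1| <= delta / 2 * su.
  by move: sub; rewrite ler_pdivrMr//; lra.
have h3 := ler_norm c1; have h4 := ler_wpM2r (ltW su0) h1.
lra.
Unshelve. all: by end_near. Qed.

Let meanD n : R := unif_mean (mm n) (nn n) (fun k => k%:R).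
Let tail (y : R) n : R :=
  unif_mean (mm n) (nn n) (fun k => (meanD n + N n * y <= k%:R)%R%:R).

Lemma near_deviation_ge (y delta : R) : 0 < y -> 0 < delta ->
  \forall n \near \oo, ((- beta * Num.sqrt y - delta)%:E <=
    ((Num.sqrt (N n))^-1)%:E * lne (tail y n)%:E)%E.
Proof.
move=> y0 d0; have H := near_lower_tail lt_nn_mm N_cvg a_gt1 ratio_cvg y0 d0.
near=> n.
have N1 : 1 <= N n by near: n; exact: (near_N_ge N_cvg).
have s0 : 0 < Num.sqrt (N n) by rewrite sqrtr_gt0; apply: lt_le_trans N1.
have h : expR (- (Num.sqrt (N n) * (beta * Num.sqrt y + delta))) <= tail y n.
  by near: n; exact: H.
have i0 : (0 <= ((Num.sqrt (N n))^-1)%:E)%E by rewrite lee_fin invr_ge0 ltW.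
have key := le_lne (h : ((_)%:E <= (tail y n)%:E)%E).
apply: le_trans (lee_wpmul2l i0 key); rewrite -EFinM lee_fin.
by rewrite mulrN mulrA mulVf ?lt0r_neq0// mul1r; lra.
Unshelve. all: by end_near. Qed.

Lemma near_deviation_le (y delta : R) : 0 < y -> 0 < delta ->
  \forall n \near \oo, (((Num.sqrt (N n))^-1)%:E * lne (tail y n)%:E <=
    (- (kappa * Num.sqrt 2) * Num.sqrt y + delta)%:E)%E.
Proof.
move=> y0 d0; have k0 := kap0.
have sy0 : 0 < Num.sqrt y by rewrite sqrtr_gt0.
have d2 : 0 < delta / 2 by rewrite divr_gt0.
(* Lowering [y] by [eps = t ^+ 2 / 2] pays for a mean as small as [N * (meanY - eps)]. The first
   bound on [t] keeps the loss in the exponent below [delta / 2], the second keeps [y'] positive. *)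
pose t := Num.min (delta / (2 * kappa)) (Num.sqrt y).
have t0 : 0 < t by rewrite lt_min sy0 divr_gt0// mulr_gt0.
have td : kappa * t <= delta / 2.
  apply: (@le_trans _ _ (kappa * (delta / (2 * kappa)))).
    by rewrite ler_pM2l// ge_min lexx.
  by rewrite le_eqVlt; apply/orP; left; apply/eqP; field; exact: lt0r_neq0.
have ty : t ^+ 2 <= y.
  rewrite -[leRHS]sqr_sqrtr ?(ltW y0)//; apply: lerXn2r; rewrite ?nnegrE ?(ltW t0) ?(ltW sy0)//.
  by rewrite ge_min lexx orbT.
have t20 : 0 < t ^+ 2 by rewrite exprn_gt0.
pose eps := t ^+ 2 / 2; have e0 : 0 < eps by rewrite divr_gt0.
pose y' := y - eps; have y'0 : 0 < y' by rewrite /y' /eps; lra.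
have s2y : Num.sqrt 2 * Num.sqrt y <= Num.sqrt (2 * y') + t.
  rewrite -sqrtrM//; have -> : 2 * y = 2 * y' + t ^+ 2 by rewrite /y' /eps; field.
  by apply: sqrtrD_sqr_le; rewrite ?mulr_ge0// ltW.
have up := near_upper_tail lt_nn_mm N_cvg a_gt1 ratio_cvg y'0 d2.
have mean := near_meanD_ge lt_nn_mm N_cvg a_gt1 ratio_cvg e0.
near=> n.
have N1 : 1 <= N n by near: n; exact: (near_N_ge N_cvg).
have N0 : 0 < N n by apply: lt_le_trans N1.
have s0 : 0 < Num.sqrt (N n) by rewrite sqrtr_gt0.
have upn : unif_mean (mm n) (nn n)
    (fun k => (N n * (bmean (x n) (mm n) + y') <= k%:R)%R%:R) <=
    expR (- (Num.sqrt (N n) * (kappa * Num.sqrt (2 * y') - delta / 2))).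
  by near: n; exact: up.
have mn : N n * (bmean (x n) (mm n) - eps) <= meanD n by near: n; exact: mean.
have h : tail y n <=
    expR (- (Num.sqrt (N n) * (kappa * Num.sqrt (2 * y') - delta / 2))).
  apply: le_trans upn; apply: unif_mean_le => k.
  case: (lerP (meanD n + N n * y) k%:R) => hk; last exact: ler0n.
  rewrite (le_trans _ hk)//; apply: le_trans (lerD mn (lexx (N n * y))).
  by rewrite -mulrDr ler_pM2l// /y'; lra.
have i0 : (0 <= ((Num.sqrt (N n))^-1)%:E)%E by rewrite lee_fin invr_ge0 ltW.
have key := lne_le (h : ((tail y n)%:E <= (_)%:E)%E).
apply: (le_trans (lee_wpmul2l i0 key)); rewrite -EFinM lee_fin.
rewrite mulrN mulrA mulVf ?lt0r_neq0// mul1r.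
have := ler_wpM2l (ltW k0) s2y; lra.
Unshelve. all: by end_near. Qed.
End Items.

(** * The mean of the total displacement *)

Section HashExpectation.
Context d (T : measurableType d) (R : realType) (Q : probability T R).
Variables (m n : nat) (h : 'I_n -> {RV Q >-> nat}).
Hypothesis h_unif : forall i, uniform_on_urns m (h i).
Hypothesis h_indep : mutually_independent h.
Hypothesis m_gt0 : (0 < m)%N.

Lemma hash_displacement_expectation :
  ('E_Q[real_of R (hash_displacement m h)] =
   (unif_mean m n (fun k => k%:R))%:E)%E.
Proof.
have law := hash_displacement_prob h_unif h_indep m_gt0.
have mZ : measurable_fun setT (hash_displacement m h).
  move=> _ B _; rewrite setTI.
  have [+ _] := law (fun k => k \in B); rewrite (_ : [set w | _] =
    hash_displacement m h @^-1` B)//.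
  by apply/seteqP; split=> w /=; rewrite inE.
pose Z : {RV Q >-> nat} := mfun_Sub (mem_set mZ : _ \in mfun).
apply: (@expectation_nat_cvg _ _ _ Q Z (fun k => k%:R)
  (fun k => unif_mean m n (fun j => (j == k)%:R))) => // [k|].
  have [_ <-] := law (pred1 k); congr (Q _).
  by apply/seteqP; split=> w /= /eqP.
apply: cvg_near_cst; near=> K.
have Kn : (n ^ 2 < K)%N by near: K; exact: nbhs_infty_gt.
have -> : \sum_(k <- iota 0 K) k%:R * unif_mean m n (fun j => (j == k)%:R) =
    unif_mean m n (fun j => \sum_(k <- iota 0 K) k%:R * (j == k)%:R) :> R.
  rewrite /unif_mean exchange_big mulr_sumr; apply: eq_bigr => k _ /=.
  by rewrite mulrCA mulr_sumr.
apply: unif_mean_eq => j jn; have jK : (j < K)%N by move: jn Kn; clear; lia.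
rewrite (bigD1_seq j) ?iota_uniq ?mem_iota//= eqxx mulr1 big1 ?addr0// => k kj.
by rewrite eq_sym (negbTE kj) mulr0.
Unshelve. all: by end_near. Qed.
End HashExpectation.

Theorem proposition3p3 (R : realType)
  (* i.i.d. uniform addresses of the n balls, for all 0 <= n < m *)
  (dH : nat -> nat -> measure_display)
  (H : forall m n : nat, measurableType (dH m n))
  (Q : forall m n : nat, probability (H m n) R)
  (h : forall m n : nat, 'I_n -> {RV (Q m n) >-> nat})
  (h_uniform : forall m n : nat, (n < m)%N ->
     forall i : 'I_n, uniform_on_urns m (h m n i))
  (h_indep : forall m n : nat, (n < m)%N -> mutually_independent (h m n))
  (* the integers m_n, n_n and the limit a *)
  (mm nn : nat -> nat) (a : R)
  (lt_nn_mm : forall n : nat, (1 <= n)%N -> (nn n < mm n)%N)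
  (N_cvg : (mm n - nn n)%N @[n --> \oo] --> \oo)
  (a_ge1 : 1 <= a)
  (ratio_cvg : (mm n)%:R / (mm n - nn n)%:R @[n --> \oo] --> a)
  (lam_ge : (2 * expR 1)^-1 <= (1 - 1 / a) * expR (- 1 + 1 / a))
  (* the random variables X^(n), Y^(n) *)
  (dX : nat -> measure_display)
  (T : forall n : nat, measurableType (dX n))
  (P : forall n : nat, probability (T n) R)
  (X Y : forall n : nat, {RV (P n) >-> nat})
  (X_borel : forall n : nat, (1 <= n)%N ->
     has_borel_law ((nn n)%:R / (mm n)%:R * expR (- ((nn n)%:R / (mm n)%:R)))
       (X n))
  (Y_given_X : forall n : nat, (1 <= n)%N -> forall l k : nat, (1 <= l)%N ->
     P n (X n @^-1` [set l] `&` Y n @^-1` [set k]) =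
     (P n (X n @^-1` [set l]) *
      Q l l.-1 [set w | hash_displacement l (h l l.-1) w = k])%E) :
  let N : nat -> R := fun n => (mm n - nn n)%:R in
  let lam : R := (1 - 1 / a) * expR (- 1 + 1 / a) in
  let kappa : R := - ln lam - 1 in
  let alpha : R := kappa * Num.sqrt 2 in
  let beta : R :=
    2 * kappa * Num.sqrt ((1 + 1 / kappa) * (1 + (1 + ln 2) / kappa)) in
  let kk : nat -> nat := mm in
  let XR : forall n, T n -> R := fun n => real_of R (X n) in
  let YR : forall n, T n -> R := fun n => real_of R (Y n) in
  let EX : nat -> R := fun n => fine 'E_(P n)[XR n] in
  let sigma : nat -> R := fun n => stddev (P n) (XR n) in
  let D : forall n, H (mm n) (nn n) -> R :=
    fun n => real_of R (hash_displacement (mm n) (h (mm n) (nn n))) in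
  let ED : nat -> R := fun n => fine 'E_(Q (mm n) (nn n))[D n] in
  let tailD : R -> nat -> \bar R := fun y n =>
    (((Num.sqrt (N n))^-1)%:E *
     lne (Q (mm n) (nn n) [set w | (N n * y <= D n w - ED n)%R]))%E in
  [/\ (* 1 *)
      elittleo (fun n => lne (sigma n)%:E) (fun n => Num.sqrt (N n)),
      (* 2 *)
      elittleo (fun n => 'E_(P n)[fun w => (`|XR n w - EX n| ^+ 3)%R]%E)
        (fun n => Num.sqrt (N n) * sigma n ^+ 3),
      (* 3 *)
      exists c : R, 0 < c /\
        forall n : nat, (1 <= n)%N -> forall s : R, - pi <= s <= pi ->
          ComplexField.Normc.normc (char_fun (P n) (XR n) s)
            <= 1 - c * sigma n ^+ 2 * s ^+ 2 &
      (* 4 *)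
      (fun n => (kk n)%:R - N n * EX n : R) =O_\oo
        (fun n => sigma n * Num.sqrt (N n) : R) ] /\
  [/\ (* 5 *)
      elittleo (fun n => 'V_(P n)[YR n]%E) (fun n => Num.sqrt (N n)),
      (* 6 *)
      forall y : R, 0 < y ->
        ((- beta)%:E <= limn_einf (fun n =>
           ((Num.sqrt (N n * y))^-1)%:E *
           lne (P n [set w | (N n * y <= YR n w)%R])))%E /\
        (limn_esup (fun n => ereal_sup
           [set (((Num.sqrt u)^-1)%:E * lne (P n [set w | (u <= YR n w)%R]))%E
             | u in [set u : R | (Num.sqrt (N n * y) <= u)%R]])
         <= (- alpha)%:E)%E &
      (* deviations of the total displacement *)
      forall y : R, 0 < y ->
        [/\ ((- beta * Num.sqrt y)%:E <= limn_einf (tailD y))%E,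
            (limn_einf (tailD y) <= limn_esup (tailD y))%E &
            (limn_esup (tailD y) <= (- alpha * Num.sqrt y)%:E)%E ] ].
Proof.
move=> N lam kappa alpha beta kk XR YR EX sigma D ED tailD.
(* [a = 1] would give [lam = 0], against the lower bound on [lam]. *)
have a_gt1 : 1 < a.
  rewrite lt_neqAle a_ge1 andbT; apply/eqP => a1; move: lam_ge.
  rewrite -a1 divr1 subrr mul0r leNgt invr_gt0 mulr_gt0 ?expR_gt0//.
have hash_law l n (p : pred nat) : (n < l)%N ->
    measurable [set w | p (hash_displacement l (h l n) w)] /\
    Q l n [set w | p (hash_displacement l (h l n) w)] =
    (unif_mean l n (fun k => (p k)%:R))%:E.
  move=> nl; apply: hash_displacement_prob; first exact: h_uniform.
    exact: h_indep.
  exact: leq_ltn_trans nl.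
have YX n : (1 <= n)%N -> forall l k, (1 <= l)%N ->
    P n (X n @^-1` [set l] `&` Y n @^-1` [set k]) =
    (P n (X n @^-1` [set l]) * (unif_mean l l.-1 (fun j => (j == k)%:R))%:E)%E.
  move=> n1 l k l1; rewrite Y_given_X//; congr (_ * _)%E.
  have ll : (l.-1 < l)%N by rewrite prednK.
  have [_ <-] := hash_law l l.-1 (pred1 k) ll; congr (Q _ _ _).
  by apply/seteqP; split=> w /= /eqP.
have hk : kappa = 1 - 1 / a - ln (1 - 1 / a) - 1.
  have x0 := xl_gt0 a_gt1.
  rewrite /kappa /lam lnM ?posrE ?expR_gt0// expRK; ring.
have DE n : (1 <= n)%N ->
    ED n = unif_mean (mm n) (nn n) (fun k => k%:R).
  move=> n1; have nm := lt_nn_mm n n1; rewrite /ED /D.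
  by rewrite (hash_displacement_expectation (h_uniform _ _ nm) (h_indep _ _ nm))//; lia.
have tailE y n : (1 <= n)%N -> tailD y n =
    (((Num.sqrt (N n))^-1)%:E * lne (unif_mean (mm n) (nn n) (fun k =>
      (unif_mean (mm n) (nn n) (fun k => k%:R) + N n * y <= k%:R)%R%:R))%:E)%E.
  move=> n1; have nm := lt_nn_mm n n1.
  have [_ <-] := hash_law (mm n) (nn n) (fun k =>
    unif_mean (mm n) (nn n) (fun k => k%:R) + N n * y <= k%:R) nm.
  rewrite /tailD DE//; congr (_ * lne (Q _ _ _))%E.
  by apply/seteqP; split=> w /=; rewrite lerBrDl.
have ge1 : \forall n \near \oo, (1 <= n)%N by exact: nbhs_infty_ge.
split; split.
- exact: (log_stddev_littleo lt_nn_mm N_cvg a_gt1 ratio_cvg X_borel YX).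
- exact: (moment3_littleo lt_nn_mm N_cvg a_gt1 ratio_cvg X_borel YX).
- exact: (char_fun_bound lt_nn_mm N_cvg a_gt1 ratio_cvg X_borel YX).
- exact: (mean_bigO lt_nn_mm N_cvg a_gt1 ratio_cvg X_borel YX).
- exact: (variance_Y_littleo lt_nn_mm N_cvg a_gt1 ratio_cvg X_borel YX).
- move=> y y0; rewrite /alpha /beta hk; split.
    exact: (Y_rate_ge lt_nn_mm N_cvg a_gt1 ratio_cvg X_borel YX y0).
  exact: (Y_rate_le lt_nn_mm N_cvg a_gt1 ratio_cvg X_borel YX y0).
move=> y y0; split; last 1 first.
- apply: limn_esup_le => delta d0; rewrite /alpha hk.
  near=> n; have n1 : (1 <= n)%N by near: n; exact: ge1.
  rewrite tailE//; near: n.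
  exact: (near_deviation_le lt_nn_mm N_cvg a_gt1 ratio_cvg y0 d0).
- apply: limn_einf_ge => delta d0; rewrite /beta hk.
  near=> n; have n1 : (1 <= n)%N by near: n; exact: ge1.
  rewrite tailE//; near: n.
  exact: (near_deviation_ge lt_nn_mm N_cvg a_gt1 ratio_cvg y0 d0).
- exact: limn_einf_sup.
Unshelve. all: by end_near. Qed.
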